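(* Let $d\ge 2$ be an integer and let $\beta,\gamma,p$ be real parameters such that $\gamma-2<\beta<\frac{d-2}{d}\gamma$, $\gamma<d$ and $p\in(1,p_\star]$ with $p_\star=\frac{d-\gamma}{d-2-\beta}$. If $$\gamma<0\quad\mbox{and}\quad \beta_{\rm FS}(\gamma)<\beta<\frac{d-2}{d}\,\gamma,\qquad\mbox{where}\quad \beta_{\rm FS}(\gamma)=d-2-\sqrt{(d-\gamma)^2-4(d-1)},$$ then symmetry breaking holds, that is, $$\mathsf C_{\beta,\gamma,p}>\mathsf C^\star_{\beta,\gamma,p}.$$
   Context: Notation: $\|w\|_{\mathrm L^{q,\gamma}(\mathbb R^d)}=\left(\int_{\mathbb R^d}|w|^q\,|x|^{-\gamma}\,dx\right)^{1/q}$. $C_0^\infty(\mathbb R^d)$ denotes the space of smooth functions on $\mathbb R^d$ which converge to zero as $|x|\to\infty$, and $C^\infty_{0,\mathrm{rad}}(\mathbb R^d)$ its subset of radial functions. With $$\vartheta=\frac{(d-\gamma)(p-1)}{p\,(d+2+\beta-2\gamma-p(d-2-\beta))},$$ $\mathsf C_{\beta,\gamma,p}$ is the best (smallest) constant in the Caffarelli-Kohn-Nirenberg inequality $$\|w\|_{\mathrm L^{2p,\gamma}(\mathbb R^d)}\le \mathsf C_{\beta,\gamma,p}\,\|\nabla w\|_{\mathrm L^{2,\beta}(\mathbb R^d)}^\vartheta\,\|w\|_{\mathrm L^{p+1,\gamma}(\mathbb R^d)}^{1-\vartheta}\quad\forall\,w\in C_0^\infty(\mathbb R^d),$$ and $\mathsf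 C^\star_{\beta,\gamma,p}$ is the best constant in the same inequality restricted to $w\in C^\infty_{0,\mathrm{rad}}(\mathbb R^d)$. *)

(* Defs.v *)
From HB Require Import structures.
From mathcomp Require Import all_boot all_order all_algebra.
From mathcomp Require Import all_classical all_reals all_analysis.

Set Implicit Arguments.
Unset Strict Implicit.
Unset Printing Implicit Defensive.

Import Order.TTheory GRing.Theory Num.Theory.
Import numFieldNormedType.Exports.

Local Open Scope classical_set_scope.
Local Open Scope ring_scope.

Section power_measure.
Context dsp (T : measurableType dsp) (R : realType).

Definition cons_pair n (x : T * n.-tuple T) : n.+1.-tuple T :=
  [tuple of x.1 :: x.2].

Lemma measurable_cons_pair n : measurable_fun setT (@cons_pair n).
Proof. exact: measurable_cons. Qed.

Lemma measurable_uncons n :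
  measurable_fun setT
    (fun t : n.+1.-tuple T => (thead t, [tuple of behead t])).
Proof.
apply/measurable_fun_pair; last exact: measurable_behead.
exact: measurable_tnth.
Qed.

Section step.
Variables (m : {sigma_finite_measure set T -> \bar R}) (n : nat)
  (mu : {sigma_finite_measure set (n.-tuple T) -> \bar R}).

Definition power_step : set (n.+1.-tuple T) -> \bar R :=
  pushforward (m \x mu)%E (@cons_pair n).

Let step0 : power_step set0 = 0%E.
Proof. by rewrite /power_step /pushforward preimage_set0 measure0. Qed.

Let step_ge0 A : (0 <= power_step A)%E.
Proof. by rewrite /power_step /pushforward measure_ge0. Qed.

Let step_sigma_additive : semi_sigma_additive power_step.
Proof.
move=> F mF tF mUF; rewrite /power_step /pushforward preimage_bigcup.
apply: measure_semi_sigma_additive.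
- by move=> i; rewrite -[X in measurable X]setTI; exact: measurable_cons_pair.
- apply/trivIsetP => /= i j _ _ ij; rewrite -preimage_setI.
  by move/trivIsetP : tF => /(_ _ _ _ _ ij) ->//; rewrite preimage_set0.
- rewrite -preimage_bigcup -[X in measurable X]setTI.
  exact: measurable_cons_pair.
Qed.

HB.instance Definition _ := isMeasure.Build _ _ _ power_step
  step0 step_ge0 step_sigma_additive.

(* The library's sigma-finite instance on [m1 \x m2] is shadowed by the one on
   products of subprobabilities, so it is not found by unification. *)
Let product_sigma_finite : sigma_finite setT (m \x mu)%E.
Proof.
have /sigma_finiteP[F [TF ndF Foo]] := sigma_finiteT m.
have /sigma_finiteP[G [TG ndG Goo]] := sigma_finiteT mu.
exists (fun k => F k `*` G k).
  rewrite -setXTT TF TG predeqE => -[x y]; split.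
    move=> [/= [i _ Fix] [k _ Gky]]; exists (maxn i k) => //; split.
    - by move: x Fix; exact/subsetPset/ndF/leq_maxl.
    - by move: y Gky; exact/subsetPset/ndG/leq_maxr.
  by move=> [k _ []/= ? ?]; split; exists k.
move=> k; have [? ?] := Foo k; have [? ?] := Goo k.
split; first exact: measurableX.
by rewrite product_measure1E// lte_mul_pinfty// ge0_fin_numE.
Qed.

Let step_sigma_finite : sigma_finite setT power_step.
Proof.
have [F FT Foo] := product_sigma_finite.
pose u (t : n.+1.-tuple T) := (thead t, [tuple of behead t]).
exists (fun i => u @^-1` F i).
  by rewrite -preimage_bigcup -FT preimage_setT.
move=> i; have [mF Ffin] := Foo i; split.
  by rewrite -[X in measurable X]setTI; exact: measurable_uncons.
rewrite /power_step /pushforward -comp_preimage.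
rewrite (_ : u \o _ = id) ?preimage_id//.
apply/funext => -[x t]; rewrite /u /cons_pair/=; congr pair.
exact/val_inj.
Qed.

HB.instance Definition _ := Measure_isSigmaFinite.Build _ _ _ power_step
  step_sigma_finite.

End step.

Definition dirac_nil : set (0.-tuple T) -> \bar R :=
  @dirac _ (0.-tuple T) [tuple] R.
HB.instance Definition _ := SigmaFiniteMeasure.on dirac_nil.

Fixpoint power_measure (m : {sigma_finite_measure set T -> \bar R}) (n : nat) :
    {sigma_finite_measure set (n.-tuple T) -> \bar R} :=
  match n with
  | 0 => dirac_nil
  | k.+1 => power_step m (power_measure m k)
  end.

Lemma power_measure_box m n (A : 'I_n -> set T) :
  (forall i, measurable (A i)) ->
  power_measure m n [set t | forall i, A i (tnth t i)] =
  (\prod_(i < n) m (A i))%E.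
Proof.
elim: n A => [|n IH] A mA /=.
  by rewrite big_ord0 /dirac_nil diracE mem_set// => -[].
rewrite big_ord_recl -IH//.
rewrite /power_step /pushforward.
have -> : @cons_pair n @^-1` [set t | forall i, A i (tnth t i)] =
    A ord0 `*` [set t | forall i, A (lift ord0 i) (tnth t i)].
  apply/seteqP; split => -[x t] /= H.
    by split=> [|i]; [have := H ord0 | have := H (lift ord0 i); rewrite tnthS].
  move=> i; case: (unliftP ord0 i) => [j ->|->]; last exact: H.1.
  by rewrite tnthS; exact: H.2.
rewrite product_measure1E//.
rewrite (_ : [set t | _] = \bigcap_(i in [set: 'I_n])
   ((fun t : n.-tuple T => tnth t i) @^-1` A (lift ord0 i))).
  apply: fin_bigcap_measurable => // i _.
  by rewrite -[X in measurable X]setTI; exact: measurable_tnth.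
by apply/seteqP; split=> t /= H i; [move=> _|]; exact: H.
Qed.

End power_measure.

(* Lebesgue measure on [R^n], with [R^n] represented by tuples because
   ['rV[R]_n] carries no measurable structure. *)
Definition lebesgue_tuple (R : realType) (n : nat) :=
  power_measure (@lebesgue_measure R) n.

Section ckn.
Context (R : realType) (d : nat).
Implicit Types (w : 'rV[R]_d -> R) (x : 'rV[R]_d).

(* The library norm on ['rV[R]_d] is the sup norm. *)
Definition enorm x : R := Num.sqrt (\sum_i x 0 i ^+ 2).

Definition partial (i : 'I_d) w x : R := 'D_(delta_mx 0 i) w x.

Definition grad w x : 'rV[R]_d := \row_i partial i w x.

Fixpoint Ck (k : nat) w : Prop :=
  match k with
  | 0 => continuous w
  | l.+1 => (forall x, differentiable w x) /\ forall i, Ck l (partial i w)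
  end.

Definition smooth w : Prop := forall k, Ck k w.

Definition vanishes_at_infinity w : Prop :=
  forall e, 0 < e -> exists M, forall x, M <= enorm x -> `|w x| < e.

Definition radial w : Prop := forall x y, enorm x = enorm y -> w x = w y.

(* Smooth functions tending to 0 at infinity, not necessarily compactly
   supported. *)
Definition C0infty : set ('rV[R]_d -> R) :=
  [set w | smooth w /\ vanishes_at_infinity w].

Definition C0infty_rad : set ('rV[R]_d -> R) := C0infty `&` radial.

(* Since [0 `^ r = 0] for [r != 0], the weight is 0 at the origin, a null set,
   even when [g > 0]. The norm is [+oo] when the integral diverges. *)
Definition wnorm (q g : R) (w : 'rV[R]_d -> R) : \bar R :=
  poweR (\int[lebesgue_tuple R d]_(t in setT)
    (`|w (\row_i tnth t i)| `^ q * enorm (\row_i tnth t i) `^ (- g))%:E)%E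
    q^-1.

Definition theta (beta gamma p : R) : R :=
  (d%:R - gamma) * (p - 1) /
  (p * (d%:R + 2 + beta - 2 * gamma - p * (d%:R - 2 - beta))).

(* In [\bar R], [0 * +oo = 0] and [poweR +oo 0 = 1]. The former is harmless:
   if [w] in [C0infty] has a null factor on the right-hand side then [w = 0].
   The latter is the convention needed when [theta = 1]. *)
Definition CKN_ineq (beta gamma p C : R) w : Prop :=
  (wnorm (2 * p) gamma w <=
   C%:E * poweR (wnorm 2 beta (fun x => enorm (grad w x))) (theta beta gamma p)
        * poweR (wnorm (p + 1) gamma w) (1 - theta beta gamma p))%E.

(* Best constant for the functions in [K]; [+oo] if no constant works. *)
Definition best_constant (K : set ('rV[R]_d -> R)) (beta gamma p : R) : \bar R :=
  ereal_inf [set C%:E | C in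
    [set C : R | forall w, K w -> CKN_ineq beta gamma p C w]].

Definition C_CKN := best_constant C0infty.

Definition C_CKN_rad := best_constant C0infty_rad.

Definition p_star (beta gamma : R) : R := (d%:R - gamma) / (d%:R - 2 - beta).

Definition beta_FS (gamma : R) : R :=
  d%:R - 2 - Num.sqrt ((d%:R - gamma) ^+ 2 - 4 * (d%:R - 1)).

End ckn.

Arguments theta {R} d beta gamma p.
Arguments C_CKN {R} d beta gamma p.
Arguments C_CKN_rad {R} d beta gamma p.
Arguments p_star {R} d beta gamma.
Arguments beta_FS {R} d gamma.

(* Main.v *)
Require Import Defs.
From HB Require Import structures.
From mathcomp Require Import all_boot all_order all_algebra perm.
From mathcomp Require Import all_classical all_reals all_analysis.
From mathcomp Require Import measurable_realfun.
From mathcomp Require Import ring lra.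

Set Implicit Arguments.
Unset Strict Implicit.
Unset Printing Implicit Defensive.

Import Order.TTheory GRing.Theory Num.Theory.
Import numFieldNormedType.Exports.

Local Open Scope classical_set_scope.
Local Open Scope ring_scope.

(** Write N = d - gamma, al = 1 + (beta - gamma)/2, n = N/al and
    m = 2p/(p - 1); the hypotheses give d < n <= m. The proof compares both
    best constants with the quotient Lam of the radial function
    f = (1 + |x|^(2 al))^(-1/(p - 1)).

    Radial functions satisfy the inequality with the constant Lam
    [radial_CKN_ineq]. In the volume coordinate y = |x|^N the weighted integral
    of |w|^q becomes a multiple of the integral of |psi|^q dy on the half-line
    [integral_polar], and the gradient integral becomes one of
    psi'^2 y^(2 - 2/n), whatever the value of d: the radial problem is a
    Gagliardo--Nirenberg inequality in the possibly fractional dimension n. It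
    is proved by mass transport: |psi|^(2p) is transported to
    (1 + y^(2/n))^(-m), the arithmetic--geometric mean inequality bounds the
    Jacobian [transport_pointwise], an integration by parts and Young's
    inequality bring in the gradient [calibration], and two free scales are
    optimised at the end [sharp_of_family]. Neither the existence of an
    optimiser nor its uniqueness enters.

    The radial extremal is then perturbed in the direction of a spherical
    harmonic of degree one, as f + e x_1 g with
    x_1 g = x_1 |x|^(al - 1) (1 + |x|^(2 al))^(-m/2), the mode that carries the
    first instability. By reflection the terms odd in x_1 integrate to zero, and
    x_1^2 averages to |x|^2/d over spheres [integral_coord_sqr], so at second
    order in e everything reduces to the integrals of (1 + |x|^(2 al))^(-j),
    which are linked by a recursion in j [Jprof_rec]. The quotient increases at
    second order exactly when al^2 (n - 1) > d - 1 [second_variation], and this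
    is the hypothesis beta_FS < beta once squares are completed [FS_cond].

    As |x|^al is not smooth at the origin, |x|^2 is replaced by |x|^2 + h with
    h > 0. The functions so obtained are smooth [tame_smooth], and dominated
    convergence as h -> 0 [val_density_cvg], [grad_density_cvg] transfers the
    strict inequality to some h > 0 [trial_beats_radial]. *)

(** * Lebesgue measure on tuples: uniqueness and symmetries *)

Section lebesgue_tuple_symmetries.
Context (R : realType).
Notation MR := (measurableTypeR R).
Notation mu := (@lebesgue_measure R).

Definition tbox n (A : 'I_n -> set MR) : set (n.-tuple MR) :=
  [set t | forall i, A i (tnth t i)].

Lemma tbox_bigcap n (A : 'I_n -> set MR) :
  tbox A = \bigcap_(i in [set: 'I_n]) ((fun t : n.-tuple MR => tnth t i) @^-1` A i).
Proof. by apply/seteqP; split=> t /= H i; [move=> _|]; exact: H. Qed.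

Lemma measurable_tbox n (A : 'I_n -> set MR) :
  (forall i, measurable (A i)) -> measurable (tbox A).
Proof.
move=> mA; rewrite tbox_bigcap; apply: fin_bigcap_measurable => // i _.
by rewrite -[X in measurable X]setTI; exact: measurable_tnth.
Qed.

(** Boxes generate the product sigma-algebra, are stable under intersection, and
    exhaust the space by sets of finite measure. *)
Lemma lebesgue_tuple_unique n (m : {measure set (n.-tuple MR) -> \bar R}) :
  (forall A : 'I_n -> set MR, (forall i, measurable (A i)) ->
    m (tbox A) = (\prod_(i < n) mu (A i))%E) ->
  forall A, measurable A -> m A = lebesgue_tuple R n A.
Proof.
move=> mbox A mA.
pose G := [set B : set (n.-tuple MR) |
  exists2 C : 'I_n -> set MR, (forall i, measurable (C i)) & B = tbox C].
apply: (@g_sigma_algebra_measure_unique _ _ _ G _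
  (fun k => tbox (fun _ : 'I_n => `[- k%:R, k%:R]%classic))).
- by move=> _ [C mC ->]; exact: measurable_tbox.
- by move=> k; exists (fun=> `[- k%:R, k%:R]%classic) => // i; exact: measurable_itv.
- apply/seteqP; split => // t _.
  have [k kP] : exists k, forall i : 'I_n, `|tnth t i| <= k%:R :> R.
    exists (\max_(i < n) (Num.trunc `|tnth t i|).+1)%N => i.
    apply: (@le_trans _ _ (Num.trunc `|tnth t i|).+1%:R).
      by rewrite ltW// truncnS_gt.
    by rewrite ler_nat (@leq_bigmax _ (fun i : 'I_n => (Num.trunc `|tnth t i|).+1) i).
  by exists k => // i /=; rewrite in_itv/= -ler_norml; exact: kP.
- move=> _ _ [C mC ->] [D mD ->]; exists (fun i => C i `&` D i).
    by move=> i; exact: measurableI.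
  apply/seteqP; split => [t [Ct Dt] i|t CDt]; first by split; [exact: Ct|exact: Dt].
  by split=> i; have [] := CDt i.
- by move=> _ [C mC ->]; rewrite mbox//; exact/esym/power_measure_box.
- move=> k; rewrite mbox//.
  suff : (\prod_(i < n) mu (`[(- k%:R)%R, k%:R%R]%classic : set R))%E \is a fin_num.
    by rewrite fin_numE => /andP[_]; rewrite ltey.
  apply: (@big_ind _ (fun x : \bar R => x \is a fin_num)) => //.
  + by move=> x y; exact: fin_numM.
  + by move=> i _; rewrite lebesgue_measure_itv/=; case: ifP.
- move: mA; apply: smallest_sub.
    by apply: smallest_sigma_algebra.
  apply: (@big_ind _ (fun X => X `<=` <<s G >>)) => //.
    by move=> X Y XG YG Z [/XG|/YG].
  move=> i _ _ [B mB <-]; apply: sub_sigma_algebra.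
  exists (fun j => if j == i then B else setT) => [j|]; first by case: ifP.
  rewrite setTI; apply/seteqP; split => [t /= Bt j|t /(_ i)]; last by rewrite eqxx.
  by case: eqP => // ->.
Qed.

(** By uniqueness of the measure, a map only has to be tested on preimages of
    boxes. *)
Lemma tuple_change_of_variables n (phi : n.-tuple MR -> n.-tuple MR) (c : R) :
  0 < c -> measurable_fun setT phi ->
  (forall A : 'I_n -> set MR, (forall i, measurable (A i)) ->
    lebesgue_tuple R n (phi @^-1` tbox A) = (c%:E * \prod_(i < n) mu (A i))%E) ->
  forall f : n.-tuple MR -> \bar R, measurable_fun setT f -> (forall t, 0 <= f t)%E ->
  (\int[lebesgue_tuple R n]_t f (phi t) = c%:E * \int[lebesgue_tuple R n]_t f t)%E.
Proof.
move=> c0 mphi phiE f mf f0.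
have ci0 : 0 <= c^-1 by rewrite invr_ge0 ltW.
pose pm : {measure set (n.-tuple MR) -> \bar R} :=
  measure_function_pushforward__canonical__measure_function_Measure
    (lebesgue_tuple R n) mphi.
pose m : {measure set (n.-tuple MR) -> \bar R} :=
  mscale (NngNum ci0) pm.
have mE : forall A, measurable A -> m A = lebesgue_tuple R n A.
  apply: lebesgue_tuple_unique => A mA.
  have -> : m (tbox A) = (c^-1%:E * lebesgue_tuple R n (phi @^-1` tbox A))%E by [].
  by rewrite phiE// muleA -EFinM mulVf ?gt_eqF// mul1e.
have -> : (\int[lebesgue_tuple R n]_t f t = \int[m]_t f t)%E.
  by apply: eq_measure_integral => A mA _; rewrite mE.
rewrite ge0_integral_mscale//= muleA -EFinM mulfV ?gt_eqF// mul1e.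
by rewrite ge0_integral_pushforward.
Qed.

Lemma measurable_tuple_coord n m (phi : m.-tuple MR -> n.-tuple MR)
    (g : 'I_n -> MR -> MR) (s : 'I_n -> 'I_m) :
  (forall t i, tnth (phi t) i = g i (tnth t (s i))) ->
  (forall i, measurable_fun setT (g i)) -> measurable_fun setT phi.
Proof.
move=> phiE mg; apply/measurable_fun_tnthP => i.
rewrite (_ : _ \o phi = g i \o (fun t => tnth t (s i))); last first.
  by apply/funext => t /=; rewrite phiE.
by apply: measurableT_comp => //; exact: measurable_tnth.
Qed.

Definition tflip n (i0 : 'I_n) (t : n.-tuple MR) : n.-tuple MR :=
  [tuple if i == i0 then - tnth t i else tnth t i | i < n].

Lemma integral_tflip n (i0 : 'I_n) (f : n.-tuple MR -> \bar R) :
  measurable_fun setT f -> (forall t, 0 <= f t)%E ->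
  (\int[lebesgue_tuple R n]_t f (tflip i0 t) = \int[lebesgue_tuple R n]_t f t)%E.
Proof.
move=> mf f0; rewrite -[RHS]mul1e.
apply: (@tuple_change_of_variables _ (tflip i0) 1) => //.
  apply: (@measurable_tuple_coord _ _ _
    (fun i x => if i == i0 then - x else x) id) => [t i|i].
    by rewrite tnth_mktuple.
  by case: (i == i0); [exact: oppr_measurable|exact: measurable_id].
move=> A mA; rewrite mul1e.
rewrite (_ : _ @^-1` _ = tbox (fun i => if i == i0 then -%R @^-1` A i else A i)).
  rewrite power_measure_box; last first.
    move=> i; case: ifP => // _; rewrite -[X in measurable X]setTI.
    exact: (@oppr_measurable R setT measurableT _ (mA i)).
  by apply: eq_bigr => i _; case: ifP => // _; exact: (lebesgue_measureN (mA i)).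
apply/seteqP; split => t /= + i => /(_ i); rewrite tnth_mktuple;
  by case: ifP.
Qed.

Definition tswap n (i0 j0 : 'I_n) (t : n.-tuple MR) : n.-tuple MR :=
  [tuple tnth t (tperm i0 j0 i) | i < n].

Lemma integral_tswap n (i0 j0 : 'I_n) (f : n.-tuple MR -> \bar R) :
  measurable_fun setT f -> (forall t, 0 <= f t)%E ->
  (\int[lebesgue_tuple R n]_t f (tswap i0 j0 t) = \int[lebesgue_tuple R n]_t f t)%E.
Proof.
move=> mf f0; rewrite -[RHS]mul1e.
apply: (@tuple_change_of_variables _ (tswap i0 j0) 1) => //.
  apply: (@measurable_tuple_coord _ _ _ (fun=> id) (tperm i0 j0)) => [t i|i].
    by rewrite tnth_mktuple.
  exact: measurable_id.
move=> A mA; rewrite mul1e.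
rewrite (_ : _ @^-1` _ = tbox (fun i => A (tperm i0 j0 i))).
  rewrite power_measure_box// [RHS](reindex_inj (@perm_inj _ (tperm i0 j0))).
  by [].
apply/seteqP; split => t /= + i => /(_ (tperm i0 j0 i)); rewrite !tnth_mktuple tpermK//.
Qed.

Lemma lebesgue_measure_scale (r : R) (A : set MR) : 0 < r -> measurable A ->
  mu ( *%R r @^-1` A) = (r^-1%:E * mu A)%E.
Proof.
move=> r0 mA.
have mulm : measurable_fun [set: MR] (( *%R r) : MR -> MR).
  exact: mulrl_measurable.
pose pm : {measure set MR -> \bar R} :=
  measure_function_pushforward__canonical__measure_function_Measure
    mu mulm.
pose m : {measure set MR -> \bar R} :=
  mscale (NngNum (ltW r0)) pm.
have mE B : m B = (r%:E * mu ( *%R r @^-1` B))%E by [].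
rewrite (@lebesgue_measure_unique _ m _ A)//.
  by rewrite mE muleA -EFinM mulVf ?gt_eqF// mul1e.
move=> _ [[a b] _ <-]; rewrite mE.
rewrite (_ : _ @^-1` _ = `]a / r, b / r]%classic); last first.
  apply/seteqP; split => x /=; rewrite !in_itv/= ltr_pdivrMr// ler_pdivlMr//;
  by rewrite !(mulrC x).
rewrite !lebesgue_measure_itv/= !lte_fin ltr_pM2r ?invr_gt0//.
case: ifPn => _; last by rewrite mule0.
by rewrite -!EFinB -EFinM; congr EFin; field; rewrite gt_eqF.
Qed.

Definition tscale n (r : R) (t : n.-tuple MR) : n.-tuple MR :=
  [tuple r * tnth t i | i < n].

Lemma integral_tscale n (r : R) (f : n.-tuple MR -> \bar R) : 0 < r ->
  measurable_fun setT f -> (forall t, 0 <= f t)%E ->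
  (\int[lebesgue_tuple R n]_t f (tscale r t) =
   (r ^- n)%:E * \int[lebesgue_tuple R n]_t f t)%E.
Proof.
move=> r0 mf f0.
apply: (@tuple_change_of_variables _ (tscale r)) => //.
- by rewrite invr_gt0 exprn_gt0.
- apply: (@measurable_tuple_coord _ _ _ (fun=> *%R r) id) => [t i|i].
    by rewrite tnth_mktuple.
  exact: mulrl_measurable.
move=> A mA.
rewrite (_ : _ @^-1` _ = tbox (fun i => *%R r @^-1` A i)).
  rewrite power_measure_box; last first.
    by move=> i; rewrite -[X in measurable X]setTI; exact: (@mulrl_measurable R setT r measurableT _ (mA i)).
  transitivity (\prod_(i < n) (r^-1%:E * mu (A i)))%E.
    by apply: eq_bigr => i _; exact: lebesgue_measure_scale.
  rewrite big_split/=; congr (_ * _)%E.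
  by rewrite prodEFin prodr_const card_ord exprVn.
by apply/seteqP; split => t /= + i => /(_ i); rewrite tnth_mktuple.
Qed.

End lebesgue_tuple_symmetries.

(** * Integration in the variable |x|^N *)

Section density.
Context d (T : measurableType d) (R : realType) (m : {measure set T -> \bar R}).
Variable h : T -> \bar R.
Hypotheses (mh : measurable_fun setT h) (h0 : forall x, (0 <= h x)%E).

Definition density_measure (A : set T) : \bar R := (\int[m]_(x in A) h x)%E.

Let density0 : density_measure set0 = 0%E.
Proof. by rewrite /density_measure integral_set0. Qed.

Let density_ge0 A : (0 <= density_measure A)%E.
Proof. by apply: integral_ge0 => x _; exact: h0. Qed.

Let density_sigma_additive : semi_sigma_additive density_measure.
Proof.
move=> F mF tF mUF; rewrite /density_measure ge0_integral_bigcup//.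
- by apply: is_cvg_nneseries => n _ _; exact: density_ge0.
- exact: measurable_funTS.
Qed.

HB.instance Definition _ := isMeasure.Build _ _ _ density_measure
  density0 density_ge0 density_sigma_additive.

Definition density : {measure set T -> \bar R} := density_measure.

End density.

Section polar.
Context (R : realType) (d : nat).
Notation MR := (measurableTypeR R).
Notation mu := (@lebesgue_measure R).
Notation lam := (lebesgue_tuple R d).
Implicit Types t : d.-tuple MR.

Definition tx t : 'rV[R]_d := \row_i tnth t i.

Definition tnorm t : R := enorm (tx t).

Lemma tnormE t : tnorm t = Num.sqrt (\sum_i (tnth t i : R) ^+ 2).
Proof.
by rewrite /tnorm /enorm; congr Num.sqrt; apply: eq_bigr => i _; rewrite mxE.
Qed.

Lemma tnorm_ge0 t : 0 <= tnorm t. Proof. exact: sqrtr_ge0. Qed.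

Lemma measurable_tnth_real (i : 'I_d) :
  measurable_fun [set: d.-tuple MR] (fun t => tnth t i : R).
Proof. exact: measurable_tnth. Qed.

Lemma measurable_sqrt : measurable_fun [set: R] (@Num.sqrt R).
Proof. by apply: continuous_measurable_fun; exact: sqrt_continuous. Qed.

Lemma measurable_tnorm : measurable_fun [set: d.-tuple MR] tnorm.
Proof.
rewrite (_ : tnorm = fun t => Num.sqrt (\sum_i (tnth t i : R) ^+ 2)); last first.
  by apply/funext => t; exact: tnormE.
apply: (measurableT_comp measurable_sqrt).
apply: measurable_sum => i; apply: measurable_funX.
exact: measurable_tnth_real.
Qed.

Lemma tnorm_tscale (r : R) t : 0 <= r -> tnorm (tscale r t) = r * tnorm t.
Proof.
move=> r0; rewrite !tnormE -[X in _ = X * _](ger0_norm r0) -sqrtr_sqr -sqrtrM ?sqr_ge0// mulr_sumr.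
by congr Num.sqrt; apply: eq_bigr => i _; rewrite tnth_mktuple exprMn.
Qed.

Lemma tnorm_flip (i0 : 'I_d) t : tnorm (tflip i0 t) = tnorm t.
Proof.
rewrite !tnormE; congr Num.sqrt; apply: eq_bigr => i _; rewrite tnth_mktuple.
by case: ifP => // _; rewrite sqrrN.
Qed.

Lemma tnorm_swap (i0 j0 : 'I_d) t : tnorm (tswap i0 j0 t) = tnorm t.
Proof.
rewrite !tnormE [in RHS](reindex_inj (@perm_inj _ (tperm i0 j0)))/=.
by congr Num.sqrt; apply: eq_bigr => i _; rewrite tnth_mktuple.
Qed.

Lemma tnth_sqr_le t i : (tnth t i : R) ^+ 2 <= tnorm t ^+ 2.
Proof.
rewrite tnormE sqr_sqrtr ?sumr_ge0// => [|j _]; last exact: sqr_ge0.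
by rewrite (bigD1 i)//= lerDl sumr_ge0// => j _; exact: sqr_ge0.
Qed.

Section weight.
Variable g : R.
Hypotheses (g0 : g <= 0) (d0 : (0 < d)%N).
Let N := d%:R - g.

Let N_gt0 : 0 < N.
Proof. by rewrite /N subr_gt0 (le_lt_trans g0)// ltr0n. Qed.

Definition tweight t : \bar R := (tnorm t `^ (- g))%:E.

Lemma measurable_tweight : measurable_fun [set: d.-tuple MR] tweight.
Proof.
apply/measurable_EFinP.
by apply: (measurableT_comp (measurable_powR (- g))); exact: measurable_tnorm.
Qed.

Lemma tweight_ge0 t : (0 <= tweight t)%E.
Proof. by rewrite lee_fin powR_ge0. Qed.

Definition tdensity := density lam measurable_tweight tweight_ge0.

Definition tball (a : R) : set (d.-tuple MR) := [set t | tnorm t < a].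

Lemma measurable_tball a : measurable (tball a).
Proof.
rewrite (_ : tball a = tnorm @^-1` `]-oo, a[).
  by rewrite -[X in measurable X]setTI; apply: measurable_tnorm => //.
by apply/seteqP; split => t; rewrite /tball /= in_itv.
Qed.

(** Homogeneity: a dilation by a multiplies Lebesgue measure by a^d and the
    weight by a^(-g). *)
Lemma tdensity_ball a : 0 < a -> tdensity (tball a) = ((a `^ N)%:E * tdensity (tball 1))%E.
Proof.
move=> a0; have ai0 : 0 < a^-1 by rewrite invr_gt0.
have mf b : measurable_fun [set: d.-tuple MR] (tweight \_ (tball b)).
  apply/(measurable_restrictT _ (measurable_tball b)).
  by apply: measurable_funTS; exact: measurable_tweight.
have f0 b t : (0 <= (tweight \_ (tball b)) t)%E.
  by rewrite patchE; case: ifP => // _; exact: tweight_ge0.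
have := integral_tscale ai0 (mf 1) (f0 1).
have -> : (fun t => (tweight \_ (tball 1)) (tscale a^-1 t)) =
    (fun t => (a `^ g)%:E * (tweight \_ (tball a)) t)%E.
  apply/funext => t; rewrite !patchE.
  rewrite (_ : (tscale a^-1 t \in tball 1) = (t \in tball a)); last first.
    have tE : (tnorm (tscale a^-1 t) < 1) = (tnorm t < a).
      by rewrite tnorm_tscale ?ltW// mulrC ltr_pdivrMr// mul1r.
    by apply/idP/idP; rewrite !inE /tball /= tE.
  case: ifP => _; last by rewrite mule0.
  rewrite /tweight tnorm_tscale ?(ltW ai0)// powRM ?(ltW ai0) ?tnorm_ge0// -EFinM.
  by rewrite -powR_inv1 ?(ltW a0)// -powRrM mulrN mulN1r opprK.
rewrite ge0_integralZl_EFin ?powR_ge0//.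
rewrite -!integral_mkcond -/(tdensity _) -/(tdensity _).
rewrite exprVn invrK => VE.
rewrite /N powRD; last by rewrite gt_eqF ?implybT.
rewrite powR_mulrn ?(ltW a0)// powRN EFinM muleAC -VE muleAC -EFinM.
by rewrite divff ?mul1e// gt_eqF// powR_gt0.
Qed.

(** For g <= 0 the weight is at most 1 on the unit ball, and the ball lies in a
    cube of side 2. *)
Lemma tdensity_ball_fin : (tdensity (tball 1) < +oo)%E.
Proof.
have mbox : measurable (tbox (fun _ : 'I_d => `[(-1)%R, 1%R]%classic : set MR)).
  by apply: measurable_tbox => i; exact: measurable_itv.
apply: (@le_lt_trans _ _ (lam (tball 1))).
  rewrite -[leRHS]mul1e -integral_cst; last exact: measurable_tball.
  apply: ge0_le_integral => //.
  - exact: measurable_tball.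
  - by move=> t _; exact: tweight_ge0.
  - by apply: measurable_funTS; exact: measurable_tweight.
  - move=> t; rewrite /tball /= lee_fin => t1.
    rewrite (_ : 1 = 1 `^ (- g)); last (by rewrite powR1); rewrite ge0_ler_powR ?nnegrE ?tnorm_ge0 ?oppr_ge0//.
    exact: ltW.
apply: (@le_lt_trans _ _ (lam (tbox (fun _ : 'I_d => `[(-1)%R, 1%R]%classic : set MR)))).
  apply: le_measure; rewrite ?inE//; first exact: measurable_tball.
  move=> t; rewrite /tball /= => t1 i; rewrite /= in_itv/= -ler_norml.
  rewrite -(@ler_pXn2r _ 2) ?nnegrE// expr1n.
  rewrite real_normK ?num_real// (le_trans (tnth_sqr_le t i))//.
  by rewrite expr_le1 ?tnorm_ge0// ltW.
rewrite power_measure_box//.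
suff : (\prod_(i < d) mu (`[(- 1)%R, 1%R]%classic : set R))%E \is a fin_num.
  by rewrite fin_numE => /andP[_]; rewrite ltey.
apply: (@big_ind _ (fun x : \bar R => x \is a fin_num)) => //.
  by move=> x y; exact: fin_numM.
by move=> i _; rewrite lebesgue_measure_itv/=; case: ifP.
Qed.

(** The unit ball contains a cube with all coordinates between a > 0 and b, on
    which the weight is at least a^(-g). *)
Lemma tdensity_ball_gt0 : (0 < tdensity (tball 1))%E.
Proof.
have dR0 : 0 < d%:R :> R by rewrite ltr0n.
pose a : R := (4 * d%:R)^-1; pose b : R := (2 * d%:R)^-1.
have a0 : 0 < a by rewrite invr_gt0 mulr_gt0.
have ab : a < b by rewrite ltf_pV2 ?posrE ?mulr_gt0// ltr_pM2r// ltr_nat.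
have b0 : 0 < b by exact: lt_trans ab.
pose Q := tbox (fun _ : 'I_d => `]a, b[%classic : set MR).
have mQ : measurable Q by apply: measurable_tbox => i; exact: measurable_itv.
have lamQ : (0 < lam Q)%E.
  rewrite power_measure_box//.
  suff : (0 < \prod_(i < d) mu (`]a, b[%classic : set R))%E by [].
  apply: (@big_ind _ (fun x => (0 < x)%E)) => //.
    by move=> x y; exact: mule_gt0.
  by move=> i _; rewrite lebesgue_measure_itv/= lte_fin ab -EFinB lte_fin subr_gt0.
have Qball : Q `<=` tball 1.
  move=> t Qt; rewrite /tball /= -(@ltr_pXn2r _ 2) ?nnegrE ?tnorm_ge0// expr1n.
  rewrite tnormE sqr_sqrtr ?sumr_ge0// => [|j _]; last exact: sqr_ge0.
  apply: (@le_lt_trans _ _ (\sum_(i < d) b ^+ 2)).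
    apply: ler_sum => i _; have := Qt i; rewrite /= in_itv/= => /andP[ai ib].
    by rewrite ler_pXn2r ?nnegrE ?ltW// (lt_trans a0).
  rewrite sumr_const card_ord -mulr_natl /b exprVn ltr_pdivrMr ?mul1r; last first.
    by rewrite exprn_gt0// mulr_gt0.
  have d1 : 1 <= d%:R :> R by rewrite ler1n.
  by rewrite exprMn expr2; nra.
apply: (@lt_le_trans _ _ ((a `^ (- g))%:E * lam Q)%E).
  by rewrite mule_gt0// lte_fin powR_gt0.
rewrite -integral_cst//.
apply: (@le_trans _ _ (\int[lam]_(t in Q) tweight t)%E).
  apply: ge0_le_integral => //.
  - by move=> t _; rewrite lee_fin powR_ge0.
  - by apply: measurable_funTS; exact: measurable_tweight.
  - move=> t Qt; rewrite lee_fin ge0_ler_powR ?nnegrE ?tnorm_ge0 ?oppr_ge0 ?(ltW a0)//.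
    have := tnth_sqr_le t (Ordinal d0); have := Qt (Ordinal d0).
    rewrite /= in_itv/= => /andP[ai ib] ti.
    rewrite -(@ler_pXn2r _ 2) ?nnegrE ?tnorm_ge0 ?(ltW a0)//.
    by rewrite (le_trans _ ti)// ler_pXn2r ?nnegrE ?(ltW a0)// ltW// (lt_trans a0).
apply: ge0_subset_integral => //.
- exact: measurable_tball.
- by apply: measurable_funTS; exact: measurable_tweight.
- by move=> t _; exact: tweight_ge0.
Qed.

Lemma measurable_tnorm_powR : measurable_fun [set: d.-tuple MR] (fun t => tnorm t `^ N).
Proof. by apply: (measurableT_comp (measurable_powR N)); exact: measurable_tnorm. Qed.

Definition polar_cst : R := fine (tdensity (tball 1)).

Lemma polar_cstE : tdensity (tball 1) = polar_cst%:E.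
Proof.
by rewrite fineK// ge0_fin_numE ?tdensity_ball_fin// ltW// tdensity_ball_gt0.
Qed.

Lemma polar_cst_gt0 : 0 < polar_cst.
Proof. by rewrite -lte_fin -polar_cstE tdensity_ball_gt0. Qed.

Lemma tdensity_preimage_ray (y : R) :
  tdensity ((fun t => tnorm t `^ N) @^-1` `]-oo, y[) =
  (polar_cst%:E * mu (`]-oo, y[ `&` `[0%R, +oo[))%E.
Proof.
have [y0|y0] := leP y 0.
  rewrite (_ : _ @^-1` _ = set0) ?measure0.
    rewrite (_ : _ `&` _ = set0) ?measure0 ?mule0//.
    apply/seteqP; split => // x [] /=; rewrite !in_itv/= andbT => xy x0.
    by have := le_lt_trans x0 (lt_le_trans xy y0); rewrite ltxx.
  apply/seteqP; split => // t /=; rewrite in_itv/= => ty.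
  by have := le_lt_trans (powR_ge0 _ _) (lt_le_trans ty y0); rewrite ltxx.
rewrite (_ : _ @^-1` _ = tball (y `^ N^-1)).
  rewrite tdensity_ball ?powR_gt0// -powRrM mulVf ?gt_eqF// powRr1 ?ltW//.
  rewrite polar_cstE muleC; congr (_ * _)%E.
  rewrite (_ : _ `&` _ = `[0%R, y[%classic).
    by rewrite lebesgue_measure_itv/= lte_fin y0 sube0.
  apply/seteqP; split => x /=; rewrite !in_itv/= ?andbT.
    by move=> [-> ->].
  by move=> /andP[-> ->].
have powK (r : R) : 0 <= r -> (r `^ N) `^ N^-1 = r.
  by move=> r0; rewrite -powRrM mulfV ?gt_eqF// powRr1.
have powVK (r : R) : 0 <= r -> (r `^ N^-1) `^ N = r.
  by move=> r0; rewrite -powRrM mulVf ?gt_eqF// powRr1.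
apply/seteqP; split => t; rewrite /tball /= in_itv/= => ty.
  rewrite -(powK (tnorm t)) ?tnorm_ge0// gt0_ltr_powR ?invr_gt0 ?nnegrE ?powR_ge0//.
  exact: ltW.
by rewrite -(powVK y) ?(ltW y0)// gt0_ltr_powR ?nnegrE ?tnorm_ge0 ?powR_ge0.
Qed.

(** The image of the weighted measure under |x|^N is a multiple of Lebesgue
    measure on the half-line: by homogeneity both agree on the rays, which
    generate the Borel sets. *)
Lemma tdensity_preimage (A : set MR) : measurable A ->
  tdensity ((fun t => tnorm t `^ N) @^-1` A) =
  (polar_cst%:E * mu (A `&` `[0%R, +oo[))%E.
Proof.
move=> mA.
have mphi : measurable_fun [set: d.-tuple MR] ((fun t => tnorm t `^ N) : _ -> MR).
  exact: measurable_tnorm_powR.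
pose m1 : {measure set MR -> \bar R} :=
  measure_function_pushforward__canonical__measure_function_Measure tdensity mphi.
have mI : measurable (`[0%R, +oo[%classic : set MR) by exact: measurable_itv.
pose m2 : {measure set MR -> \bar R} :=
  mscale (NngNum (ltW polar_cst_gt0)) (mrestr mu mI).
suff : m1 A = m2 A by [].
pose I0 (k : nat) : set MR := `]-oo, k%:R[%classic.
apply: (@g_sigma_algebra_measure_unique _ R MR (@RGenInftyO.G R) _ I0 _ _ m1 m2).
- by move=> _ [x ->]; exact: measurable_itv.
- by move=> k; exists k%:R.
- apply/seteqP; split => // x _; exists (Num.trunc `|x|).+1 => //=.
  by rewrite /I0 /= in_itv/= (le_lt_trans (ler_norm x))// truncnS_gt.
- move=> _ _ [x ->] [y ->]; exists (Num.min x y).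
  by apply/seteqP; split => z /=; rewrite !in_itv/= lt_min => /andP.
- by move=> _ [x ->]; exact: tdensity_preimage_ray.
- move=> k; rewrite [m1 _](_ : _ = (polar_cst%:E * mu (`]-oo, k%:R[ `&` `[0%R, +oo[))%E).
    apply: (@le_lt_trans _ _ (polar_cst%:E * mu `[0%R, k%:R])%E).
      rewrite lee_pmul2l ?lte_fin ?polar_cst_gt0//.
      apply: le_measure; rewrite ?inE//; first by apply: measurableI; exact: measurable_itv.
      by move=> x [] /=; rewrite !in_itv/= andbT => /ltW -> ->.
    by rewrite lebesgue_measure_itv/=; case: ifP => _; rewrite ?mule0 -?EFinB -?EFinM ltry.
  exact: tdensity_preimage_ray.
- suff : (RGenInftyO.G (R:=R)).-sigma.-measurable A by [].
  by rewrite -RGenInftyO.measurableE.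
Qed.

Lemma lebesgue_measure_co (a : R) : 0 <= a -> mu `[0, a[ = a%:E.
Proof.
move=> a0; rewrite lebesgue_measure_itv/= lte_fin; case: ltP => a1; first by rewrite sube0.
by congr EFin; apply/eqP; rewrite eq_le a0 a1.
Qed.

(** Layer cake: by Tonelli's theorem on the region below the graph of F, only
    the weighted measures of the sets where F exceeds a level matter, and these
    are known from [tdensity_preimage]. *)
Lemma integral_polar (F : R -> R) :
  measurable_fun setT F -> (forall y, 0 <= F y) ->
  (\int[lam]_t ((F (tnorm t `^ N))%:E * tweight t) =
   polar_cst%:E * \int[mu]_(y in `[0%R, +oo[) (F y)%:E)%E.
Proof.
move=> mF F0; pose phi t := tnorm t `^ N.
have mFphi : measurable_fun [set: d.-tuple MR] (F \o phi).
  by apply: measurableT_comp => //; exact: measurable_tnorm_powR.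
(* the weight on the region below the graph of [F \o phi] *)
pose G (z : d.-tuple MR * MR) : \bar R :=
  if (0 <= z.2) && (z.2 < F (phi z.1)) then tweight z.1 else 0%E.
have mG : measurable_fun setT G.
  apply: measurable_fun_ifT.
  - apply: measurable_and.
      apply: measurable_fun_ler; first exact: measurable_cst.
      exact: measurable_snd.
    apply: measurable_fun_ltr; first exact: measurable_snd.
    by apply: (measurableT_comp mFphi); exact: measurable_fst.
  - by apply: (measurableT_comp measurable_tweight); exact: measurable_fst.
  - exact: measurable_cst.
have G0 z : (0 <= G z)%E by rewrite /G; case: ifP => // _; exact: tweight_ge0.
pose H (z : MR * MR) : \bar R :=
  if [&& 0 <= z.1, z.1 < F z.2 & (0 <= z.2)%R] then 1%E else 0%E.
have mH : measurable_fun setT H.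
  apply: measurable_fun_ifT; [|exact: measurable_cst|exact: measurable_cst].
  apply: measurable_and.
    apply: measurable_fun_ler; first exact: measurable_cst.
    exact: measurable_fst.
  apply: measurable_and.
    apply: measurable_fun_ltr; first exact: measurable_fst.
    by apply: (measurableT_comp mF); exact: measurable_snd.
  apply: measurable_fun_ler; first exact: measurable_cst.
  exact: measurable_snd.
have H0 z : (0 <= H z)%E by rewrite /H; case: ifP.
transitivity (\int[lam]_t \int[mu]_s G (t, s))%E.
  apply: eq_integral => t _.
  transitivity (\int[mu]_(s in `[0%R, F (phi t)[) (cst (tweight t) s))%E.
    by rewrite integral_cst//= lebesgue_measure_co// muleC.
  rewrite integral_mkcond; apply: eq_integral => s _; rewrite patchE /G/=.
  by rewrite mem_setE in_itv.
rewrite fubini_tonelli//.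
transitivity (\int[mu]_s (polar_cst%:E * \int[mu]_y H (s, y)))%E.
  apply: eq_integral => s _.
  pose B : set MR := [set y | (0 <= s) && (s < F y)].
  have mB : measurable B.
    have [s0|s0] := leP 0 s.
      rewrite (_ : B = F @^-1` `]s, +oo[).
        by rewrite -[X in measurable X]setTI; apply: mF => //; exact: measurable_itv.
      by apply/seteqP; split => y; rewrite /B/= s0 in_itv/= andbT.
    rewrite (_ : B = set0)//; apply/seteqP; split => // y; rewrite /B/=.
    by rewrite leNgt s0.
  transitivity (tdensity (phi @^-1` B)).
    rewrite /tdensity /= /density_measure integral_mkcond.
    by apply: eq_integral => t _; rewrite patchE /G/= mem_setE.
  rewrite tdensity_preimage//; congr (_ * _)%E.
  transitivity (\int[mu]_(y in B `&` `[0%R, +oo[) cst 1%E y)%E.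
    have mI : measurable (`[0%R, +oo[%classic : set MR) by exact: measurable_itv.
    rewrite integral_cst ?mul1e//.
    exact: (measurableI _ _ mB mI).
  rewrite integral_mkcond; apply: eq_integral => y _; rewrite patchE /H/=.
  by rewrite in_setI !mem_setE in_itv/= andbT andbA.
rewrite ge0_integralZl_EFin ?ltW ?polar_cst_gt0//; last 2 first.
- by move=> s _; apply: integral_ge0.
- exact: (@measurable_fun_fubini_tonelli_F _ _ _ _ _ mu H).
congr (_ * _)%E; rewrite fubini_tonelli//.
rewrite [RHS]integral_mkcond; apply: eq_integral => y _; rewrite patchE mem_setE in_itv/= andbT.
case: ifPn => y0.
  transitivity (\int[mu]_(s in `[0%R, F y[) cst 1%E s)%E; last first.
    by rewrite integral_cst ?mul1e//= lebesgue_measure_co.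
  rewrite [RHS]integral_mkcond; apply: eq_integral => s _; rewrite patchE /H/=.
  by rewrite mem_setE in_itv/= y0 andbT.
by rewrite integral0_eq// => s _; rewrite /H/= (negbTE y0) !andbF.
Qed.

End weight.

(** Exchanging two coordinates preserves the measure, so all coordinates have
    the same second moment, and the squares add up to the square of the norm. *)
Lemma integral_coord_sqr (i0 : 'I_d) (G : R -> R) :
  measurable_fun setT G -> (forall r, 0 <= G r) ->
  (d%:R%:E * \int[lam]_t ((tnth t i0 : R) ^+ 2 * G (tnorm t))%:E =
   \int[lam]_t (tnorm t ^+ 2 * G (tnorm t))%:E)%E.
Proof.
move=> mG G0.
have mf i : measurable_fun [set: d.-tuple MR]
    (fun t => ((tnth t i : R) ^+ 2 * G (tnorm t))%:E).
  apply/measurable_EFinP; apply: measurable_funM.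
    by apply: measurable_funX; exact: measurable_tnth_real.
  by apply: (measurableT_comp mG); exact: measurable_tnorm.
have f0 i t : (0 <= ((tnth t i : R) ^+ 2 * G (tnorm t))%:E)%E.
  by rewrite lee_fin mulr_ge0// sqr_ge0.
transitivity (\sum_(i < d) \int[lam]_t ((tnth t i : R) ^+ 2 * G (tnorm t))%:E)%E.
  rewrite (eq_bigr (fun=> \int[lam]_t ((tnth t i0 : R) ^+ 2 * G (tnorm t))%:E)%E).
    by rewrite sumr_const card_ord mule_natl.
  move=> i _; rewrite -(integral_tswap i i0 (mf i) (f0 i)).
  by apply: eq_integral => t _; rewrite tnth_mktuple tpermL tnorm_swap.
rewrite -ge0_integral_sum//; apply: eq_integral => t _.
rewrite sumEFin -mulr_suml; congr (_ * _)%:E.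
by rewrite tnormE sqr_sqrtr// sumr_ge0// => j _; exact: sqr_ge0.
Qed.

Lemma measurable_tflip (i0 : 'I_d) : measurable_fun [set: d.-tuple MR] (tflip i0).
Proof.
apply: (@measurable_tuple_coord _ _ _ _
  (fun i x => if i == i0 then - x else x) id) => [t i|i].
  by rewrite tnth_mktuple.
by case: (i == i0); [exact: oppr_measurable|exact: measurable_id].
Qed.

End polar.

(** * Calculus of real powers *)

Section calculus.
Context (R : realType).

Lemma is_derive_le (f df : R -> R) (a0 a b : R) : a0 < a -> a <= b ->
  (forall x, a0 < x -> is_derive x 1 f (df x)) ->
  (forall x, a0 < x -> df x <= 0) -> f b <= f a.
Proof.
move=> a0a ab fd df0.
have fc : {within `[a, b], continuous f}.
  apply: derivable_within_continuous => x; rewrite in_itv/= => /andP[ax _].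
  by have := fd x (lt_le_trans a0a ax) => ?; exact: ex_derive.
have fd' : forall x, x \in `]a, b[ -> is_derive x 1 f (df x).
  by move=> x; rewrite in_itv/= => /andP[ax _]; apply: fd; exact: lt_trans ax.
have [c + fba] := MVT_segment ab fd' fc.
rewrite in_itv/= => /andP[ac _]; rewrite -subr_le0 fba.
by rewrite mulr_le0_ge0 ?subr_ge0// df0// (lt_le_trans a0a).
Qed.

Lemma is_derive_increasing (f df : R -> R) (a0 a b : R) : a0 < a -> a < b ->
  (forall x, a0 < x -> is_derive x 1 f (df x)) ->
  (forall x, a0 < x -> 0 < df x) -> f a < f b.
Proof.
move=> a0a ab fd df0.
have fc : {within `[a, b], continuous f}.
  apply: derivable_within_continuous => x; rewrite in_itv/= => /andP[ax _].
  by have := fd x (lt_le_trans a0a ax) => ?; exact: ex_derive.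
have fd' : forall x, x \in `]a, b[ -> is_derive x 1 f (df x).
  by move=> x; rewrite in_itv/= => /andP[ax _]; apply: fd; exact: lt_trans ax.
have [c + fba] := MVT ab fd' fc.
rewrite in_itv/= => /andP[ac _]; rewrite -subr_gt0 fba.
by rewrite mulr_gt0 ?subr_gt0// df0// (lt_trans a0a).
Qed.

Lemma is_derive_powR_comp (f : R -> R) (df x a : R) :
  0 < f x -> is_derive x 1 f df ->
  is_derive x 1 (fun y => f y `^ a) (a * f x `^ (a - 1) * df).
Proof.
move=> fx0 fd.
have pd : is_derive (f x) 1 (fun z : R => z `^ a) (a * f x `^ (a - 1)).
  exact: is_derive1_powR.
by have := @is_derive1_comp R (fun z => z `^ a) f x _ _ pd fd.
Qed.

Lemma is_derive_cast (f : R -> R) (x a b : R) :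
  is_derive x 1 f a -> a = b -> is_derive x 1 f b.
Proof. by move=> h <-. Qed.

Lemma is_derive_add (f g : R -> R) (x a b : R) : is_derive x 1 f a ->
  is_derive x 1 g b -> is_derive x 1 (fun y => f y + g y) (a + b).
Proof. by move=> fa gb; exact: is_deriveD. Qed.

Lemma is_derive_sub (f g : R -> R) (x a b : R) : is_derive x 1 f a ->
  is_derive x 1 g b -> is_derive x 1 (fun y => f y - g y) (a - b).
Proof. by move=> fa gb; exact: is_deriveB. Qed.

Lemma is_derive_mul (f g : R -> R) (x a b : R) : is_derive x 1 f a ->
  is_derive x 1 g b -> is_derive x 1 (fun y => f y * g y) (a * g x + f x * b).
Proof.
move=> fa gb; apply: (is_derive_cast (is_deriveM fa gb)).
by rewrite /GRing.scale/= addrC (mulrC a).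
Qed.

Lemma is_derive_scale (f : R -> R) (k x a : R) : is_derive x 1 f a ->
  is_derive x 1 (fun y => k * f y) (k * a).
Proof. by move=> fa; exact: is_deriveZ. Qed.

Lemma is_derive_chain (f g : R -> R) (x a b : R) : is_derive (f x) 1 g b ->
  is_derive x 1 f a -> is_derive x 1 (fun y => g (f y)) (b * a).
Proof. by move=> gb fa; exact: (@is_derive1_comp R g f x _ _ gb fa). Qed.

Lemma powR_gt0D (x r s : R) : 0 < x -> x `^ (r + s) = x `^ r * x `^ s.
Proof. by move=> x0; rewrite powRD// (gt_eqF x0) implybT. Qed.

Lemma powR_gt0B1 (x r : R) : 0 < x -> x `^ (r - 1) = x `^ r / x.
Proof. by move=> x0; rewrite powR_gt0D// powR_inv1 ?(ltW x0). Qed.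

Lemma continuous_powR_gt0 (x a : R) : 0 < x -> {for x, continuous (fun z : R => z `^ a)}.
Proof.
move=> x0; apply/differentiable_continuous/derivable1_diffP.
by have := is_derive1_powR a x0 => ?; exact: ex_derive.
Qed.

Lemma cvg_powR_gt0 (T : Type) (F : set_system T) (FF : Filter F) (f : T -> R) (l a : R) :
  0 < l -> f @ F --> l -> (fun x => f x `^ a) @ F --> l `^ a.
Proof.
move=> l0 fl.
exact: (@continuous_cvg T R R F FF f (fun z : R => z `^ a) l
  (@continuous_powR_gt0 l a l0) fl).
Qed.

Lemma powRN_cvgy (s : R) : 0 < s -> (fun x : R => x `^ (- s)) @ +oo --> (0 : R).
Proof.
move=> s0; apply/cvgr0Pnorm_lt => e e0; near=> x.
have x0 : e `^ (- s^-1) < x by near: x; exact: nbhs_pinfty_gt.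
have eE : e = (e `^ (- s^-1)) `^ (- s).
  by rewrite -powRrM mulrNN mulVf ?gt_eqF// powRr1// ltW.
have ep0 : 0 < e `^ (- s^-1) by rewrite powR_gt0.
rewrite ger0_norm ?powR_ge0// [ltRHS]eE !(powRN _ s) ltf_pV2 ?posrE ?powR_gt0//.
by rewrite gt0_ltr_powR// nnegrE ltW// (lt_trans ep0).
Unshelve. all: by end_near. Qed.

Lemma le_powR_neg (x y a : R) : 0 < x -> x <= y -> a <= 0 -> y `^ a <= x `^ a.
Proof.
move=> x0 xy a0; rewrite -[a]opprK !(powRN _ (- a)) lef_pV2 ?posrE ?powR_gt0//.
  by rewrite ge0_ler_powR ?nnegrE ?oppr_ge0 ?(ltW x0)// (le_trans (ltW x0)).
exact: lt_le_trans xy.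
Qed.

Lemma powR_le_expR (x w : R) : 0 <= x -> 0 <= w -> x `^ w <= expR (w * (x - 1)).
Proof.
move=> x0 w0; rewrite mulrC expRM ge0_ler_powR ?nnegrE ?expR_ge0//.
by have := expR_ge1Dx (x - 1); rewrite addrC subrK.
Qed.

(** Each factor is compared with M exp(x/M - 1), where M is the right-hand side;
    the exponents then add up to zero. *)
Lemma weighted_amgm3 (x y z a b c : R) : 0 < x -> 0 < y -> 0 < z ->
  0 <= a -> 0 <= b -> 0 <= c -> a + b + c = 1 ->
  x `^ a * y `^ b * z `^ c <= a * x + b * y + c * z.
Proof.
move=> x0 y0 z0 a0 b0 c0 abc.
set M := a * x + b * y + c * z.
have M0 : 0 < M.
  pose t := Num.min x (Num.min y z).
  have t0 : 0 < t by rewrite !lt_min x0 y0 z0.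
  have tx : t <= x by rewrite ge_min lexx.
  have ty : t <= y by rewrite !ge_min lexx orbT.
  have tz : t <= z by rewrite !ge_min lexx !orbT.
  rewrite (lt_le_trans t0)// -[t]mul1r -abc !mulrDl.
  by rewrite /M !lerD ?ler_wpM2l.
have ME : M = M `^ a * M `^ b * M `^ c.
  by rewrite -!powRD ?abc ?powRr1 ?(ltW M0)//; apply/implyP => _; rewrite gt_eqF.
have div v w : 0 < v -> 0 <= w -> v `^ w <= M `^ w * expR (w * (v / M - 1)).
  move=> v0 w0; have vM : 0 <= v / M by rewrite divr_ge0// ltW.
  rewrite {1}(_ : v = M * (v / M)); last by rewrite mulrC divfK ?gt_eqF.
  by rewrite powRM ?(ltW M0)// ler_wpM2l ?powR_ge0// powR_le_expR.
rewrite (@le_trans _ _ ((M `^ a * expR (a * (x / M - 1))) *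
  (M `^ b * expR (b * (y / M - 1))) * (M `^ c * expR (c * (z / M - 1)))))//.
  rewrite ler_pM ?mulr_ge0 ?powR_ge0 ?div//.
  by rewrite ler_pM ?powR_ge0 ?div.
rewrite (mulrACA (M `^ a)) [leLHS]mulrACA -ME -!expRD.
rewrite (_ : _ + _ + _ = 0) ?expR0 ?mulr1//.
rewrite !mulrBr !mulr1.
transitivity (M / M - (a + b + c)); first by rewrite /M; field; rewrite gt_eqF.
by rewrite abc divff ?subrr// gt_eqF.
Qed.

End calculus.

(** * The one-dimensional inequality by mass transport *)

Section bubble.
Context (R : realType).
Variable n : R.
Hypothesis n0 : 0 < n.

(** In the volume coordinate x = r^n this is 1 + r^2; its powers are the
    extremal profiles. *)
Definition bub (x : R) : R := 1 + x `^ (2 / n).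

Lemma bub_ge1 x : 1 <= bub x.
Proof. by rewrite lerDl powR_ge0. Qed.

Lemma bub_gt0 x : 0 < bub x. Proof. exact: lt_le_trans (bub_ge1 x). Qed.

Lemma le_bub x y : 0 <= x -> x <= y -> bub x <= bub y.
Proof.
move=> x0 xy; have y0 := le_trans x0 xy.
by rewrite lerD2l ge0_ler_powR ?nnegrE// divr_ge0// ltW.
Qed.

Lemma is_derive_bub (x : R) : 0 < x ->
  is_derive x 1 bub (2 / n * x `^ (2 / n - 1)).
Proof.
move=> x0; have := is_derive1_powR (2 / n) x0 => h.
have h1 : is_derive x 1 (cst (1 : R)) (0 : R) by exact: is_derive_cst.
by have := is_deriveD h1 h; rewrite add0r.
Qed.

(** Relates the powers -j and -j - 1 of [bub]: integrating it yields both
    [mass1] and the recursion [Jprof_rec]. *)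
Lemma is_derive_bub_powR (x j : R) : 0 < x ->
  is_derive x 1 (fun y => y * bub y `^ (- j))
    ((1 - 2 * j / n) * bub x `^ (- j) + 2 * j / n * bub x `^ (- j - 1)).
Proof.
move=> x0; have hb := is_derive_bub x0.
have hp := is_derive_powR_comp (- j) (bub_gt0 x) hb.
apply: (is_derive_cast (is_deriveM (is_derive_id x (1 : R)) hp)); rewrite /GRing.scale/= mulr1.
have E1 : x `^ (2 / n - 1) * x = bub x - 1.
  by rewrite /bub addrAC subrr add0r powR_gt0B1// divfK ?gt_eqF.
have E2 : bub x `^ (- j - 1) * bub x = bub x `^ (- j).
  by rewrite powR_gt0B1 ?bub_gt0// divfK ?gt_eqF ?bub_gt0.
rewrite -E2.
transitivity (bub x `^ (- j - 1) * bub x +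
  - j * bub x `^ (- j - 1) * (2 / n) * (x `^ (2 / n - 1) * x)); first by ring.
by rewrite E1; field; rewrite gt_eqF.
Qed.

Lemma bub_tail (j : R) : n < 2 * j -> (fun x : R => x * bub x `^ (- j)) @ +oo --> (0 : R).
Proof.
move=> nj; have s0 : 0 < 2 * j / n - 1 by rewrite subr_gt0 ltr_pdivlMr// mul1r.
apply: (squeeze_cvgr _ (cvg_cst 0) (powRN_cvgy s0)).
near=> x; have x0 : 0 < x by near: x; exact: nbhs_pinfty_gt.
rewrite mulr_ge0 ?powR_ge0 ?(ltW x0)//=.
rewrite (_ : x `^ _ = x * (x `^ (2 / n)) `^ (- j)).
  rewrite ler_wpM2l ?(ltW x0)// !(powRN _ j) lef_pV2 ?posrE ?powR_gt0 ?bub_gt0//.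
  rewrite ge0_ler_powR ?nnegrE ?powR_ge0 ?(ltW (bub_gt0 _))//.
    by have := n0; lra.
  by rewrite /bub lerDr.
rewrite -powRrM; transitivity (x `^ 1 * x `^ (2 / n * - j)).
  by rewrite -powR_gt0D//; congr powR; field; rewrite gt_eqF.
by rewrite powRr1 ?(ltW x0).
Unshelve. all: by end_near. Qed.

Lemma bub_head (j : R) : 0 <= j -> (fun x : R => x * bub x `^ (- j)) @ 0^'+ --> (0 : R).
Proof.
move=> j0; apply: (squeeze_cvgr _ (cvg_cst 0) (cvg_at_right_filter cvg_id)).
near=> x; have x0 : 0 < x by near: x; exact: nbhs_right_gt.
rewrite mulr_ge0 ?powR_ge0 ?(ltW x0)//= ler_piMr ?(ltW x0)//.
rewrite powRN invf_le1 ?powR_gt0 ?bub_gt0//.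
apply: (@le_trans _ _ (bub x `^ 0)); first by rewrite powRr0.
by rewrite ler_powR ?bub_ge1.
Unshelve. all: by end_near. Qed.

End bubble.

Section transport.
Context (R : realType).
Variables (n p : R).
Hypotheses (n2 : 2 < n) (p1 : 1 < p).
Let m := 2 * p / (p - 1).
Hypothesis nm : n <= m.

Let n0 : 0 < n. Proof. exact: lt_trans n2. Qed.
Let p0 : 0 < p. Proof. exact: lt_trans p1. Qed.
Let pm1 : 0 < p - 1. Proof. by rewrite subr_gt0. Qed.
Let m0 : 0 < m. Proof. exact: lt_le_trans nm. Qed.
Notation bub := (bub n).

(** Here th is the value at y of the transport map and dth its derivative, as
    prescribed by conservation of mass. In dimension n such a map stretches by
    (th/y)^(1/n) in n - 1 directions and by the derivative of the radius in one.
    The arithmetic--geometric mean inequality, with weights (n - 1)/m, 1/m and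
    (m - n)/m for these two stretches and for a free scale sg, replaces the
    Jacobian by a trace; the trace is a derivative up to a term in the
    derivative of u. *)
Lemma transport_pointwise (u y th om sg dth : R) :
  0 < u -> 0 < y -> 0 < th -> 0 < om -> 0 < sg ->
  dth = om * u `^ (2 * p) / bub th `^ (- m) ->
  om `^ (m^-1 - 1) * sg `^ (1 - n / m) * (bub th `^ (1 - m) * dth) <=
  n / m * (u `^ (p + 1) * (n^-1 * th `^ (n^-1 - 1) * dth * y `^ (1 - n^-1) +
     (1 - n^-1) * th `^ n^-1 * y `^ (- n^-1))) + (1 - n / m) * sg * u `^ (p + 1).
Proof.
move=> u0 y0 th0 om0 sg0 dthE.
have dth0 : 0 < dth by rewrite dthE divr_gt0// ?mulr_gt0// powR_gt0// bub_gt0.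
pose r := th / y; have r0 : 0 < r by rewrite divr_gt0.
have mn : 1 - n / m = (m - n) / m by field; rewrite gt_eqF.
have n1 : 1 < n by rewrite (lt_trans _ n2)// ltr1n.
have w1 : 0 <= (n - 1) / m by rewrite divr_ge0 ?(ltW m0)// subr_ge0 ltW.
have w2 : 0 <= m^-1 by rewrite invr_ge0 ltW.
have w3 : 0 <= (m - n) / m by rewrite divr_ge0 ?(ltW m0)// subr_ge0.
have w123 : (n - 1) / m + m^-1 + (m - n) / m = 1 by field; rewrite gt_eqF.
have amgm := weighted_amgm3 (powR_gt0 n^-1 r0)
  (mulr_gt0 (powR_gt0 (n^-1 - 1) r0) dth0) sg0 w1 w2 w3 w123.
have Ebr : n * (n^-1 * th `^ (n^-1 - 1) * dth * y `^ (1 - n^-1) +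
     (1 - n^-1) * th `^ n^-1 * y `^ (- n^-1)) =
   (n - 1) * r `^ n^-1 + r `^ (n^-1 - 1) * dth.
  rewrite /r !powRM ?(ltW th0) ?invr_ge0 ?(ltW y0)//.
  rewrite -[in RHS](powR_inv1 (ltW y0)) -!powRrM.
  rewrite (_ : -1 * (n^-1 - 1) = 1 - n^-1); last by ring.
  by rewrite mulN1r; field; rewrite gt_eqF.
have El : (r `^ n^-1) `^ ((n - 1) / m) * (r `^ (n^-1 - 1) * dth) `^ m^-1 *
    sg `^ ((m - n) / m) = dth `^ m^-1 * sg `^ (1 - n / m).
  rewrite powRM ?powR_ge0 ?(ltW dth0)// -!powRrM mn mulrA -powR_gt0D//.
  rewrite (_ : _ + _ = 0) ?powRr0 ?mul1r//.
  by field; rewrite !gt_eqF.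
have Eu : u `^ (p + 1) * dth `^ m^-1 = om `^ (m^-1 - 1) * (bub th `^ (1 - m) * dth).
  have b0 := bub_gt0 n th.
  have {}dthE : dth = om * u `^ (2 * p) * bub th `^ m.
    by rewrite dthE powRN invrK.
  rewrite {1}dthE !powRM ?mulr_ge0 ?powR_ge0 ?(ltW om0)//.
  rewrite -!powRrM mulfV ?gt_eqF// powRr1 ?(ltW b0)//.
  transitivity (om `^ m^-1 * (u `^ (p + 1) * u `^ (2 * p * m^-1)) * bub th); first by ring.
  rewrite -powR_gt0D//.
  rewrite (_ : p + 1 + 2 * p * m^-1 = 2 * p); last first.
    by rewrite /m; field; rewrite !gt_eqF.
  rewrite dthE powR_gt0B1// powR_gt0D// powRr1 ?(ltW b0)// !powRN.
  by field; rewrite !gt_eqF ?powR_gt0.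
rewrite (mulrAC (om `^ _)) -Eu -[leLHS]mulrA -El.
set BR := (X in n / m * (_ * X)); rewrite -/BR in Ebr.
rewrite (_ : n / m * _ + _ = u `^ (p + 1) * (n * BR / m + (m - n) / m * sg)).
  rewrite Ebr ler_wpM2l ?powR_ge0// (le_trans amgm)// le_eqVlt; apply/orP; left.
  by apply/eqP; field; rewrite gt_eqF.
by rewrite mn; field; rewrite gt_eqF.
Qed.

Section calibration.
Variable H : R -> R.
Hypothesis Hd : forall x : R, 0 < x -> is_derive x 1 H (bub x `^ (- m)).

Let cL := 1 - 2 * (m - 1) / n.

Let cL_neq0 : cL != 0.
Proof.
rewrite lt_eqF// /cL subr_lt0 ltr_pdivlMr//.
by have := n2; have := nm; lra.
Qed.

(** A primitive of the power 1 - m of [bub], written with the primitive H of the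
    power -m after an integration by parts. *)
Definition mass1 (x : R) : R :=
  cL^-1 * (x * bub x `^ (- (m - 1)) - 2 * (m - 1) / n * H x).

Definition mass2 (x : R) : R := mass1 x - H x.

Lemma is_derive_mass1 (x : R) : 0 < x -> is_derive x 1 mass1 (bub x `^ (1 - m)).
Proof.
move=> x0; have h1 := is_derive_bub_powR n0 (m - 1) x0.
have h2 := is_derive_scale (2 * (m - 1) / n) (Hd x0).
apply: (is_derive_cast (is_derive_scale cL^-1 (is_derive_sub h1 h2))).
rewrite (_ : - (m - 1) - 1 = - m); last by ring.
rewrite (_ : - (m - 1) = 1 - m); last by ring.
by rewrite addrK mulrA mulVf ?mul1r.
Qed.

Lemma is_derive_mass2 (x : R) : 0 < x ->
  is_derive x 1 mass2 (bub x `^ (- m) * x `^ (2 / n)).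
Proof.
move=> x0; apply: (is_derive_cast (is_derive_sub (is_derive_mass1 x0) (Hd x0))).
have b0 := bub_gt0 n x; rewrite powR_gt0D// powRr1 ?(ltW b0)//.
by rewrite /bub; ring.
Qed.

Let H_lt (x y : R) : 0 < x -> x < y -> H x < H y.
Proof.
move=> x0 xy; have x20 : 0 < x / 2 by rewrite divr_gt0.
apply: (@is_derive_increasing R H (fun z => bub z `^ (- m)) (x / 2)) => //.
- by rewrite ltr_pdivrMr// mulr2n mulrDr mulr1 ltrDl.
- by move=> z xz; apply: Hd; exact: lt_trans xz.
- by move=> z _; rewrite powR_gt0// bub_gt0.
Qed.

(** Inverse of H on the positive half-line; 0 is the default outside the range
    of H. *)
Definition Hinv (t : R) : R := xget 0 [set x | 0 < x /\ H x = t].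

Let HinvK (x : R) : 0 < x -> Hinv (H x) = x.
Proof.
move=> x0; rewrite /Hinv; case: xgetP => [y _ [y0 yx]|/(_ x)]; last by case.
have [xy|xy|//] := ltgtP x y; have := H_lt _ xy; rewrite yx ltxx => h.
  by have := h x0.
by have := h y0.
Qed.

Let Hcont (x : R) : 0 < x -> {for x, continuous H}.
Proof.
by move=> x0; apply/differentiable_continuous/derivable1_diffP; have := Hd x0 => ?; exact: ex_derive.
Qed.

Let is_derive_Hinv (x : R) : 0 < x ->
  is_derive (H x) 1 Hinv (bub x `^ (- m))^-1.
Proof.
move=> x0; apply: is_derive_inverse.
- near=> z; apply: HinvK; near: z; exact: lt_nbhsr.
- near=> z; apply: Hcont; near: z; exact: lt_nbhsr.
- exact: Hd.
- by rewrite gt_eqF// powR_gt0// bub_gt0.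
Unshelve. all: by end_near. Qed.

(** [bub] increases, so on [x, y] the derivative of [mass1] is at most bub y
    times that of H. *)
Let mass1_le (x y : R) : 0 < x -> x <= y ->
  mass1 y - mass1 x <= bub y * (H y - H x).
Proof.
move=> x0 xy; have [->|xy'] := eqVneq x y; first by rewrite !subrr mulr0.
have {xy xy'} xy : x < y by rewrite lt_neqAle xy' xy.
pose F z := mass1 z - bub y * H z.
have Fd (z : R) : 0 < z -> is_derive z 1 F (bub z `^ (1 - m) - bub y * bub z `^ (- m)).
  move=> z0; apply: is_derive_sub; first exact: is_derive_mass1.
  exact/is_derive_scale/Hd.
have Fc : {within `[x, y], continuous F}.
  apply: derivable_within_continuous => z; rewrite in_itv/= => /andP[xz _].
  by have := Fd z (lt_le_trans x0 xz) => ?; exact: ex_derive.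
have Fd' z : z \in `]x, y[ -> is_derive z 1 F (bub z `^ (1 - m) - bub y * bub z `^ (- m)).
  by rewrite in_itv/= => /andP[xz _]; apply: Fd; exact: lt_trans xz.
have [c + Fyx] := MVT xy Fd' Fc.
rewrite in_itv/= => /andP[xc cy].
have c0 : 0 < c by exact: lt_trans xc.
have : F y - F x <= 0.
  rewrite Fyx mulr_le0_ge0 ?subr_ge0 ?(ltW xy)//.
  rewrite subr_le0 powR_gt0D ?bub_gt0// powRr1 ?(ltW (bub_gt0 _ _))//.
  by rewrite ler_wpM2r ?powR_ge0// le_bub// ltW.
by rewrite /F; lra.
Qed.

Let mass2_le (x y : R) : 0 < x -> x <= y -> mass2 x <= mass2 y.
Proof.
move=> x0 xy; have x20 : 0 < x / 2 by rewrite divr_gt0.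
rewrite -lerN2.
apply: (@is_derive_le R (fun z => - mass2 z)
  (fun z => - (bub z `^ (- m) * z `^ (2 / n))) (x / 2)).
- by rewrite ltr_pdivrMr// mulr2n mulrDr mulr1 ltrDl.
- exact: xy.
- by move=> z xz; apply: is_deriveN; apply: is_derive_mass2; exact: lt_trans xz.
- by move=> z _; rewrite oppr_le0; exact: (mulr_ge0 (powR_ge0 _ _) (powR_ge0 _ _)).
Qed.

(** The map th sends the mass om U of u^(2p) to the mass of the profile
    between k0 and k1, so that th Y = k1. The boundary term K comes from the
    integration by parts of the trace: it vanishes at Y, where u = 0, and is
    nonnegative at a. Young's inequality with the parameter mu splits the
    term in the derivative of u into the gradient and the second moment of
    the profile. The comparison is between the values at a and Y of one
    nonincreasing function F, which avoids any discussion of the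
    integrability of the intermediate terms. *)
Lemma calibration (k0 k1 om sg mu a0 a Y : R) (u U dw q VA VB : R -> R) :
  0 < k0 -> k0 < k1 -> 0 < om -> 0 < sg -> 0 < mu -> 0 < a0 -> a0 < a -> a <= Y ->
  (forall y, 0 <= u y) ->
  (forall y, a0 < y -> is_derive y 1 U (u y `^ (2 * p))) ->
  (forall y, a0 < y -> 0 <= om * U y <= H k1 - H k0) ->
  (forall y, a0 < y -> is_derive y 1 (fun z => u z `^ (p + 1)) (dw y)) ->
  (forall y, a0 < y -> `|dw y| <= (p + 1) * u y `^ p * q y) ->
  (forall y, a0 < y -> is_derive y 1 VA (q y ^+ 2 * y `^ (2 - 2 / n))) ->
  (forall y, a0 < y -> is_derive y 1 VB (u y `^ (p + 1))) ->
  u Y = 0 -> om * U Y = H k1 - H k0 ->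
  om `^ (m^-1 - 1) * sg `^ (1 - n / m) *
    (mass1 k1 - mass1 k0 - bub k1 * (om * U a)) <=
  n / m * ((p + 1) / 2) * (mu / om * (mass2 k1 - mass2 k0) + (VA Y - VA a) / mu) +
  (1 - n / m) * sg * (VB Y - VB a).
Proof.
move=> k00 k01 om0 sg0 mu0 a00 a0a aY u0 Ud Ub dwd dwb VAd VBd uY UY.
pose th y := Hinv (H k0 + om * U y).
have thP y : a0 < y -> [/\ 0 < th y, k0 <= th y, th y <= k1 & H (th y) = H k0 + om * U y].
  move=> ay; have /andP[U0 U1] := Ub y ay.
  have Hc : {within `[k0, k1], continuous H}.
    apply: derivable_within_continuous => x; rewrite in_itv/= => /andP[xz _].
    by have := Hd (lt_le_trans k00 xz) => ?; exact: ex_derive.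
  have H01 : H k0 <= H k1 by rewrite ltW// H_lt.
  have [|c] := IVT (ltW k01) Hc (v := H k0 + om * U y).
    by rewrite min_l// max_r// lerDl U0/= -lerBrDl.
  rewrite in_itv/= => /andP[c0 c1] Hc'.
  have c00 : 0 < c by exact: lt_le_trans c0.
  by rewrite /th -Hc' HinvK.
pose dth y := om * u y `^ (2 * p) / bub (th y) `^ (- m).
have thd y : a0 < y -> is_derive y 1 th (dth y).
  move=> ay; have [t0 _ _ tE] := thP y ay.
  have h1 : is_derive y 1 (fun z => H k0 + om * U z) (om * u y `^ (2 * p)).
    apply: (is_derive_cast (is_derive_add (is_derive_cst (H k0) y 1) (is_derive_scale om (Ud y ay)))).
    by rewrite add0r.
  have h2 : is_derive (H k0 + om * U y) 1 Hinv (bub (th y) `^ (- m))^-1.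
    by rewrite -tE; exact: is_derive_Hinv.
  by apply: (is_derive_cast (is_derive_chain (f := fun z => H k0 + om * U z) h2 h1)); rewrite mulrC.
set c1 := om `^ _ * sg `^ _.
have c10 : 0 <= c1 by rewrite mulr_ge0// powR_ge0.
set c2 := n / m * ((p + 1) / 2).
have c20 : 0 < c2 by rewrite /c2 mulr_gt0// divr_gt0// addr_gt0.
pose K y := u y `^ (p + 1) * (th y `^ n^-1 * y `^ (1 - n^-1)).
(* the derivative of F is the pointwise transport inequality minus the losses in
   Young's inequality, hence nonpositive *)
pose F y := c1 * mass1 (th y) - n / m * K y - c2 * (mu / om) * mass2 (th y)
  - c2 / mu * VA y - (1 - n / m) * sg * VB y.
pose BR y := n^-1 * th y `^ (n^-1 - 1) * dth y * y `^ (1 - n^-1) +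
     (1 - n^-1) * th y `^ n^-1 * y `^ (- n^-1).
pose dF y := c1 * (bub (th y) `^ (1 - m) * dth y)
  - n / m * (dw y * (th y `^ n^-1 * y `^ (1 - n^-1)) + u y `^ (p + 1) * BR y)
  - c2 * (mu / om) * (bub (th y) `^ (- m) * th y `^ (2 / n) * dth y)
  - c2 / mu * (q y ^+ 2 * y `^ (2 - 2 / n)) - (1 - n / m) * sg * u y `^ (p + 1).
have Fd y : a0 < y -> is_derive y 1 F (dF y).
  move=> ay; have y0 : 0 < y by exact: lt_trans ay.
  have [t0 _ _ tE] := thP y ay; have td := thd y ay.
  have Kd : is_derive y 1 K (dw y * (th y `^ n^-1 * y `^ (1 - n^-1)) + u y `^ (p + 1) * BR y).
    apply: is_derive_mul; first exact: dwd.
    have yd := is_derive1_powR (1 - n^-1) y0.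
    apply: (is_derive_cast (is_derive_mul (is_derive_powR_comp n^-1 t0 td) yd)).
    rewrite /BR (_ : 1 - n^-1 - 1 = - n^-1); last by ring.
    by ring.
  apply: is_derive_sub; last exact/is_derive_scale/VBd.
  apply: is_derive_sub; last exact/is_derive_scale/VAd.
  apply: is_derive_sub; last first.
    by apply: is_derive_scale; apply: is_derive_chain => //; exact: is_derive_mass2.
  apply: is_derive_sub.
  by apply: is_derive_scale; apply: is_derive_chain => //; exact: is_derive_mass1.
have dF0 y : a0 < y -> dF y <= 0.
  move=> ay; have y0 : 0 < y by exact: lt_trans ay.
  have [t0 _ _ tE] := thP y ay; have b0 := bub_gt0 n (th y).
  have qy0 : 0 <= c2 / mu * (q y ^+ 2 * y `^ (2 - 2 / n)).
    by rewrite mulr_ge0 ?divr_ge0 ?(ltW c20) ?(ltW mu0)// mulr_ge0 ?sqr_ge0 ?powR_ge0.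
  have [uy0|uy0] := eqVneq (u y) 0.
    have dthy : dth y = 0.
      by rewrite /dth uy0 powR0 ?mulr0 ?mul0r// mulf_neq0// gt_eqF.
    have dwy : dw y = 0.
      apply/eqP; rewrite -normr_le0 (le_trans (dwb y ay))//.
      by rewrite uy0 powR0 ?mulr0 ?mul0r// gt_eqF.
    rewrite /dF dthy dwy uy0 powR0 ?gt_eqF ?addr_gt0// !(mulr0, mul0r, addr0, subr0, sub0r).
    by rewrite oppr0 sub0r oppr_le0.
  have {}uy0 : 0 < u y by rewrite lt_neqAle eq_sym uy0 u0.
  have := transport_pointwise uy0 y0 t0 om0 sg0 (erefl (dth y)).
  rewrite -/c1 -/(BR y) => tp.
  set T := th y `^ n^-1; set Z := y `^ (1 - n^-1).
  have T0 : 0 <= T by exact: powR_ge0.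
  have Z0 : 0 <= Z by exact: powR_ge0.
  have T2 : th y `^ (2 / n) = T ^+ 2.
    by rewrite /T -powR_mulrn ?powR_ge0// -powRrM mulrC.
  have Z2 : y `^ (2 - 2 / n) = Z ^+ 2.
    by rewrite /Z -powR_mulrn ?powR_ge0// -powRrM; congr powR; ring.
  have u2 : u y `^ (2 * p) = (u y `^ p) ^+ 2.
    by rewrite -powR_mulrn ?powR_ge0// -powRrM mulrC.
  have bd : bub (th y) `^ (- m) * T ^+ 2 * dth y = om * (u y `^ p) ^+ 2 * T ^+ 2.
    by rewrite /dth u2; field; rewrite gt_eqF// powR_gt0.
  have young : - (dw y * (T * Z)) <=
      (p + 1) / 2 * (mu * (u y `^ p) ^+ 2 * T ^+ 2 + q y ^+ 2 * Z ^+ 2 / mu).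
    apply: (@le_trans _ _ ((p + 1) * u y `^ p * q y * (T * Z))).
      rewrite -mulNr ler_wpM2r ?mulr_ge0//.
      by rewrite (le_trans _ (dwb y ay))// -normrN ler_norm.
    rewrite -subr_ge0 (_ : _ - _ = (p + 1) / 2 / mu * (mu * (u y `^ p * T) - q y * Z) ^+ 2).
      by rewrite mulr_ge0 ?sqr_ge0// !divr_ge0 ?addr_ge0 ?(ltW mu0) ?(ltW p0).
    by field; rewrite gt_eqF.
  have nm0 : 0 <= n / m by rewrite divr_ge0 ?ltW.
  have := ler_wpM2l nm0 young.
  rewrite /dF T2 Z2 bd -/T -/Z => young'.
  rewrite (_ : c2 * (mu / om) * (om * (u y `^ p) ^+ 2 * T ^+ 2) =
    c2 * (mu * (u y `^ p) ^+ 2 * T ^+ 2)); last by field; rewrite gt_eqF.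
  move: tp young'; rewrite /c2; set W := u y `^ p; set V := u y `^ (p + 1).
  move: (BR y) => B0 tp young'.
  lra.
have := is_derive_le a0a aY Fd dF0.
have aa0 : a0 < a by [].
have [ta0 tak0 tak1 taE] := thP a aa0.
have tY : th Y = k1.
  by rewrite /th UY addrC subrK HinvK// (lt_trans k00).
rewrite /F tY.
have KY : K Y = 0 by rewrite /K uY powR0 ?mul0r// gt_eqF// addr_gt0.
have Ka : 0 <= K a by rewrite /K !mulr_ge0// powR_ge0.
have m1 : c1 * (mass1 (th a) - mass1 k0) <= c1 * (bub k1 * (om * U a)).
  rewrite ler_wpM2l//; apply: (le_trans (mass1_le k00 tak0)).
  have /andP[U0 _] := Ub a aa0.
  by rewrite taE addrAC subrr add0r ler_wpM2r// le_bub// ltW.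
have m2 : c2 * (mu / om) * mass2 k0 <= c2 * (mu / om) * mass2 (th a).
  by rewrite ler_wpM2l ?mass2_le// mulr_ge0 ?(ltW c20)// divr_ge0 ?ltW.
have Ka' : 0 <= n / m * K a by rewrite mulr_ge0// divr_ge0 ?ltW.
rewrite KY mulr0; move: m1 m2 Ka'; rewrite mulrBr.
have -> : c2 * (mu / om * (mass2 k1 - mass2 k0) + (VA Y - VA a) / mu) =
  c2 * (mu / om) * mass2 k1 - c2 * (mu / om) * mass2 k0 + c2 / mu * VA Y - c2 / mu * VA a.
  by ring.
rewrite !mulrBr; lra.
Qed.

Variable Hoo : R.
Hypothesis H_right0 : H x @[x --> 0^'+] --> 0.
Hypothesis H_infty : H x @[x --> +oo] --> Hoo.
Hypothesis Hoo0 : 0 < Hoo.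

(** Total masses over the half-line: limits of the increments of [mass1] and
    [mass2] when the total mass of H is Hoo. *)
Definition mass1_oo : R := 2 * (m - 1) / (2 * (m - 1) - n) * Hoo.
Definition mass2_oo : R := n / (2 * (m - 1) - n) * Hoo.

Let r_gt0 : 0 < 2 * (m - 1) - n.
Proof. by have := n2; have := nm; lra. Qed.

Let k0 (i : nat) : R := i.+1%:R^-1.
Let k1 (i : nat) : R := i.+2%:R.

Let k0_cvg : k0 @ \oo --> 0^'+.
Proof.
move=> P [e /= e0 eP]; suff : \forall i \near \oo, P (k0 i) by [].
near=> i; apply: eP; last by rewrite /k0 invr_gt0.
rewrite /= sub0r normrN ger0_norm ?invr_ge0//.
by near: i; exact: (near_infty_natSinv_lt (PosNum e0)).
Unshelve. all: by end_near. Qed.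

Let k1_cvg : k1 @ \oo --> +oo.
Proof.
apply/cvgryPge => A; near=> i.
apply: (@le_trans _ _ i%:R); first by near: i; exact: nbhs_infty_ger.
by rewrite /k1 ler_nat ltnW.
Unshelve. all: by end_near. Qed.

Lemma cvg_mass1 : (fun i => mass1 (k1 i) - mass1 (k0 i)) @ \oo --> mass1_oo.
Proof.
have nm1 : n < 2 * (m - 1) by rewrite -subr_gt0.
have m10 : 0 <= m - 1 by have := n2; have := nm; lra.
rewrite (_ : mass1_oo = cL^-1 * (0 - 2 * (m - 1) / n * Hoo) - cL^-1 * (0 - 2 * (m - 1) / n * 0)).
  apply: cvgB; apply: cvgMl_tmp; apply: cvgB.
  - exact: (cvg_comp _ _ k1_cvg (bub_tail n0 nm1)).
  - by apply: cvgMl_tmp; exact: (cvg_comp _ _ k1_cvg H_infty).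
  - exact: (cvg_comp _ _ k0_cvg (bub_head n m10)).
  - by apply: cvgMl_tmp; exact: (cvg_comp _ _ k0_cvg H_right0).
rewrite /mass1_oo /cL; field.
rewrite (gt_eqF n0) (gt_eqF r_gt0) !andbT/= lt_eqF//.
by have := r_gt0; lra.
Qed.

Lemma cvg_H : (fun i => H (k1 i) - H (k0 i)) @ \oo --> Hoo.
Proof.
rewrite -[Hoo]subr0; apply: cvgB; first exact: (cvg_comp _ _ k1_cvg H_infty).
exact: (cvg_comp _ _ k0_cvg H_right0).
Qed.

Lemma cvg_mass2 : (fun i => mass2 (k1 i) - mass2 (k0 i)) @ \oo --> mass2_oo.
Proof.
rewrite (_ : (fun _ => _) = (fun i => (mass1 (k1 i) - mass1 (k0 i)) - (H (k1 i) - H (k0 i)))).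
  rewrite (_ : mass2_oo = mass1_oo - Hoo); first exact: cvgB cvg_mass1 cvg_H.
  by rewrite /mass1_oo /mass2_oo; field; rewrite gt_eqF.
by apply/funext => i; rewrite /mass2; ring.
Qed.

(** With t = sqrt(a dl), the choice sg = t/b and mu = t/dl makes the three terms
    on the right add up to t. *)
Lemma optimize (dl a b nu e1 : R) : 0 < dl -> 0 < a -> 0 < b ->
  (forall sg mu, 0 < sg -> 0 < mu ->
    dl `^ e1 * sg `^ (1 - nu) <= nu * ((mu * dl + a / mu) / 2) + (1 - nu) * (sg * b)) ->
  dl `^ (e1 - nu / 2) <= a `^ (nu / 2) * b `^ (1 - nu).
Proof.
move=> dl0 a0 b0 h.
pose t := (a * dl) `^ 2^-1; have t0 : 0 < t by rewrite powR_gt0// mulr_gt0.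
have tt : t * t = a * dl.
  by rewrite -expr2 -powR_mulrn ?(ltW t0)// -powRrM mulVf// powRr1// mulr_ge0 ?ltW.
have := h (t / b) (t / dl) (divr_gt0 t0 b0) (divr_gt0 t0 dl0).
rewrite divfK ?gt_eqF// divfK ?gt_eqF//.
have -> : a / (t / dl) = t.
  by apply: (mulfI (lt0r_neq0 t0)); rewrite tt; field; rewrite !gt_eqF.
rewrite (_ : nu * ((t + t) / 2) + (1 - nu) * t = t); last by field.
rewrite powRM ?invr_ge0 ?(ltW t0) ?(ltW b0)// -(powR_inv1 (ltW b0)) -powRrM mulN1r powRN.
rewrite mulrA ler_pdivrMr ?powR_gt0// => h1.
have {}h1 : dl `^ e1 <= t `^ nu * b `^ (1 - nu).
  rewrite -(ler_pM2r (powR_gt0 (1 - nu) t0)) (le_trans h1)// mulrAC -powR_gt0D//.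
  by rewrite addrCA subrr addr0 powRr1 ?(ltW t0).
rewrite powR_gt0D// powRN ler_pdivrMr ?powR_gt0// (le_trans h1)//.
by rewrite /t -powRrM [2^-1 * nu]mulrC powRM ?(ltW a0) ?(ltW dl0)// mulrAC.
Qed.

(** Letting the bounds tend to 0 and to infinity turns the increments into total
    masses. The constant q0 rescales mu so that both terms of Young's inequality
    take the form required by [optimize]. *)
Lemma sharp_of_family (D A B : R) : 0 < D -> 0 < A -> 0 < B ->
  (forall x y sg mu om : R, 0 < x -> x < y -> 0 < sg -> 0 < mu ->
    om = (H y - H x) / D ->
    om `^ (m^-1 - 1) * sg `^ (1 - n / m) * (mass1 y - mass1 x) <=
    n / m * ((p + 1) / 2) * (mu / om * (mass2 y - mass2 x) + A / mu) +
    (1 - n / m) * sg * B) ->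
  (D / Hoo) `^ (1 - m^-1 - n / m / 2) <=
  (A * (n * (p ^+ 2 - 1) / 2) / mass1_oo) `^ (n / m / 2) * (B / mass1_oo) `^ (1 - n / m).
Proof.
move=> D0 A0 B0 h.
have moo0 : 0 < mass1_oo.
  by rewrite mulr_gt0// divr_gt0//; have := n2; have := nm; lra.
apply: optimize; rewrite ?divr_gt0//.
  rewrite mulr_gt0// divr_gt0// mulr_gt0// subr_gt0 expr2.
  by have := p1; nra.
move=> sg mu sg0 mu0.
pose q0 := n * (p - 1) / 2.
have q00 : 0 < q0 by rewrite divr_gt0// mulr_gt0.
pose om i := (H (k1 i) - H (k0 i)) / D.
have k01 i : k0 i < k1 i.
  rewrite /k0 /k1 (@lt_le_trans _ _ 2)//; last by rewrite ler_nat.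
  by rewrite (@le_lt_trans _ _ 1)// ?ltr1n// invf_le1// ler1n.
have k00 i : 0 < k0 i by rewrite invr_gt0.
have omoo : om @ \oo --> Hoo / D by apply: cvgMr_tmp; exact: cvg_H.
have Hd0 : 0 < Hoo / D by rewrite divr_gt0.
have lim : (Hoo / D) `^ (m^-1 - 1) * sg `^ (1 - n / m) * mass1_oo <=
    n / m * ((p + 1) / 2) * (mu / q0 / (Hoo / D) * mass2_oo + A / (mu / q0)) +
    (1 - n / m) * sg * B.
  have cl : (fun i => om i `^ (m^-1 - 1) * sg `^ (1 - n / m) *
      (mass1 (k1 i) - mass1 (k0 i))) @ \oo -->
      (Hoo / D) `^ (m^-1 - 1) * sg `^ (1 - n / m) * mass1_oo.
    apply: cvgM; last exact: cvg_mass1.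
    by apply: cvgMr_tmp; exact: cvg_powR_gt0.
  have cr : (fun i => n / m * ((p + 1) / 2) * (mu / q0 / om i *
       (mass2 (k1 i) - mass2 (k0 i)) + A / (mu / q0)) + (1 - n / m) * sg * B) @ \oo -->
      n / m * ((p + 1) / 2) * (mu / q0 / (Hoo / D) * mass2_oo + A / (mu / q0)) +
      (1 - n / m) * sg * B.
    apply: cvgD; last exact: cvg_cst.
    apply: cvgMl_tmp; apply: cvgD; last exact: cvg_cst.
    apply: cvgM; last exact: cvg_mass2.
    by apply: cvgMl_tmp; apply: cvgV => //; rewrite gt_eqF.
  apply: (ler_cvg_to cl cr); near=> i.
  exact: (h _ _ _ _ _ (k00 i) (k01 i) sg0 (divr_gt0 mu0 q00) erefl).
have E1 : (D / Hoo) `^ (1 - m^-1) = (Hoo / D) `^ (m^-1 - 1).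
  rewrite -[D / Hoo]invrK invf_div -powR_inv1 ?(ltW Hd0)// -powRrM.
  by congr powR; ring.
rewrite E1 -(ler_pM2r moo0) (le_trans lim)// le_eqVlt; apply/orP; left; apply/eqP.
have mE : m - 1 = (p + 1) / (p - 1) by rewrite /m; field; rewrite gt_eqF.
have E2 : mass2_oo * (p + 1) = q0 * mass1_oo.
  have mp : (m - 1) * (p - 1) = p + 1 by rewrite mE divfK ?gt_eqF.
  rewrite /mass2_oo /mass1_oo /q0; have := r_gt0; set r := 2 * (m - 1) - n => r0.
  transitivity (n * (p + 1) / r * Hoo); first by ring.
  by rewrite -mp; field; rewrite gt_eqF.
have E3 : mu / q0 / (Hoo / D) * mass2_oo = mu * (D / Hoo) * mass1_oo / (p + 1).
  apply: (mulIf (lt0r_neq0 (addr_gt0 p0 ltr01))).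
  rewrite -(mulrA _ mass2_oo) E2; field.
  by rewrite !gt_eqF// addr_gt0.
rewrite E3 /q0; field.
by rewrite !gt_eqF// addr_gt0.
Unshelve. all: by end_near. Qed.

End calibration.
End transport.

(** * Integrals of the extremal profiles *)

Section primitives.
Context (R : realType).
Notation mu := (@lebesgue_measure R).
Implicit Types f : R -> R.

Definition primitive (f : R -> R) (a x : R) : R := \int[mu]_(t in `[a, x]) f t.

Lemma is_derive_primitive f (a x : R) : a < x ->
  (forall b, mu.-integrable `[a, b] (EFin \o f)) ->
  {for x, continuous f} -> is_derive x 1 (primitive f a) (f x).
Proof.
move=> ax fi fx.
have xu : x < x + 1 by rewrite ltrDl.
have [h1 h2] := continuous_FTC1_closed xu (fi (x + 1)) ax fx.
by apply: DeriveDef; [exact: h1|rewrite -derive1E; exact: h2].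
Qed.

Lemma primitiveE f (a b : R) : mu.-integrable `[a, b] (EFin \o f) ->
  (primitive f a b)%:E = (\int[mu]_(t in `[a, b]) (f t)%:E)%E.
Proof. by move=> fi; rewrite /primitive /Rintegral fineK// integrable_fin_num. Qed.

Lemma primitive_ge0 f (a b : R) : (forall t, 0 <= f t) -> 0 <= primitive f a b.
Proof. by move=> f0; apply: Rintegral_ge0. Qed.

Lemma primitive_le_integral f (a b : R) (M : \bar R) : 0 <= a ->
  (forall t, 0 <= f t) -> measurable_fun setT f ->
  mu.-integrable `[a, b] (EFin \o f) ->
  (\int[mu]_(t in `[0%R, +oo[) (f t)%:E <= M)%E -> ((primitive f a b)%:E <= M)%E.
Proof.
move=> a0 f0 mf fi fM; rewrite primitiveE//; apply: le_trans fM.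
apply: ge0_subset_integral => //.
- by apply/measurable_EFinP; exact: measurable_funTS.
- by move=> t _; rewrite lee_fin.
- by move=> t /=; rewrite !in_itv/= => /andP[at_ _]; rewrite andbT (le_trans a0).
Qed.

Lemma primitive_full f (b : R) : (forall t, b < t -> f t = 0) -> (forall t, 0 <= f t) ->
  mu.-integrable `[0, b] (EFin \o f) -> 0 <= b ->
  (primitive f 0 b)%:E = (\int[mu]_(t in `[0%R, +oo[) (f t)%:E)%E.
Proof.
move=> fb f0 fi b0; rewrite primitiveE//.
rewrite integral_mkcond [RHS]integral_mkcond; apply: eq_integral => t _.
rewrite !patchE !mem_setE !in_itv/= andbT.
by case: (leP 0 t) => //= t0; case: (leP t b) => // /fb ->.
Qed.

Lemma bounded_integrable f (M a b : R) : measurable_fun setT f ->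
  (forall t, a <= t <= b -> `|f t| <= M) -> mu.-integrable `[a, b] (EFin \o f).
Proof.
move=> mf fM.
have abfin : (mu (`[a, b]%classic : set R) < +oo)%E.
  by rewrite lebesgue_measure_itv/=; case: ifP => _; rewrite -?EFinB ltry.
apply: measurable_bounded_integrable => //.
- exact: measurable_funTS.
- exists M; split; first exact: num_real.
  move=> x Mx t /=; rewrite in_itv/= => tab.
  by rewrite (le_trans (fM t tab))// ltW.
Qed.

Lemma continuous_integrable f (a b : R) : measurable_fun setT f ->
  (forall t, a <= t -> {for t, continuous f}) -> mu.-integrable `[a, b] (EFin \o f).
Proof.
move=> mf fc; apply: continuous_compact_integrable; first exact: segment_compact.
apply: continuous_in_subspaceT => t; rewrite inE/= in_itv/= => /andP[ta _].
exact: fc.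
Qed.

Lemma primitive_cvg0 f (M : R) : measurable_fun setT f ->
  (forall t, 0 <= f t <= M) -> primitive f 0 @ 0^'+ --> 0.
Proof.
move=> mf fM.
have M0 : 0 <= M by have /andP[] := fM 0; exact: le_trans.
have fi b : mu.-integrable `[0, b] (EFin \o f).
  apply: (@bounded_integrable _ M) => // t _.
  by have /andP[f0 f1] := fM t; rewrite ger0_norm.
apply: (squeeze_cvgr (f := fun=> 0) (h := fun x => M * x)); last 2 first.
- exact: cvg_cst.
- rewrite -[X in _ --> X](mulr0 M); apply: cvgMl_tmp.
  exact: (cvg_at_right_filter cvg_id).
near=> x; have x0 : 0 < x by near: x; exact: nbhs_right_gt.
rewrite primitive_ge0/=; last by move=> t; have /andP[] := fM t.
rewrite -lee_fin primitiveE//.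
apply: (@le_trans _ _ (\int[mu]_(t in `[0%R, x]) (cst M%:E) t)%E).
  apply: ge0_le_integral => //.
  - by move=> t _; rewrite lee_fin; have /andP[] := fM t.
  - by apply/measurable_EFinP; exact: measurable_funTS.
  - by move=> t _; rewrite lee_fin; have /andP[] := fM t.
by rewrite integral_cst//= lebesgue_measure_itv/= lte_fin x0 sube0.
Unshelve. all: by end_near. Qed.

(** The primitive of a nonnegative function is nondecreasing, so its limit can
    be taken along the integers, where monotone convergence applies. *)
Lemma primitive_cvgy f (M l : R) : measurable_fun setT f ->
  (forall t, 0 <= f t <= M) ->
  (\int[mu]_(t in `[0%R, +oo[) (f t)%:E)%E = l%:E -> primitive f 0 @ +oo --> l.
Proof.
move=> mf fM fl.
have fi b : mu.-integrable `[0, b] (EFin \o f).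
  apply: (@bounded_integrable _ M) => // t _.
  by have /andP[f0 f1] := fM t; rewrite ger0_norm.
have f0 t : 0 <= f t by have /andP[] := fM t.
have cn : (fun k : nat => primitive f 0 k%:R) @ \oo --> l.
  have := @ge0_cvgn_integral R mu f f0 mf; rewrite fl.
  rewrite (_ : (fun _ => _) = (fun k : nat => (primitive f 0 k%:R)%:E)).
    by move/fine_cvgP => [].
  by apply/funext => k; rewrite primitiveE.
have le_prim b : primitive f 0 b <= l.
  by rewrite -lee_fin; apply: primitive_le_integral => //; rewrite fl.
apply/cvgrPdist_le => e e0.
move/cvgrPdist_le : cn => /(_ e e0)[k _ /(_ k (leqnn k))] /=.
rewrite ger0_norm ?subr_ge0// => lk.
near=> x; have kx : k%:R <= x by near: x; apply: nbhs_pinfty_ge; exact: num_real.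
rewrite ger0_norm ?subr_ge0// (le_trans _ lk)// lerB//.
rewrite -lee_fin !primitiveE//; apply: ge0_subset_integral => //.
- by apply/measurable_EFinP; exact: measurable_funTS.
- by move=> t _; rewrite lee_fin.
- by move=> t /=; rewrite !in_itv/= => /andP[-> tk]; rewrite (le_trans tk).
Unshelve. all: by end_near. Qed.

End primitives.

Section profile_integrals.
Context (R : realType).
Variable n : R.
Hypothesis n0 : 0 < n.
Notation mu := (@lebesgue_measure R).

Definition prof (j y : R) : R := bub n y `^ (- j).

Lemma prof_ge0 j y : 0 <= prof j y. Proof. exact: powR_ge0. Qed.

Lemma prof_gt0 j y : 0 < prof j y. Proof. by rewrite powR_gt0// bub_gt0. Qed.

Lemma prof_le1 j y : 0 <= j -> prof j y <= 1.
Proof.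
move=> j0; rewrite /prof powRN invf_le1 ?powR_gt0 ?bub_gt0//.
apply: (@le_trans _ _ (bub n y `^ 0)); first by rewrite powRr0.
by rewrite ler_powR ?bub_ge1.
Qed.

Lemma measurable_bub : measurable_fun setT (bub n).
Proof. by apply: measurable_funD => //; exact: measurable_powR. Qed.

Lemma measurable_prof j : measurable_fun setT (prof j).
Proof.
by apply: (measurableT_comp (measurable_powR (- j))); exact: measurable_bub.
Qed.

Lemma continuous_prof j (y : R) : 0 < y -> {for y, continuous (prof j)}.
Proof.
move=> y0; apply: cvg_powR_gt0; first exact: bub_gt0.
apply/differentiable_continuous/derivable1_diffP.
by have := is_derive_bub n y0 => ?; exact: ex_derive.
Qed.

Lemma prof_integrable j (b : R) : 0 <= j -> mu.-integrable `[0, b] (EFin \o prof j).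
Proof.
move=> j0; apply: (@bounded_integrable _ _ 1); first exact: measurable_prof.
by move=> t _; rewrite ger0_norm ?prof_ge0// prof_le1.
Qed.

Definition Hprof (j x : R) : R := primitive (prof j) 0 x.

Lemma is_derive_Hprof j (x : R) : 0 <= j -> 0 < x ->
  is_derive x 1 (Hprof j) (prof j x).
Proof.
move=> j0 x0; apply: is_derive_primitive => //; last exact: continuous_prof.
by move=> b; exact: prof_integrable.
Qed.

Lemma Hprof_right0 j : 0 <= j -> Hprof j @ 0^'+ --> 0.
Proof.
move=> j0; apply: (@primitive_cvg0 _ _ 1); first exact: measurable_prof.
by move=> t; rewrite prof_ge0 prof_le1.
Qed.

(** The value of the integral as a real number; the integral is finite when n <
    2 j. *)
Definition Jprof (j : R) : R := fine (\int[mu]_(t in `[0%R, +oo[) (prof j t)%:E)%E.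

(** Beyond 1 the profile lies below y^(-2 j/n), and the hypothesis on j makes
    this power integrable at infinity. *)
Lemma Hprof_bounded j (x : R) : n < 2 * j -> 1 < x ->
  Hprof j x <= Hprof j 1 + (2 * j / n - 1)^-1.
Proof.
move=> nj x1; set s := 2 * j / n.
have j0 : 0 <= j by have := n0; lra.
have s1 : 0 < s - 1 by rewrite subr_gt0 ltr_pdivlMr// mul1r.
pose F (z : R) := Hprof j z + (s - 1)^-1 * z `^ (1 - s).
have Fd (z : R) : 2^-1 < z -> is_derive z 1 F (prof j z - z `^ (- s)).
  move=> z2; have z0 : 0 < z by rewrite (lt_trans _ z2).
  have h1 := is_derive_scale (s - 1)^-1 (is_derive1_powR (1 - s) z0).
  apply: (is_derive_cast (is_derive_add (is_derive_Hprof j0 z0) h1)).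
  rewrite (_ : 1 - s - 1 = - s); last by ring.
  by field; rewrite gt_eqF.
have le_pow z : 2^-1 < z -> prof j z - z `^ (- s) <= 0.
  move=> z2; have z0 : 0 < z by rewrite (lt_trans _ z2).
  have -> : z `^ (- s) = (z `^ (2 / n)) `^ (- j).
    by rewrite -powRrM; congr powR; rewrite /s; field; rewrite gt_eqF.
  rewrite subr_le0 /prof !(powRN _ j) lef_pV2 ?posrE ?powR_gt0 ?bub_gt0//.
  by rewrite ge0_ler_powR ?nnegrE ?powR_ge0 ?(ltW (bub_gt0 _ _))// /bub lerDr.
have : F x <= F 1.
  by apply: (@is_derive_le R F (fun z => prof j z - z `^ (- s)) 2^-1) => //;
    [lra|exact: ltW].
rewrite /F powR1 mulr1; apply: le_trans.
by rewrite lerDl mulr_ge0 ?powR_ge0// invr_ge0 ltW.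
Qed.

Lemma Jprof_fin j : n < 2 * j ->
  (\int[mu]_(t in `[0%R, +oo[) (prof j t)%:E)%E \is a fin_num.
Proof.
move=> nj; have j0 : 0 <= j by have := n0; lra.
rewrite ge0_fin_numE; last by apply: integral_ge0 => t _; rewrite lee_fin prof_ge0.
apply: (@le_lt_trans _ _ (Hprof j 1 + (2 * j / n - 1)^-1)%:E); last exact: ltry.
have := @ge0_cvgn_integral R mu _ (prof_ge0 j) (measurable_prof j).
move=> h; apply: (cvge_to_le h); near=> k.
rewrite -primitiveE; last exact: prof_integrable.
rewrite lee_fin; apply: Hprof_bounded => //.
by rewrite ltr1n; near: k; exists 2%N.
Unshelve. all: by end_near. Qed.

Lemma JprofE j : n < 2 * j ->
  (\int[mu]_(t in `[0%R, +oo[) (prof j t)%:E)%E = (Jprof j)%:E.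
Proof. by move=> nj; rewrite fineK// Jprof_fin. Qed.

Lemma Hprof_cvgy j : n < 2 * j -> Hprof j @ +oo --> Jprof j.
Proof.
move=> nj; have j0 : 0 <= j by have := n0; lra.
apply: (@primitive_cvgy _ _ 1); first exact: measurable_prof.
- by move=> t; rewrite prof_ge0 prof_le1.
- exact: JprofE.
Qed.

(** The function y (1 + y^(2/n))^(-j) vanishes at both ends of the half-line, so
    its derivative, a combination of the profiles j and j + 1, has integral
    zero. *)
Lemma Jprof_rec j : n < 2 * j -> Jprof (j + 1) = (1 - n / (2 * j)) * Jprof j.
Proof.
move=> nj; have j0 : 0 <= j by have := n0; lra.
have nj1 : n < 2 * (j + 1) by lra.
have j10 : 0 <= j + 1 by lra.
set s := 2 * j / n.
pose G (z : R) := z * prof j z + (s - 1) * Hprof j z - s * Hprof (j + 1) z.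
have Gd (z : R) : 0 < z -> is_derive z 1 G 0.
  move=> z0; have h1 := is_derive_bub_powR n0 j z0.
  have h2 := is_derive_scale (s - 1) (is_derive_Hprof j0 z0).
  have h3 := is_derive_scale s (is_derive_Hprof j10 z0).
  apply: (is_derive_cast (is_derive_sub (is_derive_add h1 h2) h3)).
  rewrite /prof opprD -/s; ring.
have Gc (x y : R) : 0 < x -> x <= y -> G x = G y.
  move=> x0 xy; have x20 : 0 < x / 2 by rewrite divr_gt0.
  have xx : x / 2 < x by rewrite ltr_pdivrMr// mulr2n mulrDr mulr1 ltrDl.
  apply/eqP; rewrite eq_le; apply/andP; split; last first.
    apply: (@is_derive_le R G (fun=> 0) (x / 2)) => // z xz.
    by apply: Gd; exact: lt_trans xz.
  rewrite -lerN2; apply: (@is_derive_le R (fun z => - G z) (fun=> - 0) (x / 2)) => //.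
  by move=> z xz; apply: is_deriveN; apply: Gd; exact: lt_trans xz.
have G0 : G @ 0^'+ --> 0.
  rewrite -[X in _ --> X](_ : 0 + (s - 1) * 0 - s * 0 = 0); last by ring.
  apply: cvgB; last by apply: cvgMl_tmp; exact: Hprof_right0.
  apply: cvgD; last by apply: cvgMl_tmp; exact: Hprof_right0.
  exact: bub_head.
have Goo : G @ +oo --> 0 + (s - 1) * Jprof j - s * Jprof (j + 1).
  apply: cvgB; last by apply: cvgMl_tmp; exact: Hprof_cvgy.
  apply: cvgD; last by apply: cvgMl_tmp; exact: Hprof_cvgy.
  exact: bub_tail.
have G10 : G 1 = 0.
  have G1 : G @ 0^'+ --> G 1.
    apply: cvg_near_cst; near=> x.
    have x0 : 0 < x by near: x; exact: nbhs_right_gt.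
    by apply: Gc => //; near: x; exact: nbhs_right_le.
  exact: (cvg_unique _ G1 G0).
have GE : 0 + (s - 1) * Jprof j - s * Jprof (j + 1) = 0.
  have G1 : G @ +oo --> (0 : R).
    apply: cvg_near_cst; near=> x.
    have x1 : 1 <= x by near: x; apply: nbhs_pinfty_ge; exact: num_real.
    by rewrite -(Gc 1 x).
  exact: (cvg_unique _ Goo G1).
have s0 : s != 0 by rewrite gt_eqF// divr_gt0//; have := n0; lra.
have {GE} -> : Jprof (j + 1) = (s - 1) / s * Jprof j.
  apply: (mulfI s0); rewrite mulrA (mulrCA s) mulfV// mulr1.
  by move: GE; rewrite add0r => /eqP; rewrite subr_eq0 => /eqP <-.
congr (_ * _); rewrite /s; field.
have j1 : 0 < j by have := n0; lra.
by rewrite !gt_eqF.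
Unshelve. all: by end_near. Qed.

Lemma Jprof_gt0 j : n < 2 * j -> 0 < Jprof j.
Proof.
move=> nj; have j0 : 0 <= j by have := n0; lra.
have [c c0 cle] : exists2 c, 0 < c & forall t, 0 <= t -> t <= 1 -> c <= prof j t.
  exists (prof j 1) => [|t t0 t1]; first exact: prof_gt0.
  by apply: le_powR_neg; [exact: bub_gt0|exact: le_bub|rewrite oppr_le0].
rewrite -lte_fin -JprofE//.
apply: (@lt_le_trans _ _ c%:E); first by rewrite lte_fin.
apply: (@le_trans _ _ (\int[mu]_(t in `[0%R, 1%R]) cst c%:E t)%E).
  by rewrite integral_cst//= lebesgue_measure_itv/= lte01 sube0 mule1.
apply: (@le_trans _ _ (\int[mu]_(t in `[0%R, 1%R]) (prof j t)%:E)%E).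
  apply: ge0_le_integral.
  - exact: measurable_itv.
  - by move=> t _; rewrite lee_fin ltW.
  - exact: measurable_cst.
  - by apply/measurable_EFinP; apply: measurable_funTS; exact: measurable_prof.
  - by move=> t /=; rewrite in_itv/= => /andP[t0 t1]; rewrite lee_fin cle.
apply: ge0_subset_integral => //.
- by apply/measurable_EFinP; apply: measurable_funTS; exact: measurable_prof.
- by move=> t _; rewrite lee_fin prof_ge0.
- by move=> t /=; rewrite !in_itv/= => /andP[-> _].
Qed.

End profile_integrals.

(** * The one-dimensional inequality in integral form *)

Section truncation.
Context (R : realType).

Lemma continuous_pospart_powR0 (q : R) : 0 < q ->
  {for (0 : R), continuous (fun z : R => Num.max z 0 `^ q)}.
Proof.
move=> q0; rewrite /prop_for /continuous_at maxxx powR0 ?gt_eqF//.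
apply/cvgr0Pnorm_lt => e e0; near=> z.
have ze : `|z| < e `^ q^-1.
  by near: z; apply: (@nbhs0_lt R R); rewrite powR_gt0.
have eE : e = (e `^ q^-1) `^ q by rewrite -powRrM mulVf ?gt_eqF// powRr1// ltW.
rewrite ger0_norm ?powR_ge0// [ltRHS]eE gt0_ltr_powR ?nnegrE ?powR_ge0//.
  by rewrite le_max lexx orbT.
by rewrite gt_max powR_gt0// (le_lt_trans (ler_norm z)).
Unshelve. all: by end_near. Qed.

(** At 0 the difference quotient is the power q - 1 of the positive part, which
    is continuous since q > 1. *)
Lemma is_derive_pospart_powR (q z : R) : 1 < q ->
  is_derive z 1 (fun z : R => Num.max z 0 `^ q) (q * Num.max z 0 `^ (q - 1)).
Proof.
move=> q1; have q0 : 0 < q by exact: lt_trans q1.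
have q10 : 0 < q - 1 by rewrite subr_gt0.
have [z0|z0|->] := ltgtP z 0.
- rewrite powR0 ?gt_eqF// mulr0.
  apply: (@near_eq_is_derive R R R (fun=> 0)).
  near=> x; have x0 : x < 0 by near: x; exact: lt_nbhsl.
  by rewrite max_r ?(ltW x0)// powR0 ?gt_eqF.
- apply: (@near_eq_is_derive R R R (fun x : R => x `^ q)); last exact: is_derive1_powR.
  near=> x; have x0 : 0 < x by near: x; exact: lt_nbhsr.
  by rewrite max_l ?(ltW x0).
- rewrite powR0 ?gt_eqF// mulr0.
  apply/is_derive1_caratheodory; exists (fun z : R => Num.max z 0 `^ (q - 1)); split.
  + move=> x; rewrite maxxx powR0 ?gt_eqF// !subr0.
    have [x0|x0] := leP x 0; first by rewrite !powR0 ?gt_eqF// mul0r.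
    by rewrite powR_gt0B1// divfK ?gt_eqF.
  + exact: continuous_pospart_powR0.
  + by rewrite maxxx powR0 ?gt_eqF.
Unshelve. all: by end_near. Qed.

(** Lowering |z| by eps gives a bounded support to functions that vanish at
    infinity, so the masses to be transported are finite. *)
Definition trunc (eps z : R) : R := Num.max (`|z| - eps) 0.

Lemma trunc_ge0 eps z : 0 <= trunc eps z.
Proof. by rewrite le_max lexx orbT. Qed.

Lemma trunc_le eps z : 0 <= eps -> trunc eps z <= `|z|.
Proof. by move=> e0; rewrite ge_max normr_ge0 andbT gerBl. Qed.

Lemma trunc_powR eps z q : 0 < eps -> 0 < q ->
  trunc eps z `^ q = Num.max (z - eps) 0 `^ q + Num.max (- z - eps) 0 `^ q.
Proof.
move=> e0 q0; rewrite /trunc; have [z0|z0] := leP 0 z.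
  rewrite [X in _ + X `^ _]max_r; last by lra.
  by rewrite powR0 ?gt_eqF// addr0 ger0_norm.
rewrite [X in _ = X `^ _ + _]max_r; last by lra.
by rewrite powR0 ?gt_eqF// add0r ltr0_norm.
Qed.

Definition dtrunc (eps q z : R) : R :=
  q * (Num.max (z - eps) 0 `^ (q - 1) - Num.max (- z - eps) 0 `^ (q - 1)).

Lemma is_derive_trunc_powR (f : R -> R) (x df eps q : R) : 0 < eps -> 1 < q ->
  is_derive x 1 f df ->
  is_derive x 1 (fun y => trunc eps (f y) `^ q) (dtrunc eps q (f x) * df).
Proof.
move=> e0 q1 fd; have q0 : 0 < q by exact: lt_trans q1.
rewrite (_ : (fun y => _) =
    (fun y => Num.max (f y - eps) 0 `^ q + Num.max (- f y - eps) 0 `^ q)).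
  have h1 : is_derive x 1 (fun y => f y - eps) df.
    apply: (is_derive_cast (is_derive_sub fd (is_derive_cst eps x 1))).
    by rewrite subr0.
  have h2 : is_derive x 1 (fun y => - f y - eps) (- df).
    apply: (is_derive_cast (is_derive_sub (is_deriveN fd) (is_derive_cst eps x 1))).
    by rewrite subr0.
  have g1 := is_derive_chain (f := fun y => f y - eps) (is_derive_pospart_powR (f x - eps) q1) h1.
  have g2 := is_derive_chain (f := fun y => - f y - eps) (is_derive_pospart_powR (- f x - eps) q1) h2.
  by apply: (is_derive_cast (is_derive_add g1 g2)); rewrite /dtrunc; ring.
by apply/funext => y; rewrite trunc_powR.
Qed.

Lemma normr_dtrunc (eps q z : R) : 0 < eps -> 1 < q ->
  `|dtrunc eps q z| = q * trunc eps z `^ (q - 1).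
Proof.
move=> e0 q1; have q0 : 0 < q by exact: lt_trans q1.
have q10 : 0 < q - 1 by rewrite subr_gt0.
rewrite /dtrunc /trunc normrM gtr0_norm//; congr (_ * _).
have [z0|z0] := leP 0 z.
  rewrite [X in _ - X `^ _]max_r; last by lra.
  by rewrite powR0 ?gt_eqF// subr0 (ger0_norm z0) ger0_norm ?powR_ge0.
rewrite [X in `|X `^ _ - _|]max_r; last by lra.
by rewrite powR0 ?gt_eqF// sub0r normrN (ltr0_norm z0) ger0_norm ?powR_ge0.
Qed.

Lemma measurable_trunc (f : R -> R) eps q : measurable_fun setT f ->
  measurable_fun setT (fun y => trunc eps (f y) `^ q).
Proof.
move=> mf; apply: (measurableT_comp (measurable_powR q)).
apply: measurable_maxr; last exact: measurable_cst.
by apply: measurable_funB; [exact: measurableT_comp|exact: measurable_cst].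
Qed.

Lemma continuous_trunc_powR (f : R -> R) (x df eps q : R) : 0 < eps -> 1 < q ->
  is_derive x 1 f df -> {for x, continuous (fun y => trunc eps (f y) `^ q)}.
Proof.
move=> e0 q1 fd; apply/differentiable_continuous/derivable1_diffP.
by have := is_derive_trunc_powR e0 q1 fd => ?; exact: ex_derive.
Qed.

End truncation.

Section sharp_inequality.
Context (R : realType).
Variables (n p : R).
Hypotheses (n2 : 2 < n) (p1 : 1 < p).
Notation m := (2 * p / (p - 1)).
Hypothesis nm : n <= m.
Notation mu := (@lebesgue_measure R).

(** [calibration] is applied on [a, Y] with a > 0, because psi need not be
    differentiable at 0; the partial integrals are bounded by the full ones
    before a tends to 0. *)
Lemma sharp_inequality (psi dpsi : R -> R) (M eps Y0 A B D : R) :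
  measurable_fun setT psi -> measurable_fun setT dpsi ->
  (forall y : R, 0 < y -> is_derive y 1 psi (dpsi y)) ->
  (forall y : R, 0 < y -> {for y, continuous dpsi}) ->
  (forall y, `|psi y| <= M) -> 0 < eps ->
  (forall y, Y0 <= y -> `|psi y| <= eps) ->
  (\int[mu]_(y in `[0%R, +oo[) (dpsi y ^+ 2 * y `^ (2 - 2 / n))%:E <= A%:E)%E ->
  (\int[mu]_(y in `[0%R, +oo[) (trunc eps (psi y) `^ (p + 1))%:E <= B%:E)%E ->
  (\int[mu]_(y in `[0%R, +oo[) (trunc eps (psi y) `^ (2 * p))%:E = D%:E)%E ->
  0 < A -> 0 < B -> 0 < D ->
  (D / Jprof n m) `^ (1 - m^-1 - n / m / 2) <=
  (A * (n * (p ^+ 2 - 1) / 2) / Jprof n (m - 1)) `^ (n / m / 2) *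
  (B / Jprof n (m - 1)) `^ (1 - n / m).
Proof.
move=> mpsi mdpsi dpsiE dpsic psiM e0 psi0 iA iB iD A0 B0 D0.
have p0 : 0 < p by exact: lt_trans p1.
have pm10 : 0 < p - 1 by rewrite subr_gt0.
have n0 : 0 < n by exact: lt_trans n2.
have m0 : 0 < m by exact: lt_le_trans nm.
have [nm2 nm1] : n < 2 * m /\ n < 2 * (m - 1).
  by have := nm; have := n2; move: (2 * p / (p - 1)) => mm; split; lra.
have J0 : 0 < Jprof n m by exact: Jprof_gt0.
have Joo : mass1_oo n p (Jprof n m) = Jprof n (m - 1).
  have := Jprof_rec n0 nm1; rewrite subrK => ->.
  rewrite /mass1_oo.
  set r := 2 * (m - 1); have r0 : 0 < r by rewrite /r; lra.
  have rn : 0 < r - n by rewrite subr_gt0.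
  by field; rewrite !gt_eqF.
rewrite -Joo.
have H0 := Hprof_right0 n (ltW m0).
have Hy := Hprof_cvgy n0 nm2.
apply: (sharp_of_family n2 p1 nm H0 Hy J0 D0 A0 B0) => x y sg mu' om x0 xy sg0 mu0 omE.
have Hd (z : R) : 0 < z -> is_derive z 1 (Hprof n m) (bub n z `^ (- m)).
  by move=> z0; exact: (is_derive_Hprof n (ltW m0) z0).
have Hxy : 0 < Hprof n m y - Hprof n m x.
  rewrite subr_gt0; apply: (@is_derive_increasing R _ (prof n m) (x / 2)) => //.
  - by rewrite ltr_pdivrMr// mulr2n mulrDr mulr1 ltrDl.
  - by move=> z xz; apply: Hd; rewrite (lt_trans _ xz)// divr_gt0.
  - by move=> z _; exact: prof_gt0.
have om0 : 0 < om by rewrite omE divr_gt0.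
pose u z := trunc eps (psi z).
have u0 z : 0 <= u z by exact: trunc_ge0.
have uM z : u z <= M by rewrite (le_trans (trunc_le _ (ltW e0))).
have M0 : 0 <= M by exact: le_trans (psiM 0).
have uY z : Y0 <= z -> u z = 0.
  by move=> yz; rewrite /u /trunc max_r// subr_le0 psi0.
have ub q z : 0 <= q -> 0 <= u z `^ q <= M `^ q.
  by move=> q0; rewrite powR_ge0 ge0_ler_powR ?nnegrE.
have mu_ q : measurable_fun setT (fun z => u z `^ q) by exact: measurable_trunc.
have ui q a b : 0 <= q -> mu.-integrable `[a, b] (EFin \o (fun z => u z `^ q)).
  move=> q0; apply: (@bounded_integrable _ _ (M `^ q)) => // t _.
  by have /andP[h1 h2] := ub q t q0; rewrite ger0_norm.
have p20 : 0 < 2 * p by rewrite mulr_gt0.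
have p21 : 1 < 2 * p by lra.
have pp0 : 0 < p + 1 by rewrite addr_gt0.
have pp1 : 1 < p + 1 by rewrite ltrDr.
pose U := primitive (fun z => u z `^ (2 * p)) 0.
have U0 z : 0 <= U z by apply: primitive_ge0 => t; exact: powR_ge0.
have UD z : U z <= D.
  rewrite -lee_fin; apply: primitive_le_integral => //.
  - by move=> t; exact: powR_ge0.
  - by apply: ui; exact: ltW.
  - by rewrite iD.
have mA : measurable_fun setT (fun z => dpsi z ^+ 2 * z `^ (2 - 2 / n)).
  by apply: measurable_funM; [exact: measurable_funX|exact: measurable_powR].
have cA (z : R) : 0 < z -> {for z, continuous (fun z => dpsi z ^+ 2 * z `^ (2 - 2 / n))}.
  move=> z0; apply: continuousM; last exact: continuous_powR_gt0.
  by rewrite /prop_for /continuous_at; apply: cvgM; exact: dpsic.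
have key a : 0 < a -> a < 1 ->
    om `^ (m^-1 - 1) * sg `^ (1 - n / m) *
     (mass1 n p (Hprof n m) y - mass1 n p (Hprof n m) x - bub n y * (om * U a)) <=
    n / m * ((p + 1) / 2) * (mu' / om *
      (mass2 n p (Hprof n m) y - mass2 n p (Hprof n m) x) + A / mu') +
    (1 - n / m) * sg * B.
  move=> a0 a1; pose a' := a / 2.
  have a'0 : 0 < a' by rewrite divr_gt0.
  have a'a : a' < a by rewrite ltr_pdivrMr// mulr2n mulrDr mulr1 ltrDl.
  pose Y := Num.max Y0 1.
  have aY : a <= Y by rewrite le_max (ltW a1) orbT.
  pose VA := primitive (fun z => dpsi z ^+ 2 * z `^ (2 - 2 / n)) a'.
  pose VB := primitive (fun z => u z `^ (p + 1)) a'.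
  have YY0 : Y0 <= Y by rewrite le_max lexx.
  have := @calibration R n p n2 p1 nm (Hprof n m) Hd x y om sg mu' a' a Y u U
    (fun z => dtrunc eps (p + 1) (psi z) * dpsi z) (fun z => `|dpsi z|) VA VB
    x0 xy om0 sg0 mu0 a'0 a'a aY u0.
  move=> /(_ _ _ _ _ _ _ (uY _ YY0) _).
  have h1 z : a' < z -> is_derive z 1 U (u z `^ (2 * p)).
    move=> az; have z0 : 0 < z by exact: lt_trans az.
    apply: is_derive_primitive => //; first by move=> b; apply: ui; exact: ltW.
    exact: continuous_trunc_powR e0 p21 (dpsiE z z0).
  have h2 z : a' < z -> 0 <= om * U z <= Hprof n m y - Hprof n m x.
    move=> az; rewrite mulr_ge0 ?(ltW om0)//= omE mulrAC ler_pdivrMr//.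
    by rewrite ler_wpM2l// ltW.
  have h3 z : a' < z -> is_derive z 1 (fun z => u z `^ (p + 1))
      (dtrunc eps (p + 1) (psi z) * dpsi z).
    move=> az; have z0 : 0 < z by exact: lt_trans az.
    exact: is_derive_trunc_powR e0 pp1 (dpsiE z z0).
  have h4 z : a' < z -> `|dtrunc eps (p + 1) (psi z) * dpsi z| <=
      (p + 1) * u z `^ p * `|dpsi z|.
    by move=> az; rewrite normrM normr_dtrunc// addrK.
  have h5 z : a' < z -> is_derive z 1 VA (`|dpsi z| ^+ 2 * z `^ (2 - 2 / n)).
    move=> az; have z0 : 0 < z by exact: lt_trans az.
    rewrite real_normK ?num_real//.
    apply: (is_derive_primitive az); last exact: cA.
    move=> b; apply: continuous_integrable => // t at_; apply: cA.
    exact: lt_le_trans at_.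
  have h6 z : a' < z -> is_derive z 1 VB (u z `^ (p + 1)).
    move=> az; have z0 : 0 < z by exact: lt_trans az.
    apply: (is_derive_primitive az); first by move=> b; apply: ui; exact: ltW.
    exact: continuous_trunc_powR e0 pp1 (dpsiE z z0).
  have UYD : U Y = D.
    apply: EFin_inj; rewrite -iD; apply: primitive_full.
    - by move=> t Yt; rewrite -/(u t) uY ?powR0 ?gt_eqF// (le_trans YY0)// ltW.
    - by move=> t; exact: powR_ge0.
    - by apply: ui; exact: ltW.
    - by rewrite le_max ler01 orbT.
  have h7 : om * U Y = Hprof n m y - Hprof n m x by rewrite UYD omE divfK ?gt_eqF.
  move=> /(_ h1 h2 h3 h4 h5 h6 h7) h; apply: (le_trans h).
  have nm0 : 0 <= n / m by rewrite divr_ge0 ?ltW.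
  have VAA : VA Y - VA a <= A.
    apply: (@le_trans _ _ (VA Y)).
      by rewrite gerBl primitive_ge0// => t; rewrite mulr_ge0 ?sqr_ge0 ?powR_ge0.
    rewrite -lee_fin; apply: primitive_le_integral => //; first exact: ltW.
      by move=> t; rewrite mulr_ge0 ?sqr_ge0 ?powR_ge0.
    apply: continuous_integrable => // t at_; apply: cA.
    exact: lt_le_trans at_.
  have VBB : VB Y - VB a <= B.
    apply: (@le_trans _ _ (VB Y)).
      by rewrite gerBl primitive_ge0// => t; rewrite powR_ge0.
    rewrite -lee_fin; apply: primitive_le_integral => //; first exact: ltW.
      by move=> t; rewrite powR_ge0.
    by apply: ui; exact: ltW.
  apply: lerD.
    apply: ler_wpM2l; first by rewrite mulr_ge0// divr_ge0// ltW.
    by rewrite lerD2l ler_wpM2r// invr_ge0 ltW.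
  rewrite ler_wpM2l// mulr_ge0 ?(ltW sg0)// subr_ge0.
  by rewrite ler_pdivrMr// mul1r.
have Uc : (fun a => om `^ (m^-1 - 1) * sg `^ (1 - n / m) *
     (mass1 n p (Hprof n m) y - mass1 n p (Hprof n m) x - bub n y * (om * U a))) @ 0^'+ -->
    om `^ (m^-1 - 1) * sg `^ (1 - n / m) *
     (mass1 n p (Hprof n m) y - mass1 n p (Hprof n m) x - bub n y * (om * 0)).
  apply: cvgMl_tmp; apply: cvgB; first exact: cvg_cst.
  apply: cvgMl_tmp; apply: cvgMl_tmp.
  apply: (@primitive_cvg0 _ _ (M `^ (2 * p))) => // t.
  by apply: ub; exact: ltW.
rewrite (_ : mass1 n p _ y - _ = mass1 n p (Hprof n m) y - mass1 n p (Hprof n m) x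
   - bub n y * (om * 0)); last by rewrite !mulr0 subr0.
apply: (cvgr_to_le Uc); near=> a; apply: key.
- by near: a; exact: nbhs_right_gt.
- by near: a; apply: nbhs_right_lt.
Unshelve. all: by end_near. Qed.

End sharp_inequality.

(** * The parameters *)

Section parameters.
Context (R : realType) (d : nat) (beta gamma p : R).
Hypotheses (hd : (2 <= d)%N)
  (hbeta : gamma - 2 < beta < (d%:R - 2) / d%:R * gamma)
  (hp : 1 < p <= p_star d beta gamma)
  (hgamma0 : gamma < 0)
  (hFS : beta_FS d gamma < beta).

(** Homogeneous dimension of the measure |x|^(-gamma) dx. *)
Definition hdim : R := d%:R - gamma.

(** The substitution s = |x|^al makes the weights of the gradient and of the
    function equal, at the price of the dimension [edim]. *)
Definition aexp : R := 1 + (beta - gamma) / 2.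
Definition edim : R := hdim / aexp.
Definition bexp : R := 2 * p / (p - 1).

(** [growth] and [scal] are the exponents of the one-dimensional inequality;
    [growth_theta] and [growth_theta1] convert them into theta. *)
Definition growth : R := edim / bexp.
Definition scal : R := 1 - bexp^-1 - growth / 2.

Let d2 : (2 : R) <= d%:R. Proof. by rewrite ler_nat. Qed.
Let d0 : (0 : R) < d%:R. Proof. exact: lt_le_trans d2. Qed.

Lemma hdim_gt : d%:R < hdim. Proof. by rewrite /hdim ltrDl oppr_gt0. Qed.
Lemma hdim_gt0 : 0 < hdim. Proof. exact: lt_trans hdim_gt. Qed.

Lemma aexp_gt0 : 0 < aexp.
Proof. by move: hbeta => /andP[h _]; rewrite /aexp; lra. Qed.

Lemma edim_aexp : edim * aexp = hdim.
Proof. by rewrite /edim divfK// gt_eqF// aexp_gt0. Qed.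

Lemma edim_gt : d%:R < edim.
Proof.
rewrite /edim ltr_pdivlMr ?aexp_gt0//.
move: hbeta => /andP[_]; rewrite mulrAC ltr_pdivlMr// /aexp /hdim.
by move=> h; lra.
Qed.

Lemma edim_gt2 : 2 < edim. Proof. exact: le_lt_trans edim_gt. Qed.

Lemma p_gt1 : 1 < p. Proof. by case/andP: hp. Qed.

Lemma beta_lt0 : beta < 0.
Proof.
move: hbeta => /andP[_ h]; apply: (lt_le_trans h).
rewrite mulr_ge0_le0 ?(ltW hgamma0)// divr_ge0 ?(ltW d0)//.
by rewrite subr_ge0.
Qed.

Lemma edim_le_bexp : edim <= bexp.
Proof.
have p1 := p_gt1; have a0 := aexp_gt0.
rewrite /bexp ler_pdivlMr ?subr_gt0//.
move: hp => /andP[_]; rewrite /p_star.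
have e2 := edim_gt2.
have -> : d%:R - 2 - beta = aexp * (edim - 2).
  by rewrite mulrBr (mulrC _ edim) edim_aexp /hdim /aexp; lra.
rewrite -/hdim ler_pdivlMr; last by rewrite mulr_gt0// subr_gt0.
rewrite -edim_aexp mulrCA (mulrC edim) ler_pM2l// => h; lra.
Qed.

Lemma thetaE : theta d beta gamma p = edim * (p - 1) / (p * (2 * (p + 1) - edim * (p - 1))).
Proof.
have a0 := aexp_gt0; rewrite /theta -/hdim.
have -> : d%:R + 2 + beta - 2 * gamma - p * (d%:R - 2 - beta) =
    aexp * (2 * (p + 1) - edim * (p - 1)).
  transitivity (2 * (p + 1) * aexp - (edim * aexp) * (p - 1)); last by ring.
  by rewrite edim_aexp /hdim /aexp; field.
rewrite -edim_aexp mulrCA invfM mulrA; congr (_ * _).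
by field; rewrite gt_eqF.
Qed.

Lemma edim_p : edim * (p - 1) <= 2 * p.
Proof.
have := edim_le_bexp; rewrite /bexp ler_pdivlMr// subr_gt0; exact: p_gt1.
Qed.

Let p0 : 0 < p. Proof. exact: lt_trans p_gt1. Qed.
Let pm1 : 0 < p - 1. Proof. by rewrite subr_gt0 p_gt1. Qed.
Let n0 : 0 < edim. Proof. exact: lt_trans edim_gt2. Qed.
Let den_gt0 : 0 < 2 * (p + 1) - edim * (p - 1).
Proof. by have := edim_p; lra. Qed.

Lemma theta_gt0 : 0 < theta d beta gamma p.
Proof.
have h1 := mulr_gt0 n0 pm1; have h2 := mulr_gt0 p0 den_gt0.
by rewrite thetaE divr_gt0.
Qed.

Lemma theta_le1 : theta d beta gamma p <= 1.
Proof.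
have h2 := mulr_gt0 p0 den_gt0.
rewrite thetaE ler_pdivrMr// mul1r -subr_ge0.
rewrite (_ : _ - _ = (p + 1) * (2 * p - edim * (p - 1))); last by ring.
by rewrite mulr_ge0 ?subr_ge0 ?edim_p// addr_ge0// ltW.
Qed.

Lemma scalE : scal = (2 * (p + 1) - edim * (p - 1)) / (4 * p).
Proof. by rewrite /scal /growth /bexp; field; rewrite !gt_eqF. Qed.

Lemma scal_gt0 : 0 < scal.
Proof. by rewrite scalE divr_gt0// mulr_gt0. Qed.

Lemma growth_theta : growth / 2 / scal / (2 * p) = theta d beta gamma p / 2.
Proof.
by rewrite scalE thetaE /growth /bexp; field; rewrite !gt_eqF.
Qed.

Lemma growth_theta1 : (1 - growth) / scal / (2 * p) = (1 - theta d beta gamma p) / (p + 1).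
Proof.
rewrite scalE thetaE /growth /bexp; field; rewrite !gt_eqF//.
by rewrite addr_gt0.
Qed.

(** Completing the square, the claim reads (2 al - N)^2 < N^2 - 4 (d - 1). The
    hypothesis on beta bounds 2 al - N from below by the negative root, while 2
    al < N because the dimension n exceeds 2. *)
Lemma FS_cond : d%:R - 1 < aexp ^+ 2 * (edim - 1).
Proof.
have a0 := aexp_gt0; have nE := edim_aexp.
have -> : aexp ^+ 2 * (edim - 1) = aexp * hdim - aexp ^+ 2 by rewrite -nE; ring.
set s := Num.sqrt ((d%:R - gamma) ^+ 2 - 4 * (d%:R - 1)).
have s2 : s ^+ 2 = hdim ^+ 2 - 4 * (d%:R - 1).
  rewrite /s sqr_sqrtr// subr_ge0 /hdim.
  by have := d2; have := hgamma0; nra.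
have s0 : 0 <= s by exact: sqrtr_ge0.
have h1 : hdim - s < 2 * aexp.
  by move: hFS; rewrite /beta_FS -/s /hdim /aexp; lra.
have h2 : 2 * aexp < hdim + s.
  have : 2 * aexp < hdim by rewrite -nE ltr_pM2r// edim_gt2.
  lra.
have : (2 * aexp - hdim) ^+ 2 < s ^+ 2.
  rewrite -(@real_normK _ (2 * aexp - hdim)) ?num_real//.
  by rewrite ltr_pXn2r ?nnegrE// ltr_norml; apply/andP; split; lra.
by rewrite s2; nra.
Qed.

End parameters.

(** * The sharp inequality for radial functions *)

Section radial_functions.
Context (R : realType) (d : nat).
Implicit Types (w : 'rV[R]_d -> R) (x v : 'rV[R]_d).

Lemma enorm_ge0 x : 0 <= enorm x. Proof. exact: sqrtr_ge0. Qed.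

Lemma enorm_sqr x : enorm x ^+ 2 = \sum_i x 0 i ^+ 2.
Proof. by rewrite sqr_sqrtr// sumr_ge0// => i _; exact: sqr_ge0. Qed.

Lemma enormZ r x : enorm (r *: x) = `|r| * enorm x.
Proof.
rewrite /enorm -(sqrtr_sqr r) -sqrtrM ?sqr_ge0// mulr_sumr.
by congr Num.sqrt; apply: eq_bigr => i _; rewrite mxE exprMn.
Qed.

Lemma enorm_delta (i : 'I_d) : enorm (delta_mx 0 i : 'rV[R]_d) = 1.
Proof.
rewrite /enorm (bigD1 i)//= mxE !eqxx/= expr1n big1 ?addr0 ?sqrtr1// => j ji.
by rewrite mxE eqxx (negbTE ji) expr0n.
Qed.

Lemma is_derive_line (f : 'rV[R]_d -> R) v (r D : R) :
  is_derive (r *: v) v f D <-> is_derive r 1 (fun s : R => f (s *: v)) D.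
Proof.
have E : (fun h : R => h^-1 *: ((f \o shift (r *: v)) (h *: v) - f (r *: v))) =
    (fun h : R => h^-1 *: (((fun s : R => f (s *: v)) \o shift r) (h *: (1 : R)) - f (r *: v))).
  by apply/funext => h /=; rewrite -scalerDl /GRing.scale/= mulr1.
split=> -[fd fD]; apply: DeriveDef.
- by move: fd; rewrite /derivable E.
- by move: fD; rewrite /derive E.
- by move: fd; rewrite /derivable E.
- by move: fD; rewrite /derive E.
Qed.

Lemma derive_partial w x v : differentiable w x ->
  'D_v w x = \sum_i v 0 i * partial i w x.
Proof.
move=> wx; rewrite deriveE// [in LHS](row_sum_delta v) linear_sum.
apply: eq_bigr => i _; rewrite linearZ /partial deriveE//.
Qed.

(** Cauchy--Schwarz, from the nonnegativity of the sum of the (partial_i w - s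
    v_i)^2 with s the derivative along v. *)
Lemma derive_le_grad w x v : differentiable w x -> enorm v = 1 ->
  `|'D_v w x| <= enorm (grad w x).
Proof.
move=> wx v1; rewrite -(@ler_pXn2r _ 2) ?nnegrE ?enorm_ge0//.
have -> : enorm (grad w x) ^+ 2 = \sum_i partial i w x ^+ 2.
  by rewrite enorm_sqr; apply: eq_bigr => i _; rewrite mxE.
rewrite real_normK ?num_real// derive_partial//.
set s := \sum_i _.
have : 0 <= \sum_i (partial i w x - s * v 0 i) ^+ 2.
  by apply: sumr_ge0 => i _; exact: sqr_ge0.
have -> : \sum_i (partial i w x - s * v 0 i) ^+ 2 =
    \sum_i partial i w x ^+ 2 - 2 * s * s + s ^+ 2 * \sum_i v 0 i ^+ 2.
  transitivity (\sum_i (partial i w x ^+ 2 - 2 * s * (v 0 i * partial i w x)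
      + s ^+ 2 * v 0 i ^+ 2)); first by apply: eq_bigr => i _; ring.
  by rewrite big_split/= sumrB -!mulr_sumr.
by rewrite -enorm_sqr v1; lra.
Qed.

Lemma continuous_scale_vec v (r : R) : {for r, continuous (fun s : R => s *: v)}.
Proof. by apply: scalel_continuous. Qed.

Variable i0 : 'I_d.
Let e0 : 'rV[R]_d := delta_mx 0 i0.

(** Restriction to a coordinate axis; for a radial function this is the radial
    profile, extended evenly to negative radii. *)
Definition profile w (r : R) : R := w (r *: e0).

Lemma radial_profile w x : radial w -> w x = profile w (enorm x).
Proof.
by move=> rw; apply: rw; rewrite enormZ enorm_delta mulr1 ger0_norm// enorm_ge0.
Qed.

Lemma is_derive_profile w (r : R) : differentiable w (r *: e0) ->
  is_derive r 1 (profile w) (partial i0 w (r *: e0)).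
Proof.
move=> wr; apply/is_derive_line; apply: DeriveDef => //.
exact: diff_derivable.
Qed.

(** A radial function has the same profile on all lines through the origin,
    so its derivative along the axis is also its derivative in the direction
    x/|x|. *)
Lemma profile_derive_le_grad w x : radial w -> (forall x, differentiable w x) ->
  enorm x != 0 -> `|partial i0 w (enorm x *: e0)| <= enorm (grad w x).
Proof.
move=> rw dw x0; pose v := (enorm x)^-1 *: x.
have v1 : enorm v = 1 by rewrite enormZ normfV (ger0_norm (enorm_ge0 x)) mulVf.
have xv : x = enorm x *: v by rewrite /v scalerA mulfV// scale1r.
have pv : profile w = (fun s => w (s *: v)).
  by apply/funext => s; apply: rw; rewrite (enormZ s e0) (enormZ s v) v1 enorm_delta.
have h1 := is_derive_profile (dw (enorm x *: e0)).
have h2 : is_derive x v w (partial i0 w (enorm x *: e0)).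
  by rewrite xv; apply/is_derive_line; rewrite -pv -xv.
have -> : partial i0 w (enorm x *: e0) = 'D_v w x by rewrite (derive_val (is_derive := h2)).
exact: derive_le_grad.
Qed.

Lemma profile_continuous w (r : R) : continuous w -> {for r, continuous (profile w)}.
Proof.
move=> wc; apply: (@continuous_comp _ _ _ (fun s : R => s *: e0) w).
  exact: continuous_scale_vec.
exact: wc.
Qed.

End radial_functions.

(** The integral of a nonnegative function is a supremum over the simple
    functions below it, hence monotone for arbitrary functions; this spares
    proving that gradients are measurable. *)
Lemma ge0_le_integral_nonmeas disp (T : measurableType disp) (R : realType)
    (mu : {measure set T -> \bar R}) (f g : T -> \bar R) :
  (forall x, 0 <= f x)%E -> (forall x, f x <= g x)%E ->
  (\int[mu]_x f x <= \int[mu]_x g x)%E.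
Proof.
move=> f0 fg; have g0 x : (0 <= g x)%E by exact: le_trans (f0 x) (fg x).
rewrite !ge0_integralTE//; apply: le_ereal_sup => _ [h hf <-].
by exists h => // x; exact: le_trans (hf x) (fg x).
Qed.

(** Turns the normalised inequality between powers of D, A and B into one with
    an explicit constant. *)
Lemma powR_normalized_product (R : realType) (A B D As Bs Ds s g q t1 t2 : R) :
  0 < A -> 0 < B -> 0 < D -> 0 < As -> 0 < Bs -> 0 < Ds -> 0 < s -> 0 < q ->
  g / 2 / s / q = t1 -> (1 - g) / s / q = t2 ->
  (D / Ds) `^ s <= (A / As) `^ (g / 2) * (B / Bs) `^ (1 - g) ->
  D `^ q^-1 <= Ds `^ q^-1 / (As `^ t1 * Bs `^ t2) * A `^ t1 * B `^ t2.
Proof.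
move=> A0 B0 D0 As0 Bs0 Ds0 s0 q0 g1 g2 h.
have sq0 : 0 <= s^-1 / q by rewrite divr_ge0 ?invr_ge0// ltW.
have pV (x y z : R) : 0 < x -> 0 < y -> (x / y) `^ z = x `^ z / y `^ z.
  move=> x0 y0; rewrite powRM ?invr_ge0 ?(ltW x0) ?(ltW y0)//.
  by rewrite -powR_inv1 ?(ltW y0)// -powRrM mulN1r powRN.
have {}h : ((D / Ds) `^ s) `^ (s^-1 / q) <=
    ((A / As) `^ (g / 2) * (B / Bs) `^ (1 - g)) `^ (s^-1 / q).
  apply: ge0_ler_powR => //; rewrite nnegrE ?powR_ge0//.
  by rewrite mulr_ge0 ?powR_ge0.
move: h; rewrite (powRM _ (powR_ge0 _ _) (powR_ge0 _ _)) -!powRrM.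
rewrite (mulrA s) mulfV ?gt_eqF// mul1r !(mulrA _ s^-1) g1 g2 !pV//.
have Dp : 0 < Ds `^ q^-1 by rewrite powR_gt0.
rewrite (ler_pdivrMr _ _ Dp) => h.
apply: (le_trans h); rewrite le_eqVlt; apply/orP; left; apply/eqP.
by field; rewrite !gt_eqF ?powR_gt0.
Qed.

(** Used to exclude a vanishing gradient integral: any positive eta would then
    be an admissible bound for it. *)
Lemma powR_small_false (R : realType) (X K c s : R) :
  0 < X -> 0 < K -> 0 < c -> 0 < s ->
  (forall eta, 0 < eta -> X <= (eta * c) `^ s * K) -> False.
Proof.
move=> X0 K0 c0 s0 h.
have XK : 0 < X / (2 * K) by rewrite divr_gt0// mulr_gt0.
have := h ((X / (2 * K)) `^ s^-1 / c) (divr_gt0 (powR_gt0 _ XK) c0).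
rewrite divfK ?gt_eqF// -powRrM mulVf ?gt_eqF// powRr1 ?(ltW XK)//.
rewrite (_ : _ * K = X / 2); last by field; rewrite gt_eqF.
by lra.
Qed.

Lemma le_poweR (R : realType) (x y : \bar R) (r : R) :
  0 <= r -> (0 <= x)%E -> (x <= y)%E -> (x `^ r <= y `^ r)%E.
Proof.
move=> r0 x0 xy; apply: gt0_ler_poweR => //; rewrite in_itv/= leey andbT//.
exact: le_trans xy.
Qed.

Section radial_ckn.
Context (R : realType) (d : nat) (beta gamma p : R).
Hypotheses (hd : (2 <= d)%N)
  (hbeta : gamma - 2 < beta < (d%:R - 2) / d%:R * gamma)
  (hp : 1 < p <= p_star d beta gamma)
  (hgamma0 : gamma < 0).
Notation N := (hdim d gamma).
Notation al := (aexp beta gamma).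
Notation n := (edim d beta gamma).
Notation m := (bexp p).
Notation th := (theta d beta gamma p).
Notation MR := (measurableTypeR R).
Notation mu := (@lebesgue_measure R).
Notation lam := (lebesgue_tuple R d).

Let d0 : (0 < d)%N. Proof. exact: leq_trans hd. Qed.
Let i0 : 'I_d := Ordinal d0.
Let n2 : 2 < n. Proof. exact: (edim_gt2 hd hbeta). Qed.
Let p1 : 1 < p. Proof. exact: (p_gt1 hp). Qed.
Let N0 : 0 < N. Proof. exact: (hdim_gt0 hd hgamma0). Qed.
Let al0 : 0 < al. Proof. exact: (aexp_gt0 hbeta). Qed.
Let p0 : 0 < p. Proof. exact: lt_trans p1. Qed.
Let n0 : 0 < n. Proof. exact: lt_trans n2. Qed.
Let nm : n <= m. Proof. exact: (edim_le_bexp hd hbeta hp). Qed.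
Let m0 : 0 < m. Proof. exact: lt_le_trans nm. Qed.
Let nm2 : n < 2 * m. Proof. by have := nm; have := n2; lra. Qed.
Let nm1 : n < 2 * (m - 1). Proof. by have := nm; have := n2; lra. Qed.
Let p21 : 0 < p ^+ 2 - 1. Proof. by rewrite subr_gt0 expr2; have := p1; nra. Qed.

Definition cpol : R := polar_cst d gamma.

(** [Dstar], [Bstar] and [Astar] are the integrals of |f|^(2p), of |f|^(p+1) and
    of the squared gradient for the radial extremal f, and [Lam] is its
    quotient. *)
Definition Dstar : R := cpol * Jprof n m.
Definition Bstar : R := cpol * Jprof n (m - 1).
Definition Astar : R := cpol * (N ^+ 2 * (2 * Jprof n (m - 1) / (n * (p ^+ 2 - 1)))).

Definition Lam : R := Dstar `^ (2 * p)^-1 /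
  (Astar `^ (th / 2) * Bstar `^ ((1 - th) / (p + 1))).

Lemma cpol_gt0 : 0 < cpol.
Proof. exact: (polar_cst_gt0 (ltW hgamma0) d0). Qed.

Lemma Dstar_gt0 : 0 < Dstar.
Proof. by rewrite mulr_gt0 ?cpol_gt0 ?Jprof_gt0. Qed.

Lemma Bstar_gt0 : 0 < Bstar.
Proof. by rewrite mulr_gt0 ?cpol_gt0 ?Jprof_gt0. Qed.

Lemma Astar_gt0 : 0 < Astar.
Proof.
have J0 := Jprof_gt0 n0 nm1.
have np := mulr_gt0 n0 p21; have J2 : 0 < 2 * Jprof n (m - 1) by rewrite mulr_gt0.
by rewrite mulr_gt0 ?cpol_gt0// mulr_gt0 ?exprn_gt0// divr_gt0.
Qed.

Lemma Lam_gt0 : 0 < Lam.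
Proof.
by rewrite divr_gt0 ?mulr_gt0 ?powR_gt0 ?Dstar_gt0 ?Bstar_gt0 ?Astar_gt0.
Qed.

Lemma Lam_ineq (A B D : R) : 0 < A -> 0 < B -> 0 < D ->
  (D / Dstar) `^ (scal d beta gamma p) <=
    (A / Astar) `^ (growth d beta gamma p / 2) * (B / Bstar) `^ (1 - growth d beta gamma p) ->
  D `^ (2 * p)^-1 <= Lam * (A `^ 2^-1) `^ th * (B `^ (p + 1)^-1) `^ (1 - th).
Proof.
move=> A0 B0 D0 h.
have p20 : 0 < 2 * p by rewrite mulr_gt0.
rewrite -!powRrM (mulrC 2^-1) (mulrC (p + 1)^-1).
exact: (powR_normalized_product A0 B0 D0 Astar_gt0 Bstar_gt0 Dstar_gt0
  (scal_gt0 hd hbeta hp) p20 (growth_theta hd hbeta hp) (growth_theta1 hd hbeta hp) h).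
Qed.

Section one_function.
Variable w : 'rV[R]_d -> R.
Hypothesis wrad : C0infty_rad w.

Let wr : radial w. Proof. by case: wrad. Qed.
Let ws : smooth w. Proof. by case: wrad => -[]. Qed.
Let wv : vanishes_at_infinity w. Proof. by case: wrad => -[]. Qed.
Let wd x : differentiable w x. Proof. by have [h _] := ws 1%N; exact: h. Qed.
Let wc : continuous w. Proof. exact: (ws 0%N). Qed.
Let dwc : continuous (partial i0 w).
Proof. by have [_ h] := ws 1%N; exact: (h i0). Qed.

Let psi (y : R) : R := profile i0 w (y `^ N^-1).
Let dpsi (y : R) : R :=
  profile i0 (partial i0 w) (y `^ N^-1) * (N^-1 * y `^ (N^-1 - 1)).

Let powNK (r : R) : 0 <= r -> (r `^ N) `^ N^-1 = r.
Proof. by move=> r0; rewrite -powRrM mulfV ?gt_eqF// powRr1. Qed.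

Let measurable_prof_pow (f : 'rV[R]_d -> R) : continuous f ->
  measurable_fun setT (fun y : R => profile i0 f (y `^ N^-1)).
Proof.
move=> fc; apply: (measurableT_comp (f := profile i0 f)); last exact: measurable_powR.
by apply: continuous_measurable_fun => r; exact: profile_continuous.
Qed.

Let mpsi : measurable_fun setT psi.
Proof. exact: measurable_prof_pow. Qed.

Let mdpsi : measurable_fun setT dpsi.
Proof.
apply: measurable_funM; first exact: measurable_prof_pow.
by apply: measurable_funM => //; exact: measurable_powR.
Qed.

Let psid (y : R) : 0 < y -> is_derive y 1 psi (dpsi y).
Proof.
move=> y0; apply: is_derive_chain; last exact: is_derive1_powR.
exact: is_derive_profile.
Qed.

Let dpsic (y : R) : 0 < y -> {for y, continuous dpsi}.
Proof.
move=> y0; apply: cvgM; last first.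
  by apply: cvgMl_tmp; exact: continuous_powR_gt0.
apply: (@continuous_comp _ _ _ (fun y : R => y `^ N^-1) (profile i0 (partial i0 w))).
  exact: continuous_powR_gt0.
exact: profile_continuous.
Qed.

Let psi_bounded : exists M, forall y, `|psi y| <= M.
Proof.
have [M0 M0P] := wv ltr01.
pose r0 := Num.max M0 0.
have r00 : 0 <= r0 by rewrite le_max lexx orbT.
have pc : {within `[0, r0], continuous (fun r => `|profile i0 w r|)}.
  apply: continuous_subspaceT => r.
  apply: (@continuous_comp _ _ _ (profile i0 w) (fun z : R => `|z|)).
    exact: profile_continuous.
  exact: norm_continuous.
have [c _ cP] := EVT_max r00 pc.
exists (Num.max 1 `|profile i0 w c|) => y; rewrite le_max.
have [yr|yr] := leP r0 (y `^ N^-1).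
  rewrite ltW// /psi; apply: M0P.
  rewrite enormZ enorm_delta mulr1 ger0_norm ?powR_ge0// (le_trans _ yr)//.
  by rewrite le_max lexx.
by rewrite [X in _ || X]cP ?orbT// in_itv/= powR_ge0 ltW.
Qed.

Let psi_small eps : 0 < eps -> exists Y0, forall y, Y0 <= y -> `|psi y| <= eps.
Proof.
move=> e0; have [M0 M0P] := wv e0.
pose r0 := Num.max M0 0.
have r00 : 0 <= r0 by rewrite le_max lexx orbT.
exists (r0 `^ N) => y yr; rewrite ltW// /psi; apply: M0P.
rewrite enormZ enorm_delta mulr1 ger0_norm ?powR_ge0//.
apply: (@le_trans _ _ r0); first by rewrite le_max lexx.
rewrite -[leLHS](powNK r00) ge0_ler_powR ?nnegrE ?invr_ge0 ?(ltW N0) ?powR_ge0//.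
exact: le_trans (powR_ge0 _ _) yr.
Qed.

Let Ad : \bar R := (\int[lam]_(t in setT)
  (`|enorm (grad w (\row_i tnth t i))| `^ 2 * enorm (\row_i tnth t i) `^ (- beta))%:E)%E.

Let Id (q : R) : \bar R := (\int[lam]_(t in setT)
  (`|w (\row_i tnth t i)| `^ q * enorm (\row_i tnth t i) `^ (- gamma))%:E)%E.

Let IdE q : Id q = (cpol%:E * \int[mu]_(y in `[0%R, +oo[) (`|psi y| `^ q)%:E)%E.
Proof.
rewrite -(integral_polar (ltW hgamma0) d0 (F := fun y => `|psi y| `^ q)).
- apply: eq_integral => t _; rewrite /tweight -EFinM; congr (_ `^ q * _)%:E.
  by rewrite /psi powNK ?tnorm_ge0// -(radial_profile i0 _ wr).
- apply: (measurableT_comp (measurable_powR q)).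
  by apply: measurableT_comp => //; exact: mpsi.
- by move=> y; exact: powR_ge0.
Qed.

Let A1 : \bar R := (\int[mu]_(y in `[0%R, +oo[) (dpsi y ^+ 2 * y `^ (2 - 2 / n))%:E)%E.

Let mA1 : measurable_fun setT (fun y => dpsi y ^+ 2 * y `^ (2 - 2 / n)).
Proof.
apply: measurable_funM; first exact: measurable_funX.
exact: measurable_powR.
Qed.

(** The gradient is at least the radial derivative, which the substitution y =
    |x|^N turns into dpsi; the exponents of y combine to 2 - 2/n because N = n
    al. *)
Let AdE : ((cpol * N ^+ 2)%:E * A1 <= Ad)%E.
Proof.
have f0 y : 0 <= N ^+ 2 * (dpsi y ^+ 2 * y `^ (2 - 2 / n)).
  by apply: mulr_ge0; rewrite ?sqr_ge0// mulr_ge0 ?sqr_ge0 ?powR_ge0.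
have -> : ((cpol * N ^+ 2)%:E * A1 = cpol%:E * \int[mu]_(y in `[0%R, +oo[)
    (N ^+ 2 * (dpsi y ^+ 2 * y `^ (2 - 2 / n)))%:E)%E.
  rewrite EFinM -muleA; congr (_ * _)%E.
  under [RHS]eq_integral do rewrite EFinM.
  rewrite ge0_integralZl_EFin ?sqr_ge0//.
  - by move=> y _; rewrite lee_fin mulr_ge0 ?sqr_ge0 ?powR_ge0.
  - by apply/measurable_EFinP; exact: measurable_funTS.
rewrite -(integral_polar (ltW hgamma0) d0 _ f0); last exact: measurable_funM.
apply: ge0_le_integral_nonmeas => t.
  by rewrite mule_ge0 ?lee_fin// powR_ge0.
rewrite /tweight -EFinM lee_fin.
set r := tnorm t; have r0 : 0 <= r by exact: tnorm_ge0.
have rE : enorm (\row_i tnth t i) = r by [].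
rewrite rE; have [rz|rz] := eqVneq r 0.
  by rewrite rz [X in _ * X]powR0 ?mulr0 ?mulr_ge0 ?powR_ge0// oppr_eq0 lt_eqF.
have {}r0 : 0 < r by rewrite lt_neqAle eq_sym rz.
have rN0 : 0 < r `^ N by rewrite powR_gt0.
rewrite /dpsi powNK ?(ltW r0)//.
set P := profile _ _ _.
have PE : `|P| <= `|enorm (grad w (\row_i tnth t i))|.
  rewrite (ger0_norm (enorm_ge0 _)) /P -rE.
  by apply: profile_derive_le_grad => //; rewrite rE.
have expo : N ^+ 2 * ((P * (N^-1 * (r `^ N) `^ (N^-1 - 1))) ^+ 2 *
    (r `^ N) `^ (2 - 2 / n)) * r `^ (- gamma) = P ^+ 2 * r `^ (- beta).
  rewrite !exprMn -(powR_mulrn _ (powR_ge0 _ _)) -!powRrM.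
  have NN : N != 0 by rewrite gt_eqF.
  transitivity (P ^+ 2 * (r `^ (N * ((N^-1 - 1) * 2%:R)) * r `^ (N * (2 - 2 / n)) * r `^ (- gamma))).
    by field.
  rewrite -!powR_gt0D//; congr (_ * r `^ _).
  have nE : N = n * al by rewrite (edim_aexp hbeta).
  rewrite (_ : N * ((N^-1 - 1) * 2) + N * (2 - 2 / n) = 2 - 2 * al).
    by rewrite /aexp; field.
  by rewrite nE; field; rewrite !gt_eqF.
rewrite expo ler_wpM2r ?powR_ge0//.
rewrite -[leLHS]real_normK ?num_real// powR_mulrn//.
by rewrite ler_pXn2r ?nnegrE.
Qed.

Let utr eps y := trunc eps (psi y).

(** When the gradient integral is infinite the right-hand side is infinite; when
    the truncation vanishes the left-hand side is zero; otherwise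
    [sharp_inequality] applies to psi. *)
Let radial_trunc eps : 0 < eps ->
  ((cpol%:E * \int[mu]_(y in `[0%R, +oo[) (utr eps y `^ (2 * p))%:E) `^ (2 * p)^-1 <=
   Lam%:E * (Ad `^ 2^-1) `^ th * (Id (p + 1) `^ (p + 1)^-1) `^ (1 - th))%E.
Proof.
move=> e0.
have [M psiM] := psi_bounded; have [Y psiY] := psi_small e0.
have [[D'0 B'0] A'0] := (Dstar_gt0, Bstar_gt0, Astar_gt0).
have c0 := cpol_gt0; have th0 := theta_gt0 hd hbeta hp; have th1 := theta_le1 hd hbeta hp.
have M0 : 0 <= M by exact: le_trans (psiM 0).
have pp0 : 0 < p + 1 by rewrite addr_gt0.
have p20 : 0 < 2 * p by rewrite mulr_gt0.
have u0 y : 0 <= utr eps y by exact: trunc_ge0.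
have upsi y : utr eps y <= `|psi y| by rewrite /utr trunc_le// ltW.
have uM y : utr eps y <= M by rewrite (le_trans (upsi y)).
have mu_ q : measurable_fun setT (fun y => utr eps y `^ q) by exact: measurable_trunc.
have Af0 y : (0 <= (dpsi y ^+ 2 * y `^ (2 - 2 / n))%:E)%E.
  by rewrite lee_fin mulr_ge0 ?sqr_ge0 ?powR_ge0.
have ufin q : 0 < q -> exists2 D, 0 <= D &
    (\int[mu]_(y in `[0%R, +oo[) (utr eps y `^ q)%:E)%E = D%:E.
  move=> q0; exists (primitive (fun y => utr eps y `^ q) 0 (Num.max Y 0)).
    by apply: primitive_ge0 => t; exact: powR_ge0.
  apply/esym/primitive_full.
  - move=> t Yt; rewrite /utr /trunc max_r ?powR0 ?gt_eqF// subr_le0 psiY//.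
    by apply: le_trans (ltW Yt); rewrite le_max lexx.
  - by move=> t; exact: powR_ge0.
  - apply: (@bounded_integrable _ _ (M `^ q)) => // t _.
    by rewrite ger0_norm ?powR_ge0// ge0_ler_powR ?nnegrE// ltW.
  - by rewrite le_max lexx orbT.
have [D D0 DE] := ufin _ p20; have [B B0 BE] := ufin _ pp0.
have RHS0 : (0 <= Lam%:E * (Ad `^ 2^-1) `^ th * (Id (p + 1) `^ (p + 1)^-1) `^ (1 - th))%E.
  by rewrite mule_ge0 ?poweR_ge0// mule_ge0 ?poweR_ge0// lee_fin ltW// Lam_gt0.
rewrite DE -EFinM poweR_EFin.
have [D00|D00] := eqVneq D 0.
  by rewrite D00 mulr0 powR0// gt_eqF// invr_gt0.
have {D00}D0 : 0 < D by rewrite lt_neqAle eq_sym D00.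
have DB : D <= M `^ (p - 1) * B.
  rewrite -lee_fin -DE EFinM -BE -ge0_integralZl_EFin ?powR_ge0//; last 2 first.
  - by move=> y _; rewrite lee_fin powR_ge0.
  - by apply/measurable_EFinP; apply: measurable_funTS; exact: mu_.
  apply: ge0_le_integral => //.
  - by move=> y _; rewrite lee_fin powR_ge0.
  - by apply/measurable_EFinP; apply: measurable_funTS; exact: mu_.
  - by apply/measurable_EFinP; apply: measurable_funTS; apply: measurable_funM => //; exact: mu_.
  - move=> y _; rewrite -EFinM lee_fin.
    have [->|uy] := eqVneq (utr eps y) 0; first by rewrite !powR0 ?gt_eqF// mulr0.
    have {}uy : 0 < utr eps y by rewrite lt_neqAle eq_sym uy u0.
    rewrite (_ : 2 * p = (p - 1) + (p + 1)); last by ring.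
    rewrite powR_gt0D// ler_wpM2r ?powR_ge0// ge0_ler_powR ?nnegrE//.
    by rewrite subr_ge0 ltW.
have {}B0 : 0 < B.
  rewrite lt_neqAle B0 andbT; apply/negP => /eqP B00.
  by move: DB; rewrite -B00 mulr0 leNgt D0.
have BId : ((cpol * B)%:E <= Id (p + 1))%E.
  rewrite EFinM -BE IdE lee_pmul2l ?lte_fin//.
  apply: ge0_le_integral => //.
  - by move=> y _; rewrite lee_fin powR_ge0.
  - by apply/measurable_EFinP; apply: measurable_funTS; exact: mu_.
  - apply/measurable_EFinP; apply: measurable_funTS.
    apply: (measurableT_comp (measurable_powR (p + 1))).
    by apply: measurableT_comp => //; exact: mpsi.
  - by move=> y _; rewrite lee_fin ge0_ler_powR ?nnegrE// ltW.
have cB0 : 0 < cpol * B by rewrite mulr_gt0.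
have Id0 : (0 < Id (p + 1))%E by rewrite (lt_le_trans _ BId)// lte_fin.
have A10 : (0 <= A1)%E by apply: integral_ge0 => y _; exact: Af0.
have key A : 0 < A -> (A1 <= A%:E)%E ->
    (D / Jprof n m) `^ scal d beta gamma p <=
    (A * (n * (p ^+ 2 - 1) / 2) / Jprof n (m - 1)) `^ (growth d beta gamma p / 2) *
    (B / Jprof n (m - 1)) `^ (1 - growth d beta gamma p).
  move=> A0 A1A; apply: (sharp_inequality n2 p1 nm mpsi mdpsi psid dpsic psiM e0 psiY) => //.
  by rewrite BE.
have [Ainf|Afin] := eqVneq A1 +oo%E.
  have -> : Ad = +oo%E.
    apply/eqP; rewrite -leye_eq (le_trans _ AdE)// Ainf gt0_muley ?lte_fin//.
    by rewrite mulr_gt0 ?exprn_gt0.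
  rewrite !poweRyr ?gt_eqF ?invr_gt0// gt0_muley ?lte_fin ?Lam_gt0// gt0_mulye ?leey//.
  by rewrite !poweR_gt0.
have A1E : A1 = (fine A1)%:E by rewrite fineK// ge0_fin_numE// ltey.
have gr0 : 0 < growth d beta gamma p / 2 by rewrite divr_gt0// /growth divr_gt0.
have JB := Jprof_gt0 n0 nm1; have JD := Jprof_gt0 n0 nm2.
have A0 : 0 < fine A1.
  rewrite lt_neqAle fine_ge0// andbT; apply/negP => /eqP A00.
  have c10 : 0 < n * (p ^+ 2 - 1) / 2 / Jprof n (m - 1).
    exact: (divr_gt0 (divr_gt0 (mulr_gt0 n0 p21) (ltr0n R 2)) JB).
  apply: (powR_small_false (powR_gt0 (scal d beta gamma p) (divr_gt0 D0 JD))
    (powR_gt0 (1 - growth d beta gamma p) (divr_gt0 B0 JB)) c10 gr0) => eta eta0.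
  rewrite (mulrA eta); apply: key => //.
  by rewrite A1E -A00 lee_fin ltW.
have cN0 : 0 < cpol * N ^+ 2 by rewrite mulr_gt0// exprn_gt0.
pose A := cpol * N ^+ 2 * fine A1.
have AA0 : 0 < A by rewrite mulr_gt0.
have AAd : (A%:E <= Ad)%E by rewrite /A EFinM -A1E.
have cD0 : 0 < cpol * D by rewrite mulr_gt0.
have := @Lam_ineq A (cpol * B) (cpol * D) AA0 cB0 cD0.
have -> : cpol * D / Dstar = D / Jprof n m.
  by rewrite /Dstar; field; rewrite !gt_eqF.
have -> : cpol * B / Bstar = B / Jprof n (m - 1).
  by rewrite /Bstar; field; rewrite !gt_eqF.
have -> : A / Astar = fine A1 * (n * (p ^+ 2 - 1) / 2) / Jprof n (m - 1).
  rewrite /A /Astar; field; rewrite !gt_eqF//.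
have A1le : (A1 <= (fine A1)%:E)%E by rewrite -A1E.
move=> /(_ (key _ A0 A1le)) hL.
apply: (@le_trans _ _ (Lam%:E * ((A%:E `^ 2^-1) `^ th) *
   (((cpol * B)%:E `^ (p + 1)^-1) `^ (1 - th)))%E).
  by rewrite !poweR_EFin -!EFinM lee_fin.
have Lam0 := Lam_gt0.
apply: lee_pmul.
- by rewrite mule_ge0 ?poweR_ge0// lee_fin ltW.
- exact: poweR_ge0.
- rewrite lee_pmul2l ?lte_fin//.
  apply: le_poweR; [exact: ltW|exact: poweR_ge0|].
  by apply: le_poweR; [rewrite invr_ge0|rewrite lee_fin ltW|].
- apply: le_poweR; [by rewrite subr_ge0|exact: poweR_ge0|].
  by apply: le_poweR; [rewrite invr_ge0 ltW|rewrite lee_fin ltW|].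
Qed.

(** The truncations increase to |psi| as eps -> 0, and monotone convergence
    recovers the left-hand side. *)
Lemma radial_CKN_ineq : CKN_ineq beta gamma p Lam w.
Proof.
rewrite /CKN_ineq /wnorm -/Ad -/(Id (2 * p)) -/(Id (p + 1)).
set X := (X in (_ <= X)%E).
have p20 : 0 < 2 * p by rewrite mulr_gt0.
have Lam0 := Lam_gt0; have c0 := cpol_gt0.
have X0 : (0 <= X)%E by rewrite mule_ge0 ?poweR_ge0// mule_ge0 ?poweR_ge0// lee_fin ltW.
suff : (Id (2 * p) <= X `^ (2 * p))%E.
  move=> h; apply: (@le_trans _ _ ((X `^ (2 * p)) `^ (2 * p)^-1)%E).
    apply: le_poweR => //; first by rewrite invr_ge0 ltW.
    by apply: integral_ge0 => t _; rewrite lee_fin mulr_ge0 ?powR_ge0.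
  by rewrite -poweRrM mulfV ?gt_eqF// poweRe1.
rewrite IdE.
pose ek (k : nat) : R := k.+1%:R^-1.
have ek0 k : 0 < ek k by rewrite invr_gt0.
have lek k : ((cpol%:E * \int[mu]_(y in `[0%R, +oo[) (utr (ek k) y `^ (2 * p))%:E)
    <= X `^ (2 * p))%E.
  have I0 : (0 <= cpol%:E * \int[mu]_(y in `[0%R, +oo[) (utr (ek k) y `^ (2 * p))%:E)%E.
    rewrite mule_ge0 ?lee_fin ?(ltW c0)//.
    by apply: integral_ge0 => y _; rewrite lee_fin powR_ge0.
  have := le_poweR (ltW p20) (poweR_ge0 _ _) (radial_trunc (ek0 k)).
  by rewrite -poweRrM mulVf ?gt_eqF// poweRe1.
have mono : (\int[mu]_(y in `[0%R, +oo[) (utr (ek k) y `^ (2 * p))%:E)%E @[k --> \oo] -->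
    (\int[mu]_(y in `[0%R, +oo[) (`|psi y| `^ (2 * p))%:E)%E.
  have cv y : (utr (ek k) y `^ (2 * p))%:E @[k --> \oo] --> (`|psi y| `^ (2 * p))%:E.
    have [py|py] := eqVneq (psi y) 0.
      rewrite py normr0; apply: cvg_near_cst; near=> k.
      by rewrite /utr /trunc py normr0 sub0r max_r// oppr_le0 ltW.
    have {}py : 0 < `|psi y| by rewrite normr_gt0.
    apply: cvg_EFin; first by near=> k.
    apply: cvg_powR_gt0 => //.
    apply: (squeeze_cvgr (f := fun k => `|psi y| - ek k) (h := fun=> `|psi y|)).
    - by near=> k; rewrite /utr trunc_le ?(ltW (ek0 _))// andbT /trunc le_max lexx.
    - rewrite -[X in _ --> X]subr0; apply: cvgB; first exact: cvg_cst.
      exact: cvg_harmonic.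
    - exact: cvg_cst.
  have -> : (\int[mu]_(y in `[0%R, +oo[) (`|psi y| `^ (2 * p))%:E =
      \int[mu]_(y in `[0%R, +oo[) limn (fun k => (utr (ek k) y `^ (2 * p))%:E))%E.
    by apply: eq_integral => y _; apply/esym/cvg_lim => //; exact: cv.
  apply: cvg_monotone_convergence => //.
  - by move=> k; apply/measurable_EFinP; apply: measurable_funTS; exact: measurable_trunc.
  - by move=> k y _; rewrite lee_fin powR_ge0.
  - move=> y _ i j ij; rewrite lee_fin ge0_ler_powR ?nnegrE ?trunc_ge0 ?(ltW p20)//.
    rewrite /utr /trunc; apply: le_max2 => //.
    by rewrite lerD2l lerN2 lef_pV2 ?posrE// ler_nat ltnS.
have cmono := cvgeZl (isT : cpol%:E \is a fin_num) mono.
apply: (cvge_to_le cmono); near=> k; exact: lek.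
Unshelve. all: by end_near. Qed.

End one_function.
End radial_ckn.

(** * Second-order comparison *)

Section second_order.
Context (R : realType).

Lemma mean_value_bound (f df : R -> R) (t M : R) : 0 <= t ->
  (forall x, 0 <= x <= t -> is_derive x 1 f (df x)) ->
  (forall x, 0 < x < t -> df x <= M) -> f t - f 0 <= M * t.
Proof.
move=> t0 fd dfM; have [->|tn0] := eqVneq t 0; first by rewrite subrr mulr0.
have {}t0 : 0 < t by rewrite lt_neqAle eq_sym tn0.
have fc : {within `[0, t], continuous f}.
  apply: derivable_within_continuous => x; rewrite in_itv/= => xt.
  by have := fd x xt => ?; exact: ex_derive.
have fd' : forall x, x \in `]0, t[ -> is_derive x 1 f (df x).
  by move=> x; rewrite in_itv/= => /andP[x0 xt]; apply: fd; rewrite !ltW.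
have [c + ->] := MVT t0 fd' fc.
by rewrite in_itv/= subr0 => ct; rewrite ler_wpM2r ?dfM// ltW.
Qed.

Definition even_power (q t : R) : R := ((1 + t) `^ q + (1 - t) `^ q) / 2.

Lemma is_derive_even_power_aux (q x a : R) : -1 < x < 1 ->
  is_derive x 1 (fun t => (1 + t) `^ q + a * (1 - t) `^ q)
    (q * ((1 + x) `^ (q - 1) - a * (1 - x) `^ (q - 1))).
Proof.
move=> /andP[x1 x2].
have u0 : 0 < 1 + x by lra.
have v0 : 0 < 1 - x by lra.
have hu : is_derive x 1 (fun t : R => 1 + t) (0 + 1) by apply: is_derive_add.
have hv : is_derive x 1 (fun t : R => 1 - t) (0 - 1) by apply: is_derive_sub.
have h := is_derive_add (@is_derive_powR_comp R (fun t => 1 + t) _ x q u0 hu)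
  (is_derive_scale a (@is_derive_powR_comp R (fun t => 1 - t) _ x q v0 hv)).
by apply: (is_derive_cast h); ring.
Qed.

Lemma second_difference_near (q e : R) : 0 < e ->
  exists2 t0 : R, 0 < t0 < 1 & forall x, 0 <= x <= t0 ->
    `|(1 + x) `^ q + (1 - x) `^ q - 2| <= e.
Proof.
move=> e0.
have c0 : {for (0 : R), continuous (fun x : R => (1 + x) `^ q + (1 - x) `^ q)}.
  apply/differentiable_continuous/derivable1_diffP.
  have h : is_derive (0 : R) 1 (fun t => (1 + t) `^ q + 1 * (1 - t) `^ q)
      (q * ((1 + 0) `^ (q - 1) - 1 * (1 - 0) `^ (q - 1))).
    by apply: is_derive_even_power_aux; rewrite ltr01 andbT ltrN10.
  have E : (fun t : R => (1 + t) `^ q + 1 * (1 - t) `^ q) =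
      (fun x : R => (1 + x) `^ q + (1 - x) `^ q) by apply/funext => t; rewrite mul1r.
  by rewrite -E; exact: ex_derive.
have v0 : (1 + 0 : R) `^ q + (1 - 0) `^ q = 2 by rewrite addr0 subr0 powR1.
move/cvgrPdist_le : c0 => /(_ e e0) /nbhs_ballP[r /= r0 rP].
exists (Num.min (r / 2) (1 / 2)).
  by rewrite lt_min divr_gt0//= divr_gt0//= gt_min; apply/orP; right; lra.
move=> x /andP[x0]; rewrite le_min => /andP[xr _].
rewrite distrC; have := rP x; rewrite v0; apply.
by rewrite /ball/= sub0r normrN ger0_norm//; apply: (le_lt_trans xr); lra.
Qed.

(** The second derivative of [even_power] is continuous at 0 with value q (q -
    1); integrating its bounds twice, by the mean value theorem, gives the
    expansion. *)
Lemma even_power_expansion (q e : R) : 1 < q -> 0 < e ->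
  exists2 t0 : R, 0 < t0 < 1 & forall x, `|x| <= t0 ->
    `|even_power q x - 1 - q * (q - 1) / 2 * x ^+ 2| <= e * x ^+ 2.
Proof.
move=> q1 e0.
have qq0 : 0 < q * (q - 1) by rewrite mulr_gt0//; lra.
have [t0 /andP[t00 t01] tP] := @second_difference_near (q - 2) (2 * e / (q * (q - 1)))
  (divr_gt0 (mulr_gt0 (ltr0n _ 2) e0) qq0).
exists t0; first by rewrite t00.
suff pos x : 0 <= x <= t0 ->
    `|even_power q x - 1 - q * (q - 1) / 2 * x ^+ 2| <= e * x ^+ 2.
  move=> x; have [x0|x0] := leP 0 x => xt; first by apply: pos; rewrite x0 (le_trans (ler_norm _) xt).
  have := pos (- x); rewrite sqrrN; have -> : even_power q (- x) = even_power q x.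
    by rewrite /even_power opprK addrC.
  by apply; move: xt; rewrite ltr0_norm// => ->; rewrite andbT; lra.
move=> /andP[x0 xt].
pose d1 (z : R) := q / 2 * ((1 + z) `^ (q - 1) - (1 - z) `^ (q - 1)).
pose d2 (z : R) := q * (q - 1) / 2 * ((1 + z) `^ (q - 2) + (1 - z) `^ (q - 2)).
have dd1 z : 0 <= z <= x -> is_derive z 1 d1 (d2 z).
  move=> /andP[z0 zx].
  have zi : -1 < z < 1 by apply/andP; split; lra.
  have h := is_derive_scale (q / 2) (is_derive_even_power_aux (q - 1) (-1) zi).
  have E : (fun y : R => q / 2 * ((1 + y) `^ (q - 1) + -1 * (1 - y) `^ (q - 1))) = d1.
    by apply/funext => y; rewrite /d1 mulN1r.
  rewrite -E; apply: (is_derive_cast h); rewrite /d2.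
  have -> : q - 1 - 1 = q - 2 by lra.
  by field.
have dd0 z : 0 <= z <= x -> is_derive z 1 (even_power q) (d1 z).
  move=> /andP[z0 zx].
  have zi : -1 < z < 1 by apply/andP; split; lra.
  have h := is_derive_scale 2^-1 (is_derive_even_power_aux q 1 zi).
  have E : (fun y : R => 2^-1 * ((1 + y) `^ q + 1 * (1 - y) `^ q)) = even_power q.
    by apply/funext => y; rewrite /even_power mul1r mulrC.
  by rewrite -E; apply: (is_derive_cast h); rewrite /d1 mul1r; field.
have d2P z : 0 <= z <= x -> `|d2 z - q * (q - 1)| <= e.
  move=> /andP[z0 zx]; have zt : 0 <= z <= t0 by rewrite z0 (le_trans zx).
  have := tP z zt; rewrite /d2; set S := _ `^ _ + _ => h.
  rewrite (_ : _ - _ = q * (q - 1) / 2 * (S - 2)); last by field.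
  have k0 : 0 < q * (q - 1) / 2 by rewrite divr_gt0.
  rewrite normrM (gtr0_norm k0) mulrC -ler_pdivlMr//.
  by apply: (le_trans h); rewrite le_eqVlt; apply/orP; left; apply/eqP; field; rewrite !gt_eqF//; lra.
have d10 : d1 0 = 0 by rewrite /d1 addr0 subr0 subrr mulr0.
have ep0 : even_power q 0 = 1.
  by rewrite /even_power addr0 subr0 powR1 divff// pnatr_eq0.
have sq (z : R) k : is_derive z 1 (fun y : R => k * y ^+ 2 / 2) (k * z).
  have h := is_derive_scale (k / 2) (is_derive_mul (is_derive_id z (1 : R)) (is_derive_id z (1 : R))).
  have E : (fun y : R => k / 2 * (y * y)) = (fun y => k * y ^+ 2 / 2).
    by apply/funext => y; field.
  by rewrite -E; apply: (is_derive_cast h); field.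
have li (z : R) k : is_derive z 1 (fun y : R => k * y) k.
  by apply: (is_derive_cast (is_derive_scale k (is_derive_id z (1 : R)))); rewrite mulr1.
pose c := q * (q - 1).
have up z : 0 <= z <= x -> d1 z <= (c + e) * z.
  move=> /andP[z0 zx].
  have := @mean_value_bound d1 d2 z (c + e) z0; rewrite d10 subr0; apply.
    by move=> y /andP[y0 yz]; apply: dd1; rewrite y0 (le_trans yz).
  move=> y /andP[y0 yz]; have := d2P y; rewrite (ltW y0) (le_trans (ltW yz))// => /(_ isT).
  by rewrite ler_norml /c => /andP[_]; lra.
have lo z : 0 <= z <= x -> (c - e) * z <= d1 z.
  move=> /andP[z0 zx].
  have := @mean_value_bound (fun y => - d1 y) (fun y => - d2 y) z (- (c - e)) z0.
  rewrite d10 oppr0 subr0 mulNr lerN2; apply.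
    by move=> y /andP[y0 yz]; apply: is_deriveN; apply: dd1; rewrite y0 (le_trans yz).
  move=> y /andP[y0 yz]; have := d2P y; rewrite (ltW y0) (le_trans (ltW yz))// => /(_ isT).
  by rewrite ler_norml /c => /andP[]; lra.
rewrite ler_norml; apply/andP; split.
  have := @mean_value_bound (fun y => (c - e) * y ^+ 2 / 2 - even_power q y)
    (fun y => (c - e) * y - d1 y) x 0 x0.
  rewrite ep0 expr0n mul0r mulr0 mul0r /c => h.
  have : (q * (q - 1) - e) * x ^+ 2 / 2 - even_power q x - (0 - 1) <= 0.
    apply: h => y yx; first by apply: is_derive_sub => //; exact: dd0.
    by rewrite subr_le0 lo//; move: yx => /andP[y0 yx]; rewrite !ltW.
  by have := mulr_ge0 (ltW e0) (sqr_ge0 x); lra.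
have := @mean_value_bound (fun y => even_power q y - (c + e) * y ^+ 2 / 2)
  (fun y => d1 y - (c + e) * y) x 0 x0.
rewrite ep0 expr0n mul0r mulr0 mul0r /c => h.
have : even_power q x - (q * (q - 1) + e) * x ^+ 2 / 2 - (1 - 0) <= 0.
  apply: h => y yx; first by apply: is_derive_sub => //; exact: dd0.
  by rewrite subr_le0 up//; move: yx => /andP[y0 yx]; rewrite !ltW.
by have := mulr_ge0 (ltW e0) (sqr_ge0 x); lra.
Qed.

(** The left-hand side is at most exp(t (u a + v b)) since x <= exp(x - 1), and
    the right-hand side is at least exp(w t c/(1 + t c)) since 1 + s >= exp(s/(1
    + s)); for small t the exponents compare as their first-order parts. *)
Lemma first_order_comparison (u v w a b c : R) :
  0 <= u -> 0 <= v -> 0 < w -> 0 < c -> u * a + v * b < w * c ->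
  exists2 t0 : R, 0 < t0 & forall t, 0 < t < t0 ->
    (1 + t * a) `^ u * (1 + t * b) `^ v < (1 + t * c) `^ w.
Proof.
move=> u0 v0 w0 c0; set Z := u * a + v * b => hZ.
(* t M < 1 keeps both bases on the left nonnegative, and t M < g preserves the
   gap g between the first-order parts *)
pose M := 1 + `|a| + `|b| + (`|Z| * c).
have M0 : 0 < M.
  by rewrite /M; have := normr_ge0 a; have := normr_ge0 b; have := mulr_ge0 (normr_ge0 Z) (ltW c0); lra.
pose g := w * c - Z; have g0 : 0 < g by rewrite subr_gt0.
have gM0 : 0 < Num.min 1 g by rewrite lt_min ltr01.
exists (Num.min 1 g / M) => [|t /andP[t0 tM]]; first by rewrite divr_gt0.
have {}tM : t * M < Num.min 1 g by rewrite -ltr_pdivlMr.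
have [tM1 tMg] : t * M < 1 /\ t * M < g by move: tM; rewrite lt_min => /andP[].
have taM : `|t * a| <= t * M.
  by rewrite normrM (gtr0_norm t0) ler_pM2l// /M; have := normr_ge0 b; have := mulr_ge0 (normr_ge0 Z) (ltW c0); lra.
have tbM : `|t * b| <= t * M.
  by rewrite normrM (gtr0_norm t0) ler_pM2l// /M; have := normr_ge0 a; have := mulr_ge0 (normr_ge0 Z) (ltW c0); lra.
have ta : 0 <= 1 + t * a by move: taM; rewrite ler_norml => /andP[]; lra.
have tb : 0 <= 1 + t * b by move: tbM; rewrite ler_norml => /andP[]; lra.
have tc0 : 0 < t * c by rewrite mulr_gt0.
have tc : 0 < 1 + t * c by lra.
have tZ : t * (Z * c) <= t * M.
  rewrite ler_pM2l// /M; have := normr_ge0 a; have := normr_ge0 b.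
  by have := ler_wpM2r (ltW c0) (ler_norm Z); lra.
apply: (@le_lt_trans _ _ (expR (t * Z))).
  have -> : t * Z = u * ((1 + t * a) - 1) + v * ((1 + t * b) - 1) by rewrite /Z; ring.
  by rewrite expRD ler_pM ?powR_ge0// powR_le_expR.
apply: (@lt_le_trans _ _ (expR (w * (t * c / (1 + t * c))))).
  rewrite ltr_expR mulrA ltr_pdivlMr// mulrA (mulrC w) -!mulrA ltr_pM2l//.
  have : t * (Z * c) < g by exact: le_lt_trans tMg.
  by rewrite /g; lra.
rewrite mulrC expRM ge0_ler_powR ?nnegrE ?expR_ge0 ?(ltW w0) ?(ltW tc)//.
have := expR_ge1Dx (- (t * c / (1 + t * c))); rewrite expRN.
have -> : 1 + - (t * c / (1 + t * c)) = (1 + t * c)^-1 by field; rewrite gt_eqF.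
by rewrite lef_pV2 ?posrE ?expR_gt0.
Qed.

End second_order.

(** The J_i stand for the profile integrals of indices m - 1, m, m + 1, m + 2
    and c for the polar constant. On the left is the relative gain of the L^(2p)
    term at second order in e, minus the weighted relative costs of the gradient
    and of the L^(p+1) term; it has the sign of the Felli--Schneider expression
    on the right. *)
Lemma second_variation (R : realType) (n p al dd J0 J1 J2 J3 c th : R) :
  1 < p -> 0 < n -> 0 < al -> 0 < dd -> 0 < J0 -> 0 < c ->
  n * (p - 1) < 2 * (p + 1) ->
  th = n * (p - 1) / (p * (2 * (p + 1) - n * (p - 1))) ->
  J1 = (1 - n / (2 * (2 * p / (p - 1) - 1))) * J0 ->
  J2 = (1 - n / (2 * (2 * p / (p - 1)))) * J1 ->
  J3 = (1 - n / (2 * (2 * p / (p - 1) + 1))) * J2 ->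
  (2 * p)^-1 * ((2 * p) * (2 * p - 1) / 2 * (c * J2 - c * J3) / dd / (c * J1)) -
  (th / 2 * ((al ^+ 2 * ((1 - 2 * p / (p - 1)) ^+ 2 * (c * J1)
       + 2 * (2 * p / (p - 1)) * (1 - 2 * p / (p - 1)) * (c * J2)
       + (2 * p / (p - 1)) ^+ 2 * (c * J3)) + (dd - 1) * (c * J1)) / dd
     / (al ^+ 2 * (2 / (p - 1)) ^+ 2 * (c * J0 - c * J1))) +
   (1 - th) / (p + 1) * ((p + 1) * p / 2 * (c * J1 - c * J2) / dd / (c * J0))) =
  (p - 1) ^+ 2 / (8 * p * al ^+ 2 * dd) * (al ^+ 2 * (n - 1) - (dd - 1)).
Proof.
move=> p1 n0 al0 dd0 J00 c0 nE thE -> -> ->.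
rewrite {}thE.
have pm : 0 < p - 1 by lra.
have pp : 0 < p + 1 by lra.
have p3 : 0 < 3 * p - 1 by lra.
have p0 : 0 < p by lra.
have E0 : 0 < 2 * (p + 1) - n * (p - 1) by lra.
field; rewrite ?gt_eqF//=; try lra.
rewrite (_ : _ - _ = c * J0 * (n * (p - 1))); last by ring.
by rewrite !mulr_gt0.
Qed.

(** * Integrals over space of the profiles *)

Section has_integral.
Context (R : realType) (d : nat).
Notation MR := (measurableTypeR R).
Notation lam := (lebesgue_tuple R d).
Notation T := (d.-tuple MR).
Implicit Types (F G : T -> R).

(** Integrability and value are kept together, so that the integral of a linear
    combination is computed by composing lemmas. *)
Definition has_integral F (v : R) : Prop :=
  lam.-integrable setT (EFin \o F) /\ (\int[lam]_t (F t)%:E = v%:E)%E.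

Lemma has_integral_measurable F v : has_integral F v -> measurable_fun setT F.
Proof. by move=> [/integrableP[/measurable_EFinP]]. Qed.

Lemma has_integral_ext F G v : F =1 G -> has_integral F v -> has_integral G v.
Proof. by move=> /funext ->. Qed.

Lemma has_integralD F G v w : has_integral F v -> has_integral G w ->
  has_integral (fun t => F t + G t) (v + w).
Proof.
move=> [iF eF] [iG eG]; split.
  rewrite (_ : _ \o _ = (EFin \o F) \+ (EFin \o G))%E; last exact/funext.
  exact: integrableD.
by under eq_integral do rewrite EFinD; rewrite integralD//= eF eG.
Qed.

Lemma has_integralZ F v (k : R) : has_integral F v ->
  has_integral (fun t => k * F t) (k * v).
Proof.
move=> [iF eF]; split.
  rewrite (_ : _ \o _ = (fun t => k%:E * (EFin \o F) t))%E; last exact/funext.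
  exact: integrableZl.
by under eq_integral do rewrite EFinM; rewrite (integralZl _ iF)//= eF.
Qed.

Lemma has_integralB F G v w : has_integral F v -> has_integral G w ->
  has_integral (fun t => F t - G t) (v - w).
Proof.
move=> hF hG; have := has_integralD hF (has_integralZ (-1) hG).
by rewrite mulN1r; apply: has_integral_ext => t; rewrite mulN1r.
Qed.

Lemma le_has_integral F G v w : has_integral F v -> has_integral G w ->
  (forall t, F t <= G t) -> v <= w.
Proof.
move=> [iF eF] [iG eG] FG; rewrite -lee_fin -eF -eG.
by apply: le_integral => // t _; rewrite lee_fin.
Qed.

Lemma ge0_has_integral F (v : R) : measurable_fun setT F -> (forall t, 0 <= F t) ->
  (\int[lam]_t (F t)%:E = v%:E)%E -> has_integral F v.
Proof.
move=> mF F0 eF; split => //; apply/integrableP; split; first exact/measurable_EFinP.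
under eq_integral => t _ do rewrite /= ger0_norm//.
by rewrite eF ltry.
Qed.

Lemma has_integral_flip (i0 : 'I_d) F v : (forall t, 0 <= F t) -> has_integral F v ->
  has_integral (fun t => F (tflip i0 t)) v.
Proof.
move=> F0 hF; have mF := has_integral_measurable hF.
apply: ge0_has_integral => //.
  by apply: (measurableT_comp mF); exact: measurable_tflip.
rewrite (integral_tflip i0 (f := fun t => (F t)%:E)) ?hF.2//; first exact/measurable_EFinP.
Qed.

Lemma dominated_has_integral F G w : measurable_fun setT F ->
  (forall t, `|F t| <= G t) -> has_integral G w ->
  has_integral F (fine (\int[lam]_t (F t)%:E)%E).
Proof.
move=> mF FG [iG _].
have iF : lam.-integrable setT (EFin \o F).
  apply: le_integrable iG => //; first exact/measurable_EFinP.
  by move=> t _ /=; rewrite lee_fin (le_trans (FG t))// ler_norm.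
split => //; rewrite fineK//; exact: (integrable_fin_num measurableT iF).
Qed.

Lemma has_integral_dominated_cvg (f : nat -> T -> R) F G w :
  (forall k, measurable_fun setT (f k)) ->
  (forall k t, `|f k t| <= G t) -> has_integral G w ->
  (forall t, f ^~ t @ \oo --> F t) ->
  exists v : nat -> R, exists2 v0 : R, v @ \oo --> v0 &
    (forall k, has_integral (f k) (v k)) /\ has_integral F v0.
Proof.
move=> mf fG hG fF; exists (fun k => fine (\int[lam]_t (f k t)%:E)%E).
have hk k := dominated_has_integral (mf k) (fG k) hG.
have mF : measurable_fun setT (EFin \o F).
  apply: (@emeasurable_fun_cvg _ _ _ _ (fun k t => (f k t)%:E)).
    by move=> k; exact/measurable_EFinP.
  by move=> t _; apply: cvg_EFin; [exact: nearW|exact: fF].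
have FG t : `|F t| <= G t.
  have h : (fun k => `|f k t|) @ \oo --> `|F t| by apply: cvg_norm; exact: fF.
  by apply: (cvgr_to_le h); apply: nearW => k; exact: fG.
have hF : has_integral F (fine (\int[lam]_t (F t)%:E)%E).
  by apply: (dominated_has_integral _ FG hG); exact/measurable_EFinP.
exists (fine (\int[lam]_t (F t)%:E)%E) => //.
apply: fine_cvg; rewrite -[X in _ --> X]hF.2.
apply: (@dominated_cvg _ _ R lam setT measurableT (fun k t => (f k t)%:E) (EFin \o F)
  (EFin \o G)) => //.
- by move=> k; apply/measurable_EFinP; exact: mf.
- by move=> t _; apply: cvg_EFin; [exact: nearW|exact: fF].
- by case: hG.
- by move=> k t _ /=; rewrite lee_fin; exact: fG.
Qed.

End has_integral.

Section base_integrals.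
Context (R : realType) (d : nat) (g al j : R) (i0 : 'I_d).
Hypotheses (d0 : (0 < d)%N) (g0 : g < 0) (al0 : 0 < al) (gj : d%:R - g < 2 * al * j).
Notation MR := (measurableTypeR R).
Notation lam := (lebesgue_tuple R d).
Notation T := (d.-tuple MR).
Notation n := ((d%:R - g) / al).

(** The values for g = gamma are the building blocks of all limit integrals; g =
    beta serves as a dominating function. *)
Definition wprof (t : T) : R := (1 + tnorm t `^ (2 * al)) `^ (- j) * tnorm t `^ (- g).

Let N0 : 0 < d%:R - g.
Proof. by rewrite subr_gt0 (lt_trans g0)// ltr0n. Qed.
Let n0 : 0 < n. Proof. exact: divr_gt0. Qed.
Let nj : n < 2 * j.
Proof. by rewrite ltr_pdivrMr// mulrAC. Qed.

Lemma wprof_ge0 t : 0 <= wprof t.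
Proof. by rewrite mulr_ge0 ?powR_ge0. Qed.

Lemma measurable_wprof : measurable_fun setT wprof.
Proof.
apply: measurable_funM.
  apply: (measurableT_comp (measurable_powR (- j))); apply: measurable_funD => //.
  by apply: (measurableT_comp (measurable_powR (2 * al))); exact: measurable_tnorm.
by apply: (measurableT_comp (measurable_powR (- g))); exact: measurable_tnorm.
Qed.

(** In the variable y = |x|^N this is the integral of a one-dimensional profile,
    because (1 + |x|^(2 al)) = 1 + y^(2/n). *)
Lemma has_integral_wprof : has_integral wprof (polar_cst d g * Jprof n j).
Proof.
apply: ge0_has_integral; [exact: measurable_wprof|exact: wprof_ge0|].
rewrite EFinM -(JprofE n0 nj).
rewrite -(integral_polar (ltW g0) d0 (measurable_prof n j) (prof_ge0 n j)).
have E t : prof n j (tnorm t `^ (d%:R - g)) = (1 + tnorm t `^ (2 * al)) `^ (- j).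
  rewrite /prof /bub -powRrM; congr ((1 + _ `^ _) `^ _).
  by field; rewrite !gt_eqF.
by apply: eq_integral => t _; rewrite /wprof EFinM -E.
Qed.

(** On average over spheres x_1^2/|x|^2 is 1/d. The quotient is written with the
    real power -2 of the norm, which is 0 at the origin like the weight. *)
Lemma has_integral_wprof_coord :
  has_integral (fun t => (tnth t i0 : R) ^+ 2 * tnorm t `^ (- 2) * wprof t)
    (polar_cst d g * Jprof n j / d%:R).
Proof.
have dR : d%:R != 0 :> R by rewrite pnatr_eq0 -lt0n.
pose G (r : R) := r `^ (- 2) * ((1 + r `^ (2 * al)) `^ (- j) * r `^ (- g)).
have mG : measurable_fun setT G.
  apply: measurable_funM; first exact: measurable_powR.
  apply: measurable_funM; last exact: measurable_powR.
  have mb : measurable_fun setT (fun r : R => 1 + r `^ (2 * al)).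
    by apply: measurable_funD => //; exact: measurable_powR.
  exact: (measurableT_comp (measurable_powR (- j)) mb).
have G0 r : 0 <= G r by rewrite mulr_ge0 ?powR_ge0// mulr_ge0 ?powR_ge0.
have GE t : tnorm t ^+ 2 * G (tnorm t) = wprof t.
  rewrite /G /wprof; have [->|r0] := eqVneq (tnorm t) 0.
    by rewrite expr0n mul0r [_ `^ (- g)]powR0 ?mulr0// oppr_eq0 lt_eqF.
  by rewrite mulrA (powRN _ 2) powR_mulrn ?tnorm_ge0// mulfV ?mul1r// sqrf_eq0.
apply: ge0_has_integral.
- apply: measurable_funM; last exact: measurable_wprof.
  apply: measurable_funM; first by apply: measurable_funX; exact: measurable_tnth_real.
  by apply: (measurableT_comp (measurable_powR (- 2))); exact: measurable_tnorm.
- by move=> t; rewrite mulr_ge0 ?wprof_ge0// mulr_ge0 ?sqr_ge0 ?powR_ge0.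
have := integral_coord_sqr i0 mG G0.
have -> : (\int[lam]_t (tnorm t ^+ 2 * G (tnorm t))%:E)%E = (polar_cst d g * Jprof n j)%:E.
  by rewrite -has_integral_wprof.2; apply: eq_integral => t _; rewrite GE.
have -> : (\int[lam]_t ((tnth t i0 : R) ^+ 2 * G (tnorm t))%:E)%E =
    (\int[lam]_t ((tnth t i0 : R) ^+ 2 * tnorm t `^ (- 2) * wprof t)%:E)%E.
  by apply: eq_integral => t _; rewrite /G /wprof !mulrA.
set I := (\int[lam]_t _)%E; set v := polar_cst d g * _ => h.
have : ((d%:R^-1)%:E * (d%:R%:E * I) = (d%:R^-1)%:E * v%:E)%E by rewrite h.
by rewrite muleA -EFinM mulVf// mul1e => ->; rewrite -EFinM mulrC.
Qed.

End base_integrals.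

(** * Smooth functions of a coordinate and the regularised radius *)

Section trial_function.
Context (R : realType) (d : nat) (h al : R).
Hypothesis h0 : 0 < h.
Implicit Types (f g : 'rV[R]_d -> R) (x v : 'rV[R]_d).

Definition rho x : R := enorm x ^+ 2 + h.

Lemma rho_gt0 x : 0 < rho x.
Proof. by rewrite ltr_wpDl ?sqr_ge0. Qed.

Lemma is_derive_at_line f x v D :
  is_derive x v f D <-> is_derive (0 : R) 1 (fun s : R => f (s *: v + x)) D.
Proof.
have E : (fun k : R => k^-1 *: ((f \o shift x) (k *: v) - f x)) =
    (fun k : R => k^-1 *: (((fun s : R => f (s *: v + x)) \o shift (0 : R)) (k *: (1 : R))
      - f ((0 : R) *: v + x))).
  by apply/funext => k /=; rewrite addr0 scale0r add0r /GRing.scale/= mulr1.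
split=> -[fd fD]; apply: DeriveDef.
- by move: fd; rewrite /derivable E.
- by move: fD; rewrite /derive E.
- by move: fd; rewrite /derivable E.
- by move: fD; rewrite /derive E.
Qed.

Lemma is_derive_vchain f (phi : R -> R) x v a b :
  is_derive (f x) 1 phi b -> is_derive x v f a ->
  is_derive x v (fun y => phi (f y)) (b * a).
Proof.
move=> hb /is_derive_at_line ha; apply/is_derive_at_line.
by apply: is_derive_chain ha; rewrite scale0r add0r.
Qed.

Lemma is_derive_vadd f g x v a b : is_derive x v f a -> is_derive x v g b ->
  is_derive x v (fun y => f y + g y) (a + b).
Proof. by move=> fa gb; exact: is_deriveD. Qed.

Lemma is_derive_vmul f g x v a b : is_derive x v f a -> is_derive x v g b ->
  is_derive x v (fun y => f y * g y) (a * g x + f x * b).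
Proof.
move=> /is_derive_at_line fa /is_derive_at_line gb; apply/is_derive_at_line.
by apply: (is_derive_cast (is_derive_mul fa gb)); rewrite scale0r add0r.
Qed.

Lemma is_derive_coord (i j : 'I_d) x :
  is_derive x (delta_mx 0 i) (fun y => y 0 j) (i == j)%:R.
Proof.
apply/is_derive_at_line.
have := is_derive_add (is_derive_scale (i == j)%:R (is_derive_id (0 : R) (1 : R)))
  (is_derive_cst (x 0 j) (0 : R) (1 : R)).
rewrite mulr1 addr0; congr is_derive; apply/funext => s.
by rewrite !mxE eqxx/= mulrC (eq_sym j).
Qed.

Lemma is_derive_rho (i : 'I_d) x : is_derive x (delta_mx 0 i) rho (2 * x 0 i).
Proof.
have sq j : is_derive x (delta_mx 0 i) (fun y => y 0 j * y 0 j)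
    ((i == j)%:R * x 0 j + x 0 j * (i == j)%:R).
  by apply: is_derive_vmul; exact: is_derive_coord.
have hs := is_derive_sum sq.
have hr := is_derive_vadd hs (is_derive_cst h x (delta_mx 0 i)).
have E : (fun y => (\sum_(j < d) (fun z : 'rV[R]_d => z 0 j * z 0 j)) y + h) = rho.
  by apply/funext => y; rewrite /rho enorm_sqr fct_sumE.
rewrite -E; move: hr; congr is_derive.
rewrite addr0 (bigD1 i)//= eqxx mul1r mulr1 big1 ?addr0 => [|j ji]; last first.
  by rewrite eq_sym (negbTE ji) mul0r mulr0 addr0.
by ring.
Qed.

(** The smallest class that contains the trial functions and is visibly stable
    under partial derivatives. *)
Inductive tame : ('rV[R]_d -> R) -> Prop :=
| tame_cst c : tame (fun=> c)
| tame_coord i : tame (fun x => x 0 i)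
| tame_rho a : tame (fun x => rho x `^ a)
| tame_bubble a : tame (fun x => (1 + rho x `^ al) `^ a)
| tame_add f g of tame f & tame g : tame (fun x => f x + g x)
| tame_mul f g of tame f & tame g : tame (fun x => f x * g x).

Lemma tame_differentiable f x : tame f -> differentiable f x.
Proof.
have dp (phi : R -> R) (D : R) g y : is_derive (g y) 1 phi D ->
    differentiable g y -> differentiable (fun z => phi (g z)) y.
  move=> hphi dg; apply: (differentiable_comp (f := g) (g := phi)) => //.
  by apply/derivable1_diffP; exact: ex_derive.
have drho y : differentiable rho y.
  have E : rho = fun z => (\sum_(j < d) (fun z : 'rV[R]_d => z 0 j * z 0 j)) z + h.
    by apply/funext => z; rewrite /rho enorm_sqr fct_sumE.
  rewrite E; apply: differentiableD => //; apply: differentiable_sum => j.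
  by apply: differentiableM; exact: differentiable_coord.
have drp a y : differentiable (fun z => rho z `^ a) y.
  exact: (dp (fun r => r `^ a) _ rho y (is_derive1_powR a (rho_gt0 y)) (drho y)).
elim=> {f} [c|i|a|a|f g _ df _ dg|f g _ df _ dg].
- exact: differentiable_cst.
- exact: differentiable_coord.
- exact: drp.
- have b0 : 0 < 1 + rho x `^ al by rewrite ltr_pwDl ?powR_ge0.
  apply: (dp (fun r => r `^ a) _ (fun z => 1 + rho z `^ al) x (is_derive1_powR a b0)).
  by apply: differentiableD => //; exact: differentiable_cst.
- exact: differentiableD.
- exact: differentiableM.
Qed.

Lemma tame_derive f : tame f -> forall i : 'I_d,
  exists2 g, tame g & forall x, is_derive x (delta_mx 0 i) f (g x).
Proof.
have rp i a x : is_derive x (delta_mx 0 i) (fun y => rho y `^ a)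
    (a * rho x `^ (a - 1) * (2 * x 0 i)).
  exact: (is_derive_vchain (is_derive1_powR a (rho_gt0 x)) (is_derive_rho i x)).
elim=> {f} [c|j|a|a|f g tf df tg dg|f g tf df tg dg] i.
- by exists (fun=> 0) => [|x]; [exact: tame_cst|exact: is_derive_cst].
- by exists (fun=> (i == j)%:R) => [|x]; [exact: tame_cst|exact: is_derive_coord].
- exists (fun x => a * rho x `^ (a - 1) * (2 * x 0 i)) => [|x]; last exact: rp.
  by do 2 ?apply: tame_mul; constructor.
- exists (fun x => a * (1 + rho x `^ al) `^ (a - 1) *
      (al * rho x `^ (al - 1) * (2 * x 0 i))) => [|x].
    by do 3 ?apply: tame_mul; constructor.
  have b0 : 0 < 1 + rho x `^ al by rewrite ltr_pwDl ?powR_ge0.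
  apply: (is_derive_vchain (f := fun y => 1 + rho y `^ al) (is_derive1_powR a b0)).
  by have := is_derive_vadd (is_derive_cst (1 : R) x (delta_mx 0 i)) (rp i al x); rewrite add0r.
- have [f' tf' ff'] := df i; have [g' tg' gg'] := dg i.
  by exists (fun x => f' x + g' x) => [|x]; [exact: tame_add|exact: is_derive_vadd].
- have [f' tf' ff'] := df i; have [g' tg' gg'] := dg i.
  exists (fun x => f' x * g x + f x * g' x) => [|x]; last exact: is_derive_vmul.
  by apply: tame_add; exact: tame_mul.
Qed.

(** Iterated partial derivatives stay in a class of differentiable functions. *)
Lemma tame_smooth f : tame f -> smooth f.
Proof.
move=> tf k; elim: k f tf => [|k IH] f tf /=.
  by move=> x; apply: differentiable_continuous; exact: tame_differentiable.
split=> [x|i]; first exact: tame_differentiable.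
have [g tg fg] := tame_derive tf i.
rewrite (_ : partial i f = g); first exact: IH.
by apply/funext => x; have := fg x => ?; exact: derive_val.
Qed.

(** The gradients of trial functions have the form A x + B e_1. *)
Lemma enorm_grad_sqr f (i0 : 'I_d) x (A B : R) :
  (forall i, is_derive x (delta_mx 0 i) f (x 0 i * A + (i == i0)%:R * B)) ->
  enorm (grad f x) ^+ 2 = enorm x ^+ 2 * A ^+ 2 + 2 * (x 0 i0 * (A * B)) + B ^+ 2.
Proof.
move=> fd; rewrite !enorm_sqr.
have -> : \sum_i grad f x 0 i ^+ 2 =
    \sum_i (x 0 i ^+ 2 * A ^+ 2 + (i == i0)%:R * (2 * (x 0 i * (A * B)) + B ^+ 2)).
  apply: eq_bigr => i _; rewrite mxE /partial (derive_val (is_derive := fd i)).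
  by case: (i == i0); rewrite /= ?mul1r ?mul0r; ring.
rewrite big_split/= -mulr_suml -addrA; congr (_ + _).
rewrite (bigD1 i0)//= eqxx mul1r big1 ?addr0// => i ii.
by rewrite (negbTE ii) mul0r.
Qed.

End trial_function.

(** * The trial function: pointwise estimates and even parts *)

Section trial_profile.
Context (R : realType) (al m : R).
Hypotheses (al0 : 0 < al) (m2 : 2 < m).

(** With t = |x|^2, [ff] is the radial extremal and x_1 [gg] the
    perturbation. *)
Definition ff (t : R) : R := (1 + t `^ al) `^ (1 - m / 2).
Definition gg (t : R) : R := t `^ ((al - 1) / 2) * (1 + t `^ al) `^ (- (m / 2)).
Definition dff (t : R) : R :=
  (1 - m / 2) * al * (t `^ (al - 1) * (1 + t `^ al) `^ (- (m / 2))).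
Definition dgg (t : R) : R := gg t * ((al - 1) / 2 * t `^ (- 1) -
  m / 2 * al * (t `^ (al - 1) * (1 + t `^ al) `^ (- 1))).

(** Here t is the regularised square radius |x|^2 + h, x the first coordinate
    and e the size of the perturbation; in [trial_grad2] the true square radius
    q appears besides t. *)
Definition trial_val (e t x : R) : R := ff t + e * (x * gg t).
Definition trial_slope (e t x : R) : R := 2 * dff t + e * (x * (2 * dgg t)).
Definition trial_grad2 (e t x q : R) : R :=
  q * trial_slope e t x ^+ 2 + 2 * (x * (trial_slope e t x * (e * gg t))) + (e * gg t) ^+ 2.

Let b0 (t : R) : 0 < 1 + t `^ al.
Proof. by rewrite ltr_pwDl ?powR_ge0. Qed.

Lemma ffE t : ff t = (1 + t `^ al) * (1 + t `^ al) `^ (- (m / 2)).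
Proof. by rewrite /ff powR_gt0D// powRr1 ?ltW. Qed.

Lemma ff_gt0 t : 0 < ff t. Proof. by rewrite powR_gt0. Qed.

Lemma powRN1 (t : R) : 0 < t -> t `^ (- 1) = t^-1.
Proof. by move=> t0; rewrite powR_inv1 ?ltW. Qed.

Lemma is_derive_ff (t : R) : 0 < t -> is_derive t 1 ff (dff t).
Proof.
move=> t0.
have hb := is_derive_add (is_derive_cst (1 : R) t (1 : R)) (is_derive1_powR al t0).
apply: (is_derive_cast (@is_derive_powR_comp R (fun y => 1 + y `^ al) _ t (1 - m / 2) (b0 t) hb)).
have -> : 1 - m / 2 - 1 = - (m / 2) by lra.
by rewrite add0r /dff; ring.
Qed.

Lemma is_derive_gg (t : R) : 0 < t -> is_derive t 1 gg (dgg t).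
Proof.
move=> t0.
have hb := is_derive_add (is_derive_cst (1 : R) t (1 : R)) (is_derive1_powR al t0).
have hm := is_derive_mul (is_derive1_powR ((al - 1) / 2) t0)
  (@is_derive_powR_comp R (fun y => 1 + y `^ al) _ t (- (m / 2)) (b0 t) hb).
apply: (is_derive_cast hm); rewrite add0r /dgg /gg.
rewrite (powR_gt0B1 ((al - 1) / 2) t0) (powR_gt0B1 (- (m / 2)) (b0 t)).
rewrite !powRN1//; ring.
Qed.

Section bounds.
Variables (e t x q : R).
Hypotheses (t0 : 0 < t) (e1 : `|e| <= 1) (xq : x ^+ 2 <= q) (qt : q <= t).

Let S := t `^ al.
Let S0 : 0 < S. Proof. exact: powR_gt0. Qed.
Let b := (1 + S) `^ (- (m / 2)).
Let bp : 0 < b. Proof. by rewrite powR_gt0// addr_gt0. Qed.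
Let E := t `^ ((al - 1) / 2).
Let E0 : 0 < E. Proof. exact: powR_gt0. Qed.

Let EE : E ^+ 2 * t = S.
Proof.
rewrite -powR_mulrn ?powR_ge0// -powRrM -[X in _ * X]powRr1 ?(ltW t0)// -powR_gt0D//.
by congr (_ `^ _); field.
Qed.

Let E2 : t `^ (al - 1) = E ^+ 2.
Proof. by rewrite powR_gt0B1// -/S -EE; field; rewrite gt_eqF. Qed.

(** The ratio of x_1 gg to ff is at most t^(al/2)/(1 + t^al), which never
    exceeds 1/2: the trial function stays positive, comparable to the
    extremal. *)
Lemma trial_tilt_le : `|x * gg t| <= ff t / 2.
Proof.
rewrite -(@ler_pXn2r _ 2) ?nnegrE ?divr_ge0 ?(ltW (ff_gt0 t))//.
rewrite real_normK ?num_real// ffE /gg -/S -/b -/E.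
have -> : (x * (E * b)) ^+ 2 = x ^+ 2 * (E ^+ 2 * b ^+ 2) by ring.
apply: (@le_trans _ _ (t * (E ^+ 2 * b ^+ 2))).
  by apply: ler_wpM2r; [rewrite mulr_ge0 ?sqr_ge0|exact: le_trans xq qt].
have -> : t * (E ^+ 2 * b ^+ 2) = S * b ^+ 2 by rewrite -EE; ring.
have -> : ((1 + S) * b / 2) ^+ 2 = (1 + S) ^+ 2 / 4 * b ^+ 2 by field.
by rewrite ler_wpM2r ?sqr_ge0//; have := sqr_ge0 (S - 1); lra.
Qed.

Lemma trial_val_le : `|trial_val e t x| <= 3 / 2 * ff t.
Proof.
have := trial_tilt_le; have f0 := ff_gt0 t => h.
apply: (le_trans (ler_normD _ _)); rewrite (gtr0_norm f0) normrM.
have := ler_pM (normr_ge0 _) (normr_ge0 _) e1 h; lra.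
Qed.

Definition grad_cst : R :=
  16 * (((1 - m / 2) * al) ^+ 2 + (`|al - 1| / 2 + m / 2 * al) ^+ 2) + 2.

(** The squares of t^(1/2) dff and of t dgg are both at most constant multiples
    of t^(al - 1) (1 + t^al)^(1 - m). *)
Lemma trial_grad2_le :
  trial_grad2 e t x q <= grad_cst * (t `^ (al - 1) * (1 + t `^ al) `^ (1 - m)).
Proof.
have q0 : 0 <= q by exact: le_trans (sqr_ge0 x) xq.
have e21 : e ^+ 2 <= 1 by rewrite -real_normK ?num_real// expr_le1.
set A := trial_slope e t x; set B := e * gg t.
have -> : (1 + t `^ al) `^ (1 - m) = (1 + S) * b ^+ 2.
  rewrite -/S powR_gt0D ?addr_gt0// powRr1 ?addr_ge0 ?(ltW S0)//; congr (_ * _).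
  by rewrite -powR_mulrn ?powR_ge0// -powRrM; congr (_ `^ _); field.
rewrite E2.
have h1 : trial_grad2 e t x q <= 2 * (q * A ^+ 2) + 2 * B ^+ 2.
  rewrite /trial_grad2 -/A -/B.
  have := ler_wpM2r (sqr_ge0 A) xq; have := sqr_ge0 (x * A - B).
  by rewrite sqrrB exprMn -mulr_natl; lra.
have h2 : B ^+ 2 <= E ^+ 2 * b ^+ 2.
  rewrite /B /gg -/S -/b -/E exprMn [leRHS](_ : _ = 1 * (E * b) ^+ 2); last by ring.
  by rewrite ler_wpM2r ?sqr_ge0.
have dg : (t * dgg t) ^+ 2 <= (`|al - 1| / 2 + m / 2 * al) ^+ 2 * (E ^+ 2 * b ^+ 2).
  rewrite /dgg /gg -/S -/b -/E E2 !powRN1 ?addr_gt0//.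
  set y := (al - 1) / 2 - m / 2 * al * (S / (1 + S)).
  have -> : t * (E * b * ((al - 1) / 2 * t^-1 - m / 2 * al * (E ^+ 2 * (1 + S)^-1))) =
      E * b * y.
    by rewrite /y -EE; field; rewrite EE !gt_eqF ?addr_gt0.
  rewrite !exprMn mulrC; apply: ler_wpM2r; first by rewrite mulr_ge0 ?sqr_ge0.
  rewrite -(@real_normK _ y) ?num_real// ler_pXn2r ?nnegrE//; last first.
    by rewrite addr_ge0 ?divr_ge0// mulr_ge0 ?(ltW al0)// divr_ge0//; have := m2; lra.
  have mal : 0 <= m / 2 * al by rewrite mulr_ge0 ?(ltW al0)// divr_ge0//; have := m2; lra.
  have y1 : 0 <= S / (1 + S) <= 1.
    rewrite divr_ge0 ?addr_ge0 ?(ltW S0)//= ler_pdivrMr ?addr_gt0// mul1r lerDr//.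
  rewrite (le_trans (ler_normB _ _))// lerD//.
    by rewrite normrM [`|2^-1|]gtr0_norm// invr_gt0.
  rewrite normrM (ger0_norm mal) ger0_norm; last by case/andP: y1.
  by rewrite ler_piMr//; case/andP: y1.
have h3 : q * A ^+ 2 <= 8 * (t * dff t ^+ 2 + (t * dgg t) ^+ 2).
  apply: (@le_trans _ _ (t * A ^+ 2)); first by rewrite ler_wpM2r ?sqr_ge0.
  have hA : A ^+ 2 <= 8 * (dff t ^+ 2 + e ^+ 2 * (x ^+ 2 * dgg t ^+ 2)).
    rewrite /A /trial_slope; have := sqr_ge0 (dff t - e * (x * dgg t)); lra.
  have hx : e ^+ 2 * (x ^+ 2 * dgg t ^+ 2) <= t * dgg t ^+ 2.
    rewrite mulrA ler_wpM2r ?sqr_ge0// -[leRHS]mul1r.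
    by apply: ler_pM; rewrite ?sqr_ge0//; exact: le_trans xq qt.
  have -> : 8 * (t * dff t ^+ 2 + (t * dgg t) ^+ 2) =
    t * (8 * (dff t ^+ 2 + t * dgg t ^+ 2)) by ring.
  by rewrite ler_pM2l//; lra.
have df : t * dff t ^+ 2 = ((1 - m / 2) * al) ^+ 2 * (E ^+ 2 * (S * b ^+ 2)).
  by rewrite /dff E2 -/S -/b -EE; ring.
set K1 := ((1 - m / 2) * al) ^+ 2 in df *; rewrite /grad_cst -/K1.
set K2 := (_ + _) ^+ 2 in dg *.
have K10 : 0 <= K1 by exact: sqr_ge0.
have K20 : 0 <= K2 by exact: sqr_ge0.
set V := E ^+ 2 * b ^+ 2 in h2 dg.
have V0 : 0 <= V by rewrite mulr_ge0 ?sqr_ge0.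
have -> : (16 * (K1 + K2) + 2) * (E ^+ 2 * ((1 + S) * b ^+ 2)) =
    16 * (K1 * (V * S)) + 16 * K1 * V + 16 * (K2 * V) + 16 * (K2 * (V * S)) + 2 * V + 2 * (V * S).
  by rewrite /V; ring.
have VS : 0 <= V * S by rewrite mulr_ge0// ltW.
have df' : t * dff t ^+ 2 = K1 * (V * S) by rewrite df /V; ring.
have := mulr_ge0 K10 V0; have := mulr_ge0 K20 VS; lra.
Qed.

End bounds.

Lemma trial_grad2_ge0 e t x q : x ^+ 2 <= q -> 0 <= trial_grad2 e t x q.
Proof.
move=> xq; rewrite /trial_grad2; set A := trial_slope _ _ _; set B := e * gg t.
have := ler_wpM2r (sqr_ge0 A) xq; have := sqr_ge0 (x * A + B).
by rewrite sqrrD exprMn -mulr_natl; lra.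
Qed.

End trial_profile.

Section trial_weights.
Context (R : realType) (beta gamma m : R).
Notation al := (aexp beta gamma).
Hypotheses (al0 : 0 < al) (m2 : 2 < m).

Section fixed_radius.
Variables (r t : R).
Hypotheses (r0 : 0 < r) (rt : r ^+ 2 <= t).

Let r20 : 0 < r ^+ 2. Proof. exact: exprn_gt0. Qed.
Let t0 : 0 < t. Proof. exact: lt_le_trans rt. Qed.

Let sqrE (a : R) : (r ^+ 2) `^ a = r `^ (2 * a).
Proof. by rewrite -powR_mulrn ?(ltW r0)// -powRrM. Qed.

Lemma bubble_le (j : R) : 0 <= j -> (1 + t `^ al) `^ (- j) <= (1 + r `^ (2 * al)) `^ (- j).
Proof.
move=> j0; apply: le_powR_neg; [by rewrite ltr_pwDl ?powR_ge0| |by rewrite oppr_le0].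
by rewrite lerD2l -sqrE ge0_ler_powR ?nnegrE ?(ltW al0) ?(ltW r20) ?(ltW t0).
Qed.

(** For al <= 1 the power t^(al - 1) decreases in t, so dropping the
    regularisation increases it; the powers of r then combine to r^(-gamma). *)
Lemma grad_weight_le_small : al <= 1 ->
  t `^ (al - 1) * (1 + t `^ al) `^ (1 - m) * r `^ (- beta) <=
  (1 + r `^ (2 * al)) `^ (- (m - 1)) * r `^ (- gamma).
Proof.
move=> al1; have -> : r `^ (- gamma) = r `^ (2 * (al - 1)) * r `^ (- beta).
  by rewrite -powR_gt0D//; congr (_ `^ _); rewrite /aexp; field.
rewrite mulrA; apply: ler_wpM2r; first exact: powR_ge0.
rewrite mulrC; apply: ler_pM; [exact: powR_ge0|exact: powR_ge0| |].
  by rewrite (_ : 1 - m = - (m - 1)) ?bubble_le//; have := m2; lra.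
by rewrite -sqrE le_powR_neg// subr_le0.
Qed.

(** For al >= 1 the power t^(al - 1) increases in t and is at most (1 +
    t^al)^((al - 1)/al); this lowers the exponent j of the profile and leaves
    the weight r^(-beta). *)
Lemma grad_weight_le_large : 1 <= al ->
  t `^ (al - 1) * (1 + t `^ al) `^ (1 - m) * r `^ (- beta) <=
  (1 + r `^ (2 * al)) `^ (- (m - 1 - (al - 1) / al)) * r `^ (- beta).
Proof.
move=> al1; apply: ler_wpM2r; first exact: powR_ge0.
have b0 : 0 < 1 + t `^ al by rewrite ltr_pwDl ?powR_ge0.
have a1 : 0 <= (al - 1) / al by rewrite divr_ge0 ?subr_ge0 ?(ltW al0).
have a2 : (al - 1) / al <= 1 by rewrite ler_pdivrMr// mul1r gerBl.
apply: (@le_trans _ _ ((1 + t `^ al) `^ (- (m - 1 - (al - 1) / al)))); last first.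
  by apply: bubble_le; have := m2; lra.
have -> : - (m - 1 - (al - 1) / al) = (al - 1) / al + (1 - m) by ring.
rewrite (powR_gt0D _ (1 - m) b0); apply: ler_wpM2r; first exact: powR_ge0.
rewrite {1}(_ : al - 1 = al * ((al - 1) / al)); last by field; rewrite gt_eqF.
by rewrite powRrM ge0_ler_powR ?nnegrE ?powR_ge0 ?(ltW b0)// lerDr.
Qed.

Lemma ff_powR_le (s : R) : 0 <= s -> ff al m t `^ s <= (1 + r `^ (2 * al)) `^ (- (s * (m / 2 - 1))).
Proof.
move=> s0; rewrite /ff -powRrM.
have -> : (1 - m / 2) * s = - (s * (m / 2 - 1)) by ring.
by apply: bubble_le; rewrite mulr_ge0//; have := m2; lra.
Qed.

End fixed_radius.

Section even_parts.
Variables (e x r : R).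
Hypotheses (r0 : 0 < r) (xr : x ^+ 2 <= r ^+ 2).

Let wp (j : R) : R := (1 + r `^ (2 * al)) `^ (- j) * r `^ (- gamma).
Let up (j : R) : R := x ^+ 2 * r `^ (- 2) * wp j.

Let S := (r ^+ 2) `^ al.
Let S0 : 0 < S. Proof. by rewrite powR_gt0// exprn_gt0. Qed.
Let b := (1 + S) `^ (- (m / 2)).
Let E := (r ^+ 2) `^ ((al - 1) / 2).
Let b0 : 0 < b. Proof. by rewrite powR_gt0// addr_gt0. Qed.
Let E0 : 0 < E. Proof. by rewrite powR_gt0// exprn_gt0. Qed.
Let r20 : 0 < r ^+ 2. Proof. exact: exprn_gt0. Qed.

Let EE : E ^+ 2 * r ^+ 2 = S.
Proof.
rewrite -powR_mulrn ?powR_ge0// -powRrM -[X in _ * X]powRr1 ?(ltW r20)// -powR_gt0D//.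
by congr (_ `^ _); field.
Qed.

Let E2 : (r ^+ 2) `^ (al - 1) = E ^+ 2.
Proof. by rewrite powR_gt0B1// -/S -EE; field; rewrite gt_eqF. Qed.

Let SE : r `^ (2 * al) = S.
Proof. by rewrite /S -powR_mulrn ?(ltW r0)// -powRrM. Qed.

Let wE : r `^ (- gamma) = E ^+ 2 * r `^ (- beta).
Proof.
rewrite -E2 -powR_mulrn ?(ltW r0)// -powRrM -powR_gt0D//.
by congr (_ `^ _); rewrite /aexp; field.
Qed.

Let bb : (1 + S) `^ (- m) = b ^+ 2.
Proof. by rewrite -powR_mulrn ?powR_ge0// -powRrM; congr (_ `^ _); field. Qed.

Let S1 : 0 < 1 + S. Proof. by rewrite addr_gt0. Qed.

Let rm2 : r `^ (- 2) = (r ^+ 2)^-1.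
Proof. by rewrite powRN powR_mulrn// ltW. Qed.

Let wpm1 (j : R) : wp (j - 1) = (1 + S) * wp j.
Proof.
rewrite /wp SE; have -> : - (j - 1) = 1 + - j by ring.
by rewrite (powR_gt0D 1 (- j) S1) powRr1 ?(ltW S1)//; ring.
Qed.

Let wpp1 (j : R) : wp (j + 1) = (1 + S)^-1 * wp j.
Proof. by rewrite -[X in _ * wp X](addrK 1) wpm1 mulKf// gt_eqF. Qed.

(** In the sum over x and -x the terms linear in e cancel. Every factor is a
    power of 1 + S with S = r^(2 al), up to E = r^(al - 1). *)
Lemma trial_grad2_even :
  (trial_grad2 al m e (r ^+ 2) x (r ^+ 2) + trial_grad2 al m e (r ^+ 2) (- x) (r ^+ 2))
    * r `^ (- beta) =
  2 * ((al ^+ 2 * (m - 2) ^+ 2) * (wp (m - 1) - wp m) + e ^+ 2 *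
    (al ^+ 2 * ((1 - m) ^+ 2 * up m + 2 * m * (1 - m) * up (m + 1) + m ^+ 2 * up (m + 2))
     + (wp m - up m))).
Proof.
have -> : m + 2 = m + 1 + 1 by ring.
rewrite /up !wpp1 wpm1 /wp SE bb wE rm2.
rewrite /trial_grad2 /trial_slope /dff /dgg /gg -/S -/b -/E E2 !powRN1//.
set W := r `^ (- beta).
have := EE; move: S1; move: S b E => S' b' E' S1' EE'; move: S1'; rewrite -EE' => S1'.
by field; rewrite exprMn !gt_eqF.
Qed.

(** The trial function is ff (1 + z), with z odd in x, so the even part of its
    power is governed by [even_power]. *)
Lemma trial_val_even (s : R) : `|e| <= 1 ->
  let j := s * (m / 2 - 1) in
  let z := e * (x * E / (1 + S)) in
  [/\ `|z| <= `|e| / 2,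
   (`|trial_val al m e (r ^+ 2) x| `^ s + `|trial_val al m e (r ^+ 2) (- x)| `^ s)
     * r `^ (- gamma) = 2 * (wp j * even_power s z) &
   wp j * z ^+ 2 = e ^+ 2 * (up (j + 1) - up (j + 2))].
Proof.
move=> e1 j z; have f0 := ff_gt0 al m (r ^+ 2).
have zE : e * (x * gg al m (r ^+ 2)) = ff al m (r ^+ 2) * z.
  by rewrite ffE /z /gg -/S -/b -/E; field; rewrite gt_eqF.
have zle : `|z| <= `|e| / 2.
  have := @trial_tilt_le _ al m _ _ _ r20 xr (lexx _) => h.
  rewrite -(ler_pM2l f0) -[X in X * `|z|](gtr0_norm f0) -normrM -zE normrM.
  by have := ler_wpM2l (normr_ge0 e) h; lra.
have z1 : -1 < z < 1.
  have : `|z| < 1 by apply: (le_lt_trans zle); lra.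
  by rewrite ltr_norml.
split=> //.
- have pw y : -1 < y -> `|ff al m (r ^+ 2) * (1 + y)| `^ s = (1 + S) `^ (- j) * (1 + y) `^ s.
    move=> y1; have y0 : 0 < 1 + y by lra.
    rewrite gtr0_norm ?mulr_gt0// powRM ?(ltW f0) ?(ltW y0)//; congr (_ * _).
    by rewrite /ff -/S -powRrM; congr (_ `^ _); rewrite /j; ring.
  have -> : trial_val al m e (r ^+ 2) x = ff al m (r ^+ 2) * (1 + z).
    by rewrite /trial_val zE; ring.
  have -> : trial_val al m e (r ^+ 2) (- x) = ff al m (r ^+ 2) * (1 + - z).
    by rewrite /trial_val mulNr mulrN zE; ring.
  case/andP: z1 => z1 z2.
  rewrite !pw//; last by rewrite ltrN2.
  by rewrite /wp SE /even_power; field.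
- have -> : j + 2 = j + 1 + 1 by ring.
  rewrite /up !wpp1 rm2 /z.
  have := EE; move: S1 (wp j); move: S b E => S' b' E' S1' w EE'; move: S1'; rewrite -EE' => S1'.
  by field; rewrite exprMn !gt_eqF.
Qed.

End even_parts.
End trial_weights.

(** * The trial function: limits of its integrals *)

Lemma halve_eq (R : realDomainType) (a b c : R) : 2 * a = b + b -> a = c -> b = c.
Proof. by move=> ab <-; lra. Qed.

Section trial_integrals.
Context (R : realType) (d : nat) (beta gamma m e : R) (i0 : 'I_d).
Notation al := (aexp beta gamma).
Hypotheses (d0 : (0 < d)%N) (gamma0 : gamma < 0) (beta0 : beta < 0)
  (al0 : 0 < al) (m2 : 2 < m) (nm : d%:R - gamma < 2 * al * (m - 1)) (e1 : `|e| <= 1).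
Notation MR := (measurableTypeR R).
Notation lam := (lebesgue_tuple R d).
Notation T := (d.-tuple MR).

Let x0 (t : T) : R := tnth t i0.

Definition val_density (s h : R) (t : T) : R :=
  `|trial_val al m e (tnorm t ^+ 2 + h) (x0 t)| `^ s * tnorm t `^ (- gamma).

Definition grad_density (h : R) (t : T) : R :=
  trial_grad2 al m e (tnorm t ^+ 2 + h) (x0 t) (tnorm t ^+ 2) * tnorm t `^ (- beta).

Let mpow a : measurable_fun setT (fun y : R => y `^ a).
Proof. exact: measurable_powR. Qed.

Let mbub a : measurable_fun setT (fun y : R => (1 + y `^ al) `^ a).
Proof.
have mb : measurable_fun setT (fun r : R => 1 + r `^ al) by apply: measurable_funD.
exact: (measurableT_comp (measurable_powR a) mb).
Qed.

Let mff : measurable_fun setT (ff al m). Proof. exact: mbub. Qed.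
Let mgg : measurable_fun setT (gg al m). Proof. by apply: measurable_funM. Qed.
Let mdff : measurable_fun setT (dff al m).
Proof. by apply: measurable_funM => //; apply: measurable_funM. Qed.
Let mdgg : measurable_fun setT (dgg al m).
Proof.
apply: measurable_funM => //; apply: measurable_funB; apply: measurable_funM => //.
by apply: measurable_funM.
Qed.

Let mx : measurable_fun setT x0. Proof. exact: measurable_tnth_real. Qed.
Let mr : measurable_fun setT (fun t : T => tnorm t ^+ 2).
Proof. by apply: measurable_funX; exact: measurable_tnorm. Qed.
Let mrh h (f : R -> R) : measurable_fun setT f ->
  measurable_fun setT (fun t : T => f (tnorm t ^+ 2 + h)).
Proof.
move=> mf; have ms : measurable_fun setT (fun t : T => tnorm t ^+ 2 + h).
  by apply: measurable_funD.
exact: (measurableT_comp mf ms).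
Qed.
Let mw a : measurable_fun setT (fun t : T => tnorm t `^ a).
Proof. by apply: (measurableT_comp (measurable_powR a)); exact: measurable_tnorm. Qed.

Let mM (f g : T -> R) : measurable_fun setT f -> measurable_fun setT g ->
  measurable_fun setT (fun t => f t * g t).
Proof. exact: measurable_funM. Qed.
Let mD (f g : T -> R) : measurable_fun setT f -> measurable_fun setT g ->
  measurable_fun setT (fun t => f t + g t).
Proof. exact: measurable_funD. Qed.
Let mZ (c : R) (f : T -> R) : measurable_fun setT f -> measurable_fun setT (fun t => c * f t).
Proof. exact: measurable_funM. Qed.
Let mX2 (f : T -> R) : measurable_fun setT f -> measurable_fun setT (fun t => f t ^+ 2).
Proof. exact: measurable_funX. Qed.

Lemma measurable_val_density s h : measurable_fun setT (val_density s h).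
Proof.
have mv := mD (mrh h mff) (mZ e (mM mx (mrh h mgg))).
have mn : measurable_fun setT (fun t : T => `|trial_val al m e (tnorm t ^+ 2 + h) (x0 t)|).
  exact: (measurableT_comp (@normr_measurable R setT) mv).
exact: (mM (measurableT_comp (measurable_powR s) mn) (mw (- gamma))).
Qed.

Lemma measurable_grad_density h : measurable_fun setT (grad_density h).
Proof.
have mA := mD (mZ 2 (mrh h mdff)) (mZ e (mM mx (mZ 2 (mrh h mdgg)))).
have mB := mZ e (mrh h mgg).
exact: (mM (mD (mD (mM mr (mX2 mA)) (mZ 2 (mM mx (mM mA mB)))) (mX2 mB)) (mw (- beta))).
Qed.

Section limits.
Variables (u : nat -> R) (l : R).
Hypotheses (l0 : 0 < l) (ul : u @ \oo --> l).

Let cpow a : (fun k => u k `^ a) @ \oo --> l `^ a.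
Proof. exact: cvg_powR_gt0. Qed.

Let cbub a : (fun k => (1 + u k `^ al) `^ a) @ \oo --> (1 + l `^ al) `^ a.
Proof.
apply: cvg_powR_gt0; first by rewrite ltr_pwDl ?powR_ge0.
by apply: cvgD; [exact: cvg_cst|exact: cpow].
Qed.

Let cgg : (fun k => gg al m (u k)) @ \oo --> gg al m l.
Proof. by apply: cvgM; [exact: cpow|exact: cbub]. Qed.

Lemma cvg_trial_val x : (fun k => trial_val al m e (u k) x) @ \oo --> trial_val al m e l x.
Proof.
apply: cvgD; first exact: cbub.
by apply: cvgMl_tmp; apply: cvgMl_tmp.
Qed.

Lemma cvg_trial_grad2 x q :
  (fun k => trial_grad2 al m e (u k) x q) @ \oo --> trial_grad2 al m e l x q.
Proof.
have cA : (fun k => trial_slope al m e (u k) x) @ \oo --> trial_slope al m e l x.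
  apply: cvgD.
    by apply: cvgMl_tmp; apply: cvgMl_tmp; apply: cvgM; [exact: cpow|exact: cbub].
  apply: cvgMl_tmp; apply: cvgMl_tmp; apply: cvgMl_tmp; apply: cvgM => //; apply: cvgB.
    by apply: cvgMl_tmp; exact: cpow.
  by apply: cvgMl_tmp; apply: cvgM; [exact: cpow|exact: cbub].
have cB : (fun k => e * gg al m (u k)) @ \oo --> e * gg al m l by apply: cvgMl_tmp.
apply: cvgD; last exact: (cvgM cB cB).
apply: cvgD; first by apply: cvgMl_tmp; exact: (cvgM cA cA).
by apply: cvgMl_tmp; apply: cvgMl_tmp; apply: cvgM.
Qed.

End limits.

Let ek (k : nat) : R := k.+1%:R^-1.
Let ek0 k : 0 < ek k. Proof. by rewrite invr_gt0. Qed.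

Let uk (t : T) (k : nat) : R := tnorm t ^+ 2 + ek k.
Let ul (t : T) : R := tnorm t ^+ 2 + 0.
Let radius_cvg (t : T) : uk t @ \oo --> ul t.
Proof. by apply: cvgD; [exact: cvg_cst|exact: cvg_harmonic]. Qed.

Let xr (t : T) : x0 t ^+ 2 <= tnorm t ^+ 2. Proof. exact: tnth_sqr_le. Qed.

Let w0 (t : T) g : g < 0 -> tnorm t = 0 -> tnorm t `^ (- g) = 0.
Proof. by move=> g0 ->; rewrite powR0// oppr_eq0 lt_eqF. Qed.

Let radius_gt0 (t : T) : 0 < tnorm t -> 0 < ul t.
Proof. by move=> r0; rewrite /ul [X in 0 < X]addr0; exact: exprn_gt0. Qed.

(** The trial functions are bounded by (3/2) ff, and ff decreases, so the value
    at h = 0 dominates; at the origin the weight vanishes since gamma < 0. *)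
Lemma val_density_cvg s : 0 < s -> d%:R - gamma < 2 * al * (s * (m / 2 - 1)) ->
  exists v : nat -> R, exists2 v0 : R, v @ \oo --> v0 &
    (forall k, has_integral (val_density s (ek k)) (v k)) /\
    has_integral (val_density s 0) v0.
Proof.
move=> s0 sj.
have dom k t : `|val_density s (ek k) t| <= (3 / 2) `^ s * wprof gamma al (s * (m / 2 - 1)) t.
  rewrite ger0_norm; last by rewrite mulr_ge0 ?powR_ge0.
  have [r0|r0] := eqVneq (tnorm t) 0.
    by rewrite /val_density /wprof w0// !mulr0.
  have {}r0 : 0 < tnorm t by rewrite lt_neqAle eq_sym r0 tnorm_ge0.
  have rt : tnorm t ^+ 2 <= tnorm t ^+ 2 + ek k by rewrite lerDl ltW.
  have t0 : 0 < tnorm t ^+ 2 + ek k by rewrite ltr_wpDl ?sqr_ge0.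
  rewrite /val_density /wprof mulrA; apply: ler_wpM2r; first exact: powR_ge0.
  apply: le_trans (ler_wpM2l (powR_ge0 _ _) (ff_powR_le al0 m2 r0 rt (ltW s0))).
  have c0 : 0 <= 3 / 2 :> R by lra.
  rewrite -(powRM s c0 (ltW (ff_gt0 al m (tnorm t ^+ 2 + ek k)))).
  have hv := trial_val_le al m t0 e1 (xr t) rt.
  apply: ge0_ler_powR => //; rewrite ?nnegrE ?normr_ge0 ?(ltW s0)//.
  by have := ff_gt0 al m (tnorm t ^+ 2 + ek k); lra.
apply: (has_integral_dominated_cvg (fun k => measurable_val_density s (ek k)) dom
  (has_integralZ ((3 / 2) `^ s) (has_integral_wprof d0 gamma0 al0 sj))) => t.
have [r0|r0] := eqVneq (tnorm t) 0.
  have E h : val_density s h t = 0 by rewrite /val_density (w0 gamma0 r0) mulr0.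
  have -> : (fun k => val_density s (ek k) t) = (fun=> 0) by apply/funext => k; exact: E.
  by rewrite E; exact: cvg_cst.
have {}r0 : 0 < tnorm t by rewrite lt_neqAle eq_sym r0 tnorm_ge0.
have l0 := radius_gt0 r0.
have ct := @cvg_trial_val (uk t) (ul t) l0 (@radius_cvg t) (x0 t).
have n0 : 0 < `|trial_val al m e (tnorm t ^+ 2 + 0) (x0 t)|.
  rewrite normr_gt0 gt_eqF// /trial_val.
  have := @trial_tilt_le _ al m _ _ _ (exprn_gt0 2 r0) (xr t) (lexx _).
  have := ff_gt0 al m (tnorm t ^+ 2); rewrite addr0 => f0 h.
  have : `|e * (x0 t * gg al m (tnorm t ^+ 2))| <= ff al m (tnorm t ^+ 2) / 2.
    by rewrite normrM -[leRHS]mul1r ler_pM.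
  by rewrite ler_norml => /andP[]; lra.
have cn : (fun k => `|trial_val al m e (uk t k) (x0 t)|) @ \oo -->
  `|trial_val al m e (ul t) (x0 t)| by apply: cvg_norm; exact: ct.
have cp : (fun k => `|trial_val al m e (uk t k) (x0 t)| `^ s) @ \oo -->
  `|trial_val al m e (ul t) (x0 t)| `^ s by apply: cvg_powR_gt0; [exact: n0|exact: cn].
by apply: cvgMr_tmp; exact: cp.
Qed.

(** The two domination estimates cover al <= 1 and al >= 1; in the second case
    beta < 0 makes the weight |x|^(-beta) admissible in [has_integral_wprof]. *)
Lemma grad_density_cvg :
  exists v : nat -> R, exists2 v0 : R, v @ \oo --> v0 &
    (forall k, has_integral (grad_density (ek k)) (v k)) /\
    has_integral (grad_density 0) v0.
Proof.
have [G [w hG dom]] : exists G, exists2 w, has_integral G w &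
    forall k t, `|grad_density (ek k) t| <= G t.
  pose C := grad_cst al m.
  have C0 : 0 <= C.
    by rewrite addr_ge0// mulr_ge0// addr_ge0 ?sqr_ge0.
  have key g j : g < 0 -> d%:R - g < 2 * al * j ->
    (forall (r t : R), 0 < r -> r ^+ 2 <= t ->
      t `^ (al - 1) * (1 + t `^ al) `^ (1 - m) * r `^ (- beta) <=
      (1 + r `^ (2 * al)) `^ (- j) * r `^ (- g)) ->
    exists G, exists2 w, has_integral G w & forall k t, `|grad_density (ek k) t| <= G t.
    move=> g0 gj hj; exists (fun t => C * wprof g al j t).
    exists (C * (polar_cst d g * Jprof ((d%:R - g) / al) j)).
      exact: has_integralZ (has_integral_wprof d0 g0 al0 gj).
    move=> k t; rewrite ger0_norm; last first.
      by rewrite mulr_ge0 ?powR_ge0// trial_grad2_ge0.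
    have [r0|r0] := eqVneq (tnorm t) 0.
      by rewrite /grad_density /wprof !w0// !mulr0.
    have {}r0 : 0 < tnorm t by rewrite lt_neqAle eq_sym r0 tnorm_ge0.
    have rt : tnorm t ^+ 2 <= tnorm t ^+ 2 + ek k by rewrite lerDl ltW.
    have t0 : 0 < tnorm t ^+ 2 + ek k by rewrite ltr_wpDl ?sqr_ge0.
    apply: le_trans (ler_wpM2l C0 (hj _ _ r0 rt)).
    rewrite mulrA; apply: ler_wpM2r; first exact: powR_ge0.
    exact: (trial_grad2_le al0 m2 t0 e1 (xr t) rt).
  have [a1|/ltW a1] := leP al 1.
    by apply: (key gamma (m - 1)) => // r t r0 rt; exact: grad_weight_le_small.
  apply: (key beta (m - 1 - (al - 1) / al)) => // [|r t r0 rt]; last exact: grad_weight_le_large.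
  have -> : 2 * al * (m - 1 - (al - 1) / al) = 2 * al * (m - 1) - 2 * (al - 1).
    by field; rewrite gt_eqF.
  by move: nm; rewrite /aexp; lra.
apply: (has_integral_dominated_cvg (fun k => measurable_grad_density (ek k)) dom hG) => t.
have [r0|r0] := eqVneq (tnorm t) 0.
  have E h : grad_density h t = 0 by rewrite /grad_density (w0 beta0 r0) mulr0.
  have -> : (fun k => grad_density (ek k) t) = (fun=> 0) by apply/funext => k; exact: E.
  by rewrite E; exact: cvg_cst.
have {}r0 : 0 < tnorm t by rewrite lt_neqAle eq_sym r0 tnorm_ge0.
have l0 := radius_gt0 r0.
have cg := @cvg_trial_grad2 (uk t) (ul t) l0 (@radius_cvg t) (x0 t) (tnorm t ^+ 2).
by apply: cvgMr_tmp; exact: cg.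
Qed.

(** The integral of (1 + |x|^(2 al))^(-j) |x|^(-gamma). *)
Definition wmass (j : R) : R := polar_cst d gamma * Jprof (edim d beta gamma) j.

Let wp (j : R) (t : T) := wprof gamma al j t.
Let up (j : R) (t : T) := x0 t ^+ 2 * tnorm t `^ (- 2) * wp j t.

Let hwp j : m - 1 <= j -> has_integral (wp j) (wmass j).
Proof.
move=> mj; apply: has_integral_wprof => //; apply: (lt_le_trans nm).
by rewrite ler_pM2l// mulr_gt0.
Qed.

Let hup j : m - 1 <= j -> has_integral (up j) (wmass j / d%:R).
Proof.
move=> mj; apply: has_integral_wprof_coord => //; apply: (lt_le_trans nm).
by rewrite ler_pM2l// mulr_gt0.
Qed.

Let x0_flip t : x0 (tflip i0 t) = - x0 t.
Proof. by rewrite /x0 tnth_mktuple eqxx. Qed.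

(** Averaging the integrand with its reflection leaves a combination of the
    integrals of [has_integral_wprof] and [has_integral_wprof_coord]. *)
Lemma grad_density_limit v : has_integral (grad_density 0) v ->
  v = al ^+ 2 * (m - 2) ^+ 2 * (wmass (m - 1) - wmass m) + e ^+ 2 *
   ((al ^+ 2 * ((1 - m) ^+ 2 * wmass m + 2 * m * (1 - m) * wmass (m + 1)
      + m ^+ 2 * wmass (m + 2)) + (d%:R - 1) * wmass m) / d%:R).
Proof.
move=> hv.
have dR : d%:R != 0 :> R by rewrite pnatr_eq0 -lt0n.
have gd0 t : 0 <= grad_density 0 t by rewrite mulr_ge0 ?powR_ge0// trial_grad2_ge0.
have h1 := has_integralD hv (has_integral_flip i0 gd0 hv).
have m1 : m - 1 <= m by rewrite gerBl.
have m3 : m - 1 <= m + 1 by lra.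
have m4 : m - 1 <= m + 2 by lra.
have h2 := has_integralZ 2 (has_integralD
  (has_integralZ (al ^+ 2 * (m - 2) ^+ 2) (has_integralB (hwp (lexx (m - 1))) (hwp m1)))
  (has_integralZ (e ^+ 2) (has_integralD (has_integralZ (al ^+ 2)
    (has_integralD (has_integralD (has_integralZ ((1 - m) ^+ 2) (hup m1))
      (has_integralZ (2 * m * (1 - m)) (hup m3))) (has_integralZ (m ^+ 2) (hup m4))))
    (has_integralB (hwp m1) (hup m1))))).
have E t : grad_density 0 t + grad_density 0 (tflip i0 t) = 2 *
    (al ^+ 2 * (m - 2) ^+ 2 * (wp (m - 1) t - wp m t) + e ^+ 2 *
    (al ^+ 2 * ((1 - m) ^+ 2 * up m t + 2 * m * (1 - m) * up (m + 1) t + m ^+ 2 * up (m + 2) t)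
     + (wp m t - up m t))).
  rewrite /grad_density tnorm_flip x0_flip !addr0 -mulrDl.
  have [r0|r0] := eqVneq (tnorm t) 0.
    by rewrite /up /wp /wprof (w0 beta0 r0) !(w0 gamma0 r0) !(mulr0, subrr, addr0).
  have {}r0 : 0 < tnorm t by rewrite lt_neqAle eq_sym r0 tnorm_ge0.
  exact: trial_grad2_even.
have {}h2 := has_integral_ext (fun t => esym (E t)) h2.
have := h1.2; rewrite h2.2 => -[] h3.
apply: (halve_eq h3); move: dR.
move: (wmass (m - 1)) (wmass m) (wmass (m + 1)) (wmass (m + 2)) (d%:R : R) => a b c c' D D0.
by field.
Qed.

(** After averaging with the reflection, [even_power] is bracketed by its
    second-order expansion with error eta. *)
Lemma val_density_limit s j eta t0 v : j = s * (m / 2 - 1) -> 0 < s -> m - 1 <= j ->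
  `|e| / 2 <= t0 -> (forall z, `|z| <= t0 ->
    `|even_power s z - 1 - s * (s - 1) / 2 * z ^+ 2| <= eta * z ^+ 2) ->
  has_integral (val_density s 0) v ->
  `|v - (wmass j + s * (s - 1) / 2 * (e ^+ 2 * ((wmass (j + 1) - wmass (j + 2)) / d%:R)))| <=
    eta * (e ^+ 2 * ((wmass (j + 1) - wmass (j + 2)) / d%:R)).
Proof.
move=> jE s0 sj et exps hv.
have vd0 t : 0 <= val_density s 0 t by rewrite mulr_ge0 ?powR_ge0.
have h1 := has_integralD hv (has_integral_flip i0 vd0 hv).
have j1 : m - 1 <= j + 1 by lra.
have j2 : m - 1 <= j + 2 by lra.
have h2 c := has_integralZ 2 (has_integralD (hwp sj)
  (has_integralZ c (has_integralZ (e ^+ 2) (has_integralB (hup j1) (hup j2))))).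
have E t : 2 * (wp j t + (s * (s - 1) / 2 - eta) * (e ^+ 2 * (up (j + 1) t - up (j + 2) t)))
    <= val_density s 0 t + val_density s 0 (tflip i0 t) <=
    2 * (wp j t + (s * (s - 1) / 2 + eta) * (e ^+ 2 * (up (j + 1) t - up (j + 2) t))).
  rewrite /val_density tnorm_flip x0_flip !addr0 -mulrDl.
  have [r0|r0] := eqVneq (tnorm t) 0.
    by rewrite /up /wp /wprof !(w0 gamma0 r0) !(mulr0, subrr, addr0) lexx.
  have {}r0 : 0 < tnorm t by rewrite lt_neqAle eq_sym r0 tnorm_ge0.
  pose z := e * (x0 t * (tnorm t ^+ 2) `^ ((al - 1) / 2) / (1 + (tnorm t ^+ 2) `^ al)).
  have [ze -> zz] : [/\ `|z| <= `|e| / 2,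
      (`|trial_val al m e (tnorm t ^+ 2) (x0 t)| `^ s +
       `|trial_val al m e (tnorm t ^+ 2) (- x0 t)| `^ s) * tnorm t `^ (- gamma) =
      2 * (wp j t * even_power s z) &
      wp j t * z ^+ 2 = e ^+ 2 * (up (j + 1) t - up (j + 2) t)].
    by rewrite jE; exact: (@trial_val_even _ beta gamma m e (x0 t) _ r0 (xr t) s e1).
  have wj0 : 0 <= wp j t by exact: wprof_ge0.
  have := exps z (le_trans ze et); rewrite ler_norml => /andP[z1 z2].
  have := ler_wpM2l wj0 z1; have := ler_wpM2l wj0 z2.
  rewrite -zz; move: (even_power s z) (wp j t) (z ^+ 2) => P w q l1 l2.
  by rewrite !ler_pM2l//; apply/andP; split; lra.
have l1 := le_has_integral (h2 _) h1 (fun t => (andP (E t)).1).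
have l2 := le_has_integral h1 (h2 _) (fun t => (andP (E t)).2).
rewrite -mulrBl in l1 l2; rewrite ler_norml.
move: l1 l2; set X := e ^+ 2 * _ => l1 l2.
by apply/andP; split; lra.
Qed.

End trial_integrals.

(** * Symmetry breaking *)

Section trial_in_space.
Context (R : realType) (d : nat) (beta gamma m e h : R) (i0 : 'I_d).
Notation al := (aexp beta gamma).
Hypotheses (al0 : 0 < al) (m2 : 2 < m) (e1 : `|e| <= 1) (h0 : 0 < h).
Notation MR := (measurableTypeR R).
Notation lam := (lebesgue_tuple R d).
Notation T := (d.-tuple MR).
Implicit Types x : 'rV[R]_d.

Definition trial x : R := trial_val al m e (rho h x) (x 0 i0).

Let rho0 x : 0 < rho h x. Proof. exact: rho_gt0. Qed.

Lemma trial_smooth : smooth trial.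
Proof.
apply: (@tame_smooth _ _ h al h0).
exact: (tame_add (tame_bubble d h al (1 - m / 2)) (tame_mul (tame_cst d h al e)
  (tame_mul (tame_coord h al i0)
    (tame_mul (tame_rho d h al ((al - 1) / 2)) (tame_bubble d h al (- (m / 2))))))).
Qed.

Lemma sqr_coord_le x : x 0 i0 ^+ 2 <= enorm x ^+ 2.
Proof.
by rewrite enorm_sqr (bigD1 i0)//= lerDl sumr_ge0// => i _; exact: sqr_ge0.
Qed.

Lemma trial_vanishes : vanishes_at_infinity trial.
Proof.
move=> eps eps0; pose s := al * (m - 2).
have s0 : 0 < s by rewrite mulr_gt0// subr_gt0.
have c0 : 0 < eps / 2 by rewrite divr_gt0.
move/cvgr0Pnorm_lt : (powRN_cvgy s0) => /(_ _ c0) -[M [_ hM]].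
exists (Num.max M 0 + 1) => x xM.
have [xM1 xM2] : M < enorm x /\ 0 < enorm x.
  have a1 : M <= Num.max M 0 by rewrite le_max lexx.
  have a2 : 0 <= Num.max M 0 by rewrite le_max lexx orbT.
  by move: xM a1 a2; move: (Num.max M 0) => Y; split; lra.
have rt : enorm x ^+ 2 <= rho h x by rewrite lerDl ltW.
have := trial_val_le al m (rho0 x) e1 (sqr_coord_le x) rt.
have := ff_powR_le al0 m2 xM2 rt ler01; rewrite powRr1 ?(ltW (ff_gt0 _ _ _))// mul1r => b1.
have b2 : (1 + enorm x `^ (2 * al)) `^ (- (m / 2 - 1)) <= enorm x `^ (- s).
  have -> : enorm x `^ (- s) = (enorm x `^ (2 * al)) `^ (- (m / 2 - 1)).
    by rewrite -powRrM; congr (_ `^ _); rewrite /s; field.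
  apply: le_powR_neg; [exact: powR_gt0|by rewrite lerDr|].
  by rewrite oppr_le0; have := m2; lra.
have := hM _ xM1; rewrite ger0_norm ?powR_ge0// => b3.
have := le_trans b1 b2; rewrite /trial; lra.
Qed.

Lemma trial_C0infty : C0infty trial.
Proof. by split; [exact: trial_smooth|exact: trial_vanishes]. Qed.

Lemma enorm_grad_trial x :
  enorm (grad trial x) ^+ 2 = trial_grad2 al m e (rho h x) (x 0 i0) (enorm x ^+ 2).
Proof.
apply: (enorm_grad_sqr (i0 := i0)) => i.
have hr := is_derive_rho h i x.
have h1 := is_derive_vchain (is_derive_ff al m (rho0 x)) hr.
have h2 := is_derive_vchain (is_derive_gg al m (rho0 x)) hr.
have h3 := is_derive_vmul (is_derive_cst e x (delta_mx 0 i))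
  (is_derive_vmul (is_derive_coord i i0 x) h2).
have := is_derive_vadd h1 h3; congr is_derive.
by rewrite /trial_slope (_ : cst e x = e)//; ring.
Qed.

Lemma trial_tuple (t : T) : trial (tx t) = trial_val al m e (tnorm t ^+ 2 + h) (tnth t i0).
Proof. by rewrite /trial mxE. Qed.

Lemma wnorm_trial s v : has_integral (val_density beta gamma m e i0 s h) v ->
  wnorm s gamma trial = ((v `^ s^-1)%:E).
Proof.
move=> [_ hv]; rewrite -(poweR_EFin v s^-1) -hv.
apply: (congr1 (fun I => poweR I s^-1)).
apply: eq_integral => t _; apply: congr1.
have E : `|trial (tx t)| `^ s * tnorm t `^ (- gamma) = val_density beta gamma m e i0 s h t.
  exact: (congr1 (fun z => `|z| `^ s * tnorm t `^ (- gamma)) (trial_tuple t)).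
exact: E.
Qed.

Lemma wnorm_grad_trial v : has_integral (grad_density beta gamma m e i0 h) v ->
  wnorm 2 beta (fun x => enorm (grad trial x)) = ((v `^ 2^-1)%:E).
Proof.
move=> [_ hv]; rewrite -(poweR_EFin v 2^-1) -hv.
apply: (congr1 (fun I => poweR I 2^-1)).
apply: eq_integral => t _; apply: congr1.
have E : `|enorm (grad trial (tx t))| `^ 2 * tnorm t `^ (- beta) = grad_density beta gamma m e i0 h t.
  rewrite (ger0_norm (enorm_ge0 _)) (powR_mulrn 2 (enorm_ge0 _)).
  have gE : enorm (grad trial (tx t)) ^+ 2 =
      trial_grad2 al m e (tnorm t ^+ 2 + h) (tnth t i0) (tnorm t ^+ 2).
    by rewrite enorm_grad_trial mxE.
  exact: (congr1 (fun z => z * tnorm t `^ (- beta)) gE).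
exact: E.
Qed.

End trial_in_space.

(** Relative increments t a, t b, t c of A, B, D that favour D make the quotient
    exceed that of As, Bs, Ds. *)
Lemma strict_quotient (R : realType) (u v w a b c t As Bs Ds A B D : R) :
  0 < As -> 0 < Bs -> 0 < Ds -> 0 <= u -> 0 <= v -> 0 < w -> 0 <= 1 + t * c ->
  0 < A -> A <= As * (1 + t * a) -> 0 < B -> B <= Bs * (1 + t * b) ->
  Ds * (1 + t * c) <= D ->
  (1 + t * a) `^ u * (1 + t * b) `^ v < (1 + t * c) `^ w ->
  Ds `^ w / (As `^ u * Bs `^ v) * (A `^ u * B `^ v) < D `^ w.
Proof.
move=> As0 Bs0 Ds0 u0 v0 w0 tc A0 Aa B0 Bb Dc lt.
have ta : 0 <= 1 + t * a.
  by rewrite -(pmulr_rge0 _ As0) (le_trans (ltW A0)).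
have tb : 0 <= 1 + t * b.
  by rewrite -(pmulr_rge0 _ Bs0) (le_trans (ltW B0)).
have Au : A `^ u <= As `^ u * (1 + t * a) `^ u.
  rewrite -powRM ?(ltW As0)//; apply: ge0_ler_powR => //; rewrite nnegrE ?(ltW A0)//.
  exact: le_trans (ltW A0) Aa.
have Bv : B `^ v <= Bs `^ v * (1 + t * b) `^ v.
  rewrite -powRM ?(ltW Bs0)//; apply: ge0_ler_powR => //; rewrite nnegrE ?(ltW B0)//.
  exact: le_trans (ltW B0) Bb.
have Dw : Ds `^ w * (1 + t * c) `^ w <= D `^ w.
  have Dc0 : 0 <= Ds * (1 + t * c) by rewrite mulr_ge0// ltW.
  rewrite -powRM ?(ltW Ds0)//; apply: ge0_ler_powR; rewrite ?nnegrE ?(ltW w0)//.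
  exact: le_trans Dc0 Dc.
apply: (lt_le_trans _ Dw).
have Asu : 0 < As `^ u by exact: powR_gt0.
have Bsv : 0 < Bs `^ v by exact: powR_gt0.
have Dsw : 0 < Ds `^ w by exact: powR_gt0.
apply: (@le_lt_trans _ _ (Ds `^ w * ((1 + t * a) `^ u * (1 + t * b) `^ v))); last first.
  by rewrite ltr_pM2l.
rewrite -mulrA ler_pM2l// mulrC ler_pdivrMr ?mulr_gt0//.
apply: (le_trans (ler_pM (powR_ge0 _ _) (powR_ge0 _ _) Au Bv)).
by rewrite le_eqVlt; apply/orP; left; apply/eqP; ring.
Qed.

Section symmetry_breaking.
Context (R : realType) (d : nat) (beta gamma p : R).
Hypotheses (hd : (2 <= d)%N)
  (hbeta : gamma - 2 < beta < (d%:R - 2) / d%:R * gamma)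
  (hp : 1 < p <= p_star d beta gamma)
  (hgamma0 : gamma < 0)
  (hFS : beta_FS d gamma < beta).
Notation N := (hdim d gamma).
Notation al := (aexp beta gamma).
Notation n := (edim d beta gamma).
Notation m := (bexp p).
Notation th := (theta d beta gamma p).

Let d0 : (0 < d)%N. Proof. exact: leq_trans hd. Qed.
Let i0 : 'I_d := Ordinal d0.
Let n2 : 2 < n. Proof. exact: (edim_gt2 hd hbeta). Qed.
Let p1 : 1 < p. Proof. exact: (p_gt1 hp). Qed.
Let al0 : 0 < al. Proof. exact: (aexp_gt0 hbeta). Qed.
Let p0 : 0 < p. Proof. exact: lt_trans p1. Qed.
Let n0 : 0 < n. Proof. exact: lt_trans n2. Qed.
Let nm : n <= m. Proof. exact: (edim_le_bexp hd hbeta hp). Qed.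
Let m2 : 2 < m. Proof. exact: lt_le_trans nm. Qed.
Let beta0 : beta < 0. Proof. exact: (beta_lt0 hd hbeta). Qed.
Let nm1 : n < 2 * (m - 1). Proof. by have := nm; have := n2; lra. Qed.
Let Nm1 : d%:R - gamma < 2 * al * (m - 1).
Proof.
rewrite -/(hdim d gamma) -(edim_aexp hbeta).
by rewrite (_ : 2 * al * (m - 1) = 2 * (m - 1) * al); [rewrite ltr_pM2r|ring].
Qed.

Let W (j : R) : R := wmass d beta gamma j.

Let mp1 : m - 1 = (p + 1) * (m / 2 - 1).
Proof. by rewrite /bexp; field; rewrite gt_eqF// subr_gt0. Qed.
Let mp2 : m = (2 * p) * (m / 2 - 1).
Proof. by rewrite /bexp; field; rewrite gt_eqF// subr_gt0. Qed.

Let W_rec j : n < 2 * j -> W (j + 1) = (1 - n / (2 * j)) * W j.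
Proof. by move=> nj; rewrite /W /wmass (Jprof_rec n0 nj) mulrCA. Qed.

Let W_gt0 j : n < 2 * j -> 0 < W j.
Proof.
move=> nj; apply: mulr_gt0; last exact: (Jprof_gt0 n0 nj).
exact: (polar_cst_gt0 (ltW hgamma0) d0).
Qed.

Let W_decr j : n < 2 * j -> 0 < W j - W (j + 1).
Proof.
move=> nj; rewrite W_rec// mulrBl mul1r opprB addrC subrK.
by rewrite mulr_gt0 ?W_gt0// divr_gt0//; have := n0; lra.
Qed.

Let Astar_trial : al ^+ 2 * (m - 2) ^+ 2 * (W (m - 1) - W m) = Astar d beta gamma p.
Proof.
have := W_rec nm1; rewrite subrK => ->.
rewrite /Astar -(edim_aexp hbeta) /W /wmass /cpol.
have : 0 < p - 1 by rewrite subr_gt0.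
have pp : 0 < p + 1 by rewrite addr_gt0.
rewrite /bexp; move: (polar_cst _ _) (Jprof _ _) => c J pm.
have -> : p ^+ 2 - 1 = (p - 1) * (p + 1) by ring.
field; rewrite !gt_eqF//; lra.
Qed.

(** Coefficients of e^2 in the gradient integral and, up to q (q - 1)/2, in the
    integrals of the powers q = p + 1 and q = 2 p. *)
Let A2 : R := (al ^+ 2 * ((1 - m) ^+ 2 * W m + 2 * m * (1 - m) * W (m + 1)
  + m ^+ 2 * W (m + 2)) + (d%:R - 1) * W m) / d%:R.
Let Xb : R := (W m - W (m + 1)) / d%:R.
Let Xd : R := (W (m + 1) - W (m + 2)) / d%:R.

(** Exponents of the gradient, L^(p+1) and L^(2p) integrals in the inequality. *)
Let u : R := th / 2.
Let v : R := (1 - th) / (p + 1).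
Let w : R := (2 * p)^-1.

Let variation_gt0 :
  0 < w * ((2 * p) * (2 * p - 1) / 2 * Xd / W m) -
    (u * (A2 / Astar d beta gamma p) + v * ((p + 1) * p / 2 * Xb / W (m - 1))).
Proof.
have pm : 0 < p - 1 by rewrite subr_gt0.
have dR : (0 : R) < d%:R by rewrite ltr0n.
have nE : n * (p - 1) < 2 * (p + 1).
  have : n * (p - 1) <= 2 * p by rewrite -ler_pdivlMr.
  lra.
have J0 := Jprof_gt0 n0 nm1.
have c0 : 0 < polar_cst d gamma := polar_cst_gt0 (ltW hgamma0) d0.
have r1 := Jprof_rec n0 nm1; rewrite subrK in r1.
have nm2 : n < 2 * m by have := nm; have := n2; lra.
have r2 := Jprof_rec n0 nm2.
have nm3 : n < 2 * (m + 1) by apply: (lt_trans nm2); rewrite ltr_pM2l// ltrDl.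
have r3 := Jprof_rec n0 nm3.
have m12 : m + 1 + 1 = m + 2 by ring.
rewrite m12 in r3.
have := second_variation p1 n0 al0 dR J0 c0 nE (thetaE p hbeta) r1 r2 r3.
have AE : al ^+ 2 * (2 / (p - 1)) ^+ 2 * (polar_cst d gamma * Jprof n (m - 1)
    - polar_cst d gamma * Jprof n m) = Astar d beta gamma p.
  rewrite -Astar_trial; congr (_ * _ ^+ 2 * _).
  by rewrite /bexp; field; rewrite gt_eqF.
rewrite {}AE => E; apply: (@lt_le_trans _ _ ((p - 1) ^+ 2 / (8 * p * al ^+ 2 * d%:R) *
    (al ^+ 2 * (n - 1) - (d%:R - 1)))).
  apply: mulr_gt0; last by rewrite subr_gt0; exact: (FS_cond hd hbeta hgamma0 hFS).
  by rewrite divr_gt0 ?exprn_gt0// !mulr_gt0// exprn_gt0.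
by rewrite -E /Xd /Xb !(mulrA _ (W _ - W _)).
Qed.

Let nj k : m <= k -> n < 2 * k.
Proof. by have := nm; have := n2; lra. Qed.

Let Dstar0 : 0 < W m. Proof. exact: (W_gt0 (nj (lexx m))). Qed.
Let Bstar0 : 0 < W (m - 1). Proof. exact: (W_gt0 nm1). Qed.
Let Astar0 : 0 < Astar d beta gamma p. Proof. exact: (Astar_gt0 hd hbeta hp hgamma0). Qed.
Let dR0 : (0 : R) < d%:R. Proof. by rewrite ltr0n. Qed.
Let Xb0 : 0 < Xb.
Proof. by rewrite divr_gt0// W_decr// nj. Qed.
Let Xd0 : 0 < Xd.
Proof.
rewrite divr_gt0//; have -> : m + 2 = m + 1 + 1 by ring.
by rewrite W_decr// nj// lerDl.
Qed.

Let u0 : 0 <= u. Proof. by rewrite divr_ge0// ltW// (theta_gt0 hd hbeta hp). Qed.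
Let v0 : 0 <= v.
Proof. by rewrite divr_ge0 ?subr_ge0 ?(theta_le1 hd hbeta hp)// addr_ge0// ltW. Qed.
Let w0 : 0 < w. Proof. by rewrite invr_gt0 mulr_gt0. Qed.

(** The strict inequality of the second variation leaves room for an error eta
    in the expansions of the two power terms. *)
Let second_order_gain : exists eta a b c : R,
  [/\ 0 < eta, a = A2 / Astar d beta gamma p,
      b = ((p + 1) * p / 2 + eta) * Xb / W (m - 1) /\ eta < (p + 1) * p / 2,
      c = ((2 * p) * (2 * p - 1) / 2 - eta) * Xd / W m /\ 0 < c &
      u * a + v * b < w * c].
Proof.
have := variation_gt0; set g := _ - _ => gpos.
pose L := w * (Xd / W m) + v * (Xb / W (m - 1)).
have L0 : 0 <= L.
  exact: (addr_ge0 (mulr_ge0 (ltW w0) (divr_ge0 (ltW Xd0) (ltW Dstar0)))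
    (mulr_ge0 v0 (divr_ge0 (ltW Xb0) (ltW Bstar0)))).
have L1 : 0 < L + 1 by rewrite ltr_wpDl.
have pp : 0 < p * p by rewrite mulr_gt0.
have c1 : 0 < (p + 1) * p / 4 by rewrite divr_gt0// mulr_gt0// addr_gt0.
have c2 : 0 < (2 * p) * (2 * p - 1) / 4.
  by rewrite divr_gt0// !mulr_gt0//; have := p1; lra.
have g1 : 0 < g / (L + 1) / 2 by rewrite !divr_gt0.
pose eta := Num.min (g / (L + 1) / 2) (Num.min ((p + 1) * p / 4) ((2 * p) * (2 * p - 1) / 4)).
have eta0 : 0 < eta by rewrite !lt_min g1 c1 c2.
have eg : eta <= g / (L + 1) / 2 by rewrite ge_min lexx.
have e1 : eta <= (p + 1) * p / 4 by rewrite !ge_min lexx orbT.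
have e2 : eta <= (2 * p) * (2 * p - 1) / 4 by rewrite !ge_min lexx !orbT.
exists eta, (A2 / Astar d beta gamma p), (((p + 1) * p / 2 + eta) * Xb / W (m - 1)),
  (((2 * p) * (2 * p - 1) / 2 - eta) * Xd / W m); split=> //.
- by split=> //; lra.
- by split=> //; rewrite divr_gt0// mulr_gt0//; lra.
- have eL : eta * L < g.
    apply: (@le_lt_trans _ _ (eta * (L + 1))); first by rewrite ler_pM2l// lerDl.
    have h2 : eta * (L + 1) <= g / 2.
      by rewrite -ler_pdivlMr// mulrAC.
    by apply: (le_lt_trans h2); rewrite ltr_pdivrMr// ltr_pMr// ltr1n.
  move: eL; rewrite /g /L => eL; rewrite -subr_gt0.
  set ex := (X in 0 < X); have -> : ex = (w * ((2 * p) * (2 * p - 1) / 2 * Xd / W m) -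
    (u * (A2 / Astar d beta gamma p) + v * ((p + 1) * p / 2 * Xb / W (m - 1)))) -
     eta * (w * (Xd / W m) + v * (Xb / W (m - 1))).
    rewrite /ex; move: (Xd) (Xb) (A2 / _) (W m) (W (m - 1)) (u) (v) (w) => x1 x2 x3 x4 x5 x6 x7 x8.
    ring.
  by rewrite subr_gt0.
Qed.

(** First e is chosen so small that the second-order comparison holds for the
    limit integrals; the strict inequality then persists for some regularisation
    h = 1/(k + 1). The constant L lies strictly between Lam and the limit
    quotient. *)
Lemma trial_beats_radial : exists (W0 : 'rV[R]_d -> R) (L : R),
  [/\ C0infty W0, Lam d beta gamma p < L &
    forall C, CKN_ineq beta gamma p C W0 -> L <= C].
Proof.
have [eta [a [b [c [eta0 aE [bE eb] [cE c0] gain]]]]] := second_order_gain.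
have [t0 t00 tP] := first_order_comparison u0 v0 w0 c0 gain.
have q1 : 1 < p + 1 by rewrite ltrDr.
have q2 : 1 < 2 * p by have := p1; lra.
have [tb /andP[tb0 _] bP] := even_power_expansion q1 eta0.
have [td /andP[td0 _] dP] := even_power_expansion q2 eta0.
(* the bound (2 (1 + |a|))^-1 on e keeps 1 + e^2 a positive *)
have K0 : 0 < (2 * (1 + `|a|))^-1 by rewrite invr_gt0 mulr_gt0// ltr_pwDl.
have [e [e0 e1 et] [eb' ed ea]] : exists2 e : R, [/\ 0 < e, e <= 1 & e <= t0 / 2] &
    [/\ e <= tb, e <= td & e <= (2 * (1 + `|a|))^-1].
  exists (Num.min 1 (Num.min (t0 / 2) (Num.min tb (Num.min td (2 * (1 + `|a|))^-1)))).
    by rewrite !lt_min ltr01 tb0 td0 K0 divr_gt0// !ge_min !lexx !orbT.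
  by rewrite !ge_min !lexx !orbT.
have ne : `|e| = e by exact: gtr0_norm.
have ne1 : `|e| <= 1 by rewrite ne.
have e20 : 0 < e ^+ 2 by exact: exprn_gt0.
have e2e : e ^+ 2 <= e by rewrite expr2 ler_piMr// ltW.
have e2t : 0 < e ^+ 2 < t0.
  by rewrite e20; apply: (le_lt_trans (le_trans e2e et)); rewrite ltr_pdivrMr// ltr_pMr// ltr1n.
have ebb : `|e| / 2 <= tb by rewrite ne (le_trans _ eb')// ler_pdivrMr// ler_peMr ?(ltW e0)// ler1n.
have edd : `|e| / 2 <= td by rewrite ne (le_trans _ ed)// ler_pdivrMr// ler_peMr ?(ltW e0)// ler1n.
have ta0 : 0 < 1 + e ^+ 2 * a.
  have : `|e ^+ 2 * a| < 1.
    rewrite normrM (gtr0_norm e20); apply: (@le_lt_trans _ _ (e * `|a|)).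
      exact: ler_wpM2r.
    have a1 : 0 < 1 + `|a| by rewrite ltr_pwDl.
    apply: (@le_lt_trans _ _ ((2 * (1 + `|a|))^-1 * `|a|)); first exact: ler_wpM2r.
    rewrite mulrC ltr_pdivrMr ?mulr_gt0// mul1r.
    by have := normr_ge0 a; lra.
  by rewrite ltr_norml => /andP[h _]; rewrite -ltrBlDl sub0r.
have p20 : 0 < 2 * p by rewrite mulr_gt0.
have pp0 : 0 < p + 1 by rewrite addr_gt0.
have jb : d%:R - gamma < 2 * al * ((p + 1) * (m / 2 - 1)) by rewrite -mp1.
have jd : d%:R - gamma < 2 * al * ((2 * p) * (m / 2 - 1)).
  by rewrite -mp2 (lt_trans Nm1)// ltr_pM2l ?mulr_gt0// gtrBl.
have [vA [A0 cA [hA hA0]]] := grad_density_cvg i0 d0 hgamma0 beta0 al0 m2 Nm1 ne1.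
have [vB [B0 cB [hB hB0]]] := val_density_cvg i0 d0 hgamma0 al0 m2 ne1 pp0 jb.
have [vD [D0 cD [hD hD0]]] := val_density_cvg i0 d0 hgamma0 al0 m2 ne1 p20 jd.
have AE : A0 = Astar d beta gamma p * (1 + e ^+ 2 * a).
  have -> : A0 = Astar d beta gamma p + e ^+ 2 * A2.
    by rewrite (grad_density_limit d0 hgamma0 beta0 al0 Nm1 hA0) -Astar_trial.
  rewrite aE; have := Astar0; move: (Astar d beta gamma p) (A2) => As A As0.
  by field; rewrite gt_eqF.
have m11 : m - 1 + 1 = m by rewrite subrK.
have m12 : m - 1 + 2 = m + 1 by ring.
have BE : W (m - 1) < B0 /\ B0 <= W (m - 1) * (1 + e ^+ 2 * b).
  have := val_density_limit d0 hgamma0 al0 Nm1 ne1 mp1 pp0 (lexx _) ebb bP hB0.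
  rewrite m11 m12 -/(W _) -/(W _) -/(W _) -/Xb bE.
  have xb : 0 < e ^+ 2 * Xb by exact: mulr_gt0.
  have -> : W (m - 1) * (1 + e ^+ 2 * (((p + 1) * p / 2 + eta) * Xb / W (m - 1))) =
      W (m - 1) + ((p + 1) * p / 2 + eta) * (e ^+ 2 * Xb).
    by have := Bstar0; move: (W (m - 1)) (Xb) => w1 x1 w10; field; rewrite gt_eqF.
  have eb2 := mulr_gt0 (etrans (subr_gt0 _ _) eb) xb.
  rewrite ler_norml (_ : p + 1 - 1 = p); last by ring.
  by move: eb2; move: (W (m - 1)) (e ^+ 2 * Xb) => w1 x1 eb2 /andP[h1 h2]; split; lra.
have DE : W m * (1 + e ^+ 2 * c) <= D0.
  have mm : m - 1 <= m by rewrite gerBl.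
  have := val_density_limit d0 hgamma0 al0 Nm1 ne1 mp2 p20 mm edd dP hD0.
  rewrite -/(W _) -/(W _) -/(W _) -/Xd cE.
  have -> : W m * (1 + e ^+ 2 * ((2 * p * (2 * p - 1) / 2 - eta) * Xd / W m)) =
      W m + (2 * p * (2 * p - 1) / 2 - eta) * (e ^+ 2 * Xd).
    by have := Dstar0; move: (W m) (Xd) => w1 x1 w10; field; rewrite gt_eqF.
  by rewrite ler_norml; move: (W m) (e ^+ 2 * Xd) => w1 x1 /andP[h1 h2]; lra.
have A00 : 0 < A0 by rewrite AE mulr_gt0.
have B00 : 0 < B0 by apply: (lt_trans Bstar0); case: BE.
have tc0 : 0 <= 1 + e ^+ 2 * c by rewrite addr_ge0// mulr_ge0// ltW.
have D00 : 0 < D0.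
  by apply: (lt_le_trans _ DE); rewrite mulr_gt0// ltr_pwDl// mulr_ge0// ltW.
have AE' : A0 <= Astar d beta gamma p * (1 + e ^+ 2 * a) by rewrite AE.
have quot := strict_quotient Astar0 Bstar0 Dstar0 u0 v0 w0 tc0 A00 AE' B00 BE.2 DE (tP _ e2t).
have AB0 : 0 < A0 `^ u * B0 `^ v by rewrite mulr_gt0 ?powR_gt0.
have LE : Lam d beta gamma p = W m `^ w / (Astar d beta gamma p `^ u * W (m - 1) `^ v) by [].
rewrite -LE in quot.
have : Lam d beta gamma p < D0 `^ w / (A0 `^ u * B0 `^ v) by rewrite ltr_pdivlMr.
move=> /midf_lt [L1 L2].
set L := (_ + _) / 2 in L1 L2.
have L3 : 0 < D0 `^ w - L * (A0 `^ u * B0 `^ v) by rewrite subr_gt0 -ltr_pdivlMr.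
have cAB : (fun k => vA k `^ u * vB k `^ v) @ \oo --> A0 `^ u * B0 `^ v.
  by apply: cvgM; apply: cvg_powR_gt0.
have cF : (fun k => vD k `^ w - L * (vA k `^ u * vB k `^ v)) @ \oo -->
    D0 `^ w - L * (A0 `^ u * B0 `^ v).
  by apply: cvgB; [exact: cvg_powR_gt0|exact: cvgMl_tmp].
have [k [k1 k2]] := filter_ex (filterI (cvgr_gt _ cAB _ AB0) (cvgr_gt _ cF _ L3)).
have ek0 : 0 < k.+1%:R^-1 :> R by rewrite invr_gt0.
exists (trial beta gamma m e k.+1%:R^-1 i0), L; split=> [||C].
- exact: trial_C0infty.
- exact: L1.
rewrite /CKN_ineq (wnorm_trial (hD k)) (wnorm_trial (hB k)) (wnorm_grad_trial ek0 (hA k)).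
rewrite !poweR_EFin -!EFinM lee_fin -!powRrM.
have -> : 2^-1 * th = u by rewrite mulrC.
have -> : (p + 1)^-1 * (1 - th) = v by rewrite mulrC.
rewrite -mulrA => hC; rewrite -(ler_pM2r k1).
by apply: le_trans hC; rewrite -subr_ge0 ltW.
Qed.

Lemma best_constant_lt : (C_CKN_rad d beta gamma p < C_CKN d beta gamma p)%E.
Proof.
have [W0 [L [W0K L1 LP]]] := trial_beats_radial.
apply: (@le_lt_trans _ _ (Lam d beta gamma p)%:E).
  apply: ereal_inf_lbound; exists (Lam d beta gamma p) => // w' Kw.
  exact: (radial_CKN_ineq hd hbeta hp hgamma0 Kw).
apply: (@lt_le_trans _ _ L%:E); first by rewrite lte_fin.
by apply/ereal_infP => _ [C hC <-]; rewrite lee_fin; exact: (LP C (hC _ W0K)).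
Qed.

End symmetry_breaking.

Theorem theorem2 (R : realType) (d : nat) (beta gamma p : R)
  (hd : (2 <= d)%N)
  (hbeta : gamma - 2 < beta < (d%:R - 2) / d%:R * gamma)
  (hgamma : gamma < d%:R)
  (hp : 1 < p <= p_star d beta gamma)
  (hgamma0 : gamma < 0)
  (hFS : beta_FS d gamma < beta < (d%:R - 2) / d%:R * gamma) :
  (C_CKN_rad d beta gamma p < C_CKN d beta gamma p)%E.
Proof.
have /andP[hFS1 _] := hFS.
exact: (best_constant_lt hd hbeta hp hgamma0 hFS1).
Qed.
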